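(* Let $\alpha,\gamma,c,\kappa,p\in[0,\infty)$, $\Theta=\bigcup_{n\in\mathbb N}\mathbb Z^n$, let $\xi_d\in\mathbb R^d$, $d\in\mathbb N$, let $L^{d,K}_k\in\mathbb R$ and $f^{d,K}_k\in C(\mathbb R^d\times\mathbb R,\mathbb R)$, $k\in\{0,1,\dots,K\}$, $d,K\in\mathbb N$, satisfy for all $d,K\in\mathbb N$, $k\in\{0,\dots,K\}$, $x\in\mathbb R^d$, $a,b\in\mathbb R$ that $$|(f^{d,K}_k(x,a)-a)-(f^{d,K}_k(x,b)-b)|\le L^{d,K}_k|a-b|.$$ For every $d,K\in\mathbb N$, $k\in\{0,\dots,K\}$ let $\phi^{d,K}_k\colon\mathbb R^d\times\mathbb R^d\to\mathbb R^d$ be Borel measurable. Let $(\Omega,\mathcal F,\mathbb P)$ be a probability space. For every $d,K\in\mathbb N$ let $W^{d,K,\theta}=(W^{d,K,\theta}_k)_{k\in\{0,\dots,K\}}\colon\{0,\dots,K\}\times\Omega\to\mathbb R^d$, $\theta\in\Theta$, be i.i.d. stochastic processes such that for all $\theta\in\Theta$ the random variables $W^{d,K,\theta}_0,W^{d,K,\theta}_1,\dots,W^{d,K,\theta}_{K-1}$ are independent. For every $d,K\in\mathbb N$ let $\mathcal R^{d,K,\theta}=(\mathcal R^{d,K,\theta}_k)_{k\in\{0,\dots,K\}}\colon\{0,\dots,K\}\times\Omega\to\mathbb N_0$, $\theta\in\Theta$, be i.i.d. stochastic processes. Let $\mathfrak p^{d,K}_{k,l}\in(0,\infty)$, $l\in\mathbb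 N_0$, $k\in\{1,\dots,K\}$, $d,K\in\mathbb N$, and assume for all $d,K\in\mathbb N$, $\theta\in\Theta$, $k\in\{1,\dots,K\}$, $l\in\{0,\dots,k-1\}$ that $$\mathcal R^{d,K,\theta}_k\le k-1,\qquad \mathfrak p^{d,K}_{k,l}\,\mathbb P(\mathcal R^{d,K,0}_k=l)=|\mathbb P(\mathcal R^{d,K,0}_k=l)|^2,\qquad L^{d,K}_l\le c\,\mathbb P(\mathcal R^{d,K,0}_k=l).$$ Assume for all $d,K\in\mathbb N$ that $(\mathcal R^{d,K,\theta})_{\theta\in\Theta}$ and $(W^{d,K,\theta})_{\theta\in\Theta}$ are independent. For every $d,K\in\mathbb N$, $k\in\{0,\dots,K\}$, $\theta\in\Theta$ let $X^{d,K,\theta,k}=(X^{d,K,\theta,k,x}_l)_{(l,x)\in\{0,\dots,k\}\times\mathbb R^d}\colon\{0,\dots,k\}\times\mathbb R^d\times\Omega\to\mathbb R^d$ satisfy for all $l\in\{0,\dots,k\}$, $x\in\mathbb R^d$ that $$X^{d,K,\theta,k,x}_l=\begin{cases}x&:l=k\\ \phi^{d,K}_l(X^{d,K,\theta,k,x}_{l+1},W^{d,K,\theta}_l)&:l<k.\end{cases}$$ For every $d,K\in\mathbb N$ let $v^{d,K}_k\colon\mathbb R^d\to\mathbb R$, $k\in\{0,\dots,K\}$, be Borel measurable, and assume for all $d,K\in\mathbb N$, $k\in\{1,\dots,K\}$, $x\in\mathbb R^d$ that $$\mathbb E\Big[|v^{d,K}_0(X^{d,K,0,k,x}_0)|^2+\sum_{l=0}^{k-1}|f^{d,K}_l(X^{d,K,0,k,x}_l,0)|^2\Big]<\infty,$$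 $$\big(\mathbb E[|v^{d,K}_0(X^{d,K,0,K,\xi_d}_0)|^2]\big)^{1/2}+\sum_{l=0}^{K-1}\big(\mathbb E[|f^{d,K}_l(X^{d,K,0,K,\xi_d}_l,0)|^2]\big)^{1/2}\le\kappa,$$ $$v^{d,K}_k(x)=\mathbb E\big[f^{d,K}_{k-1}\big(X^{d,K,0,k,x}_{k-1},v^{d,K}_{k-1}(X^{d,K,0,k,x}_{k-1})\big)\big].$$ Let $V^{d,K,\theta}_{k,n,M}\colon\mathbb R^d\times\Omega\to\mathbb R$, $\theta\in\Theta$, $k\in\{0,\dots,K\}$, $n\in\mathbb N_0$, $d,K,M\in\mathbb N$, satisfy for all $d,K,M\in\mathbb N$, $n\in\mathbb N_0$, $\theta\in\Theta$, $k\in\{0,\dots,K\}$, $x\in\mathbb R^d$, writing $\vartheta=(\theta,j,m)$, $\bar\vartheta=(\theta,j,-m)$, $r=\mathcal R^{d,K,(\theta,j,m)}_k$, $Y=X^{d,K,(\theta,j,m),k,x}_{r}$ inside the double sum, that $$\begin{aligned}V^{d,K,\theta}_{k,n,M}(x)&=\frac{\mathbb 1_{\mathbb N}(n)}{M^n}\sum_{m=1}^{M^n}\Big[v^{d,K}_0(X^{d,K,(\theta,0,-m),k,x}_0)+\sum_{l=0}^{k-1}f^{d,K}_l(X^{d,K,(\theta,0,m),k,x}_l,0)\Big]\\&\quad+\sum_{j=1}^{n-1}\frac1{M^{n-j}}\sum_{m=1}^{M^{n-j}}\frac{\mathbb 1_{\mathbb N}(k)}{\mathfrak p^{d,K}_{k,r}}\Big[f^{d,K}_r\big(Y,V^{d,K,\vartheta}_{r,j,M}(Y)\big)-V^{d,K,\vartheta}_{r,j,M}(Y)-f^{d,K}_r\big(Y,V^{d,K,\bar\vartheta}_{r,j-1,M}(Y)\big)+V^{d,K,\bar\vartheta}_{r,j-1,M}(Y)\Big].\end{aligned}$$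 Let $\mathfrak C^{d,K}_{M,n}\in\mathbb R$, $d,K,M,n\in\mathbb N_0$, satisfy for all $d,K,M\in\mathbb N$, $n\in\mathbb N_0$ that $$\mathfrak C^{d,K}_{M,n}\le\gamma K^\alpha d^pM^n+\sum_{j=1}^{n-1}M^{n-j}\big(1+\gamma K^\alpha d^p+\mathfrak C^{d,K}_{M,j}+\mathfrak C^{d,K}_{M,j-1}\big).$$ Then: (i) for all $d,K,M\in\mathbb N$, $N\in\mathbb N_0$ it holds that $$\Big(\mathbb E\big[|V^{d,K,0}_{K,N,M}(\xi_d)-v^{d,K}_K(\xi_d)|^2\big]\Big)^{1/2}\le\kappa(1+2c)^NM^{-N/2}\exp\big(\tfrac M2+c\big);$$ (ii) there exist $\mathfrak N=(\mathfrak N_\varepsilon)_{\varepsilon\in(0,1]}\colon(0,1]\to\mathbb N$ and $\mathfrak c=(\mathfrak c_\delta)_{\delta\in(0,1]}\colon(0,1]\to[0,\infty)$ such that for all $d,K\in\mathbb N$, $\delta,\varepsilon\in(0,1]$ it holds that $\mathfrak C^{d,K}_{\mathfrak N_\varepsilon,\mathfrak N_\varepsilon}\le\mathfrak c_\delta K^\alpha d^p\varepsilon^{-(2+\delta)}$ and $$\Big(\mathbb E\big[|V^{d,K,0}_{K,\mathfrak N_\varepsilon,\mathfrak N_\varepsilon}(\xi_d)-v^{d,K}_K(\xi_d)|^2\big]\Big)^{1/2}\le\varepsilon.$$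
   Context: $\mathbb N=\{1,2,3,\dots\}$, $\mathbb N_0=\mathbb N\cup\{0\}$, $\mathbb 1_{\mathbb N}$ is the indicator function of $\mathbb N$. Elements of $\Theta=\bigcup_{n\in\mathbb N}\mathbb Z^n$ are finite tuples of integers; integers are identified with elements of $\mathbb Z^1\subseteq\Theta$ (so $0\in\Theta$), and for $\theta\in\mathbb Z^n$, $j,m\in\mathbb Z$ the symbol $(\theta,j,m)\in\mathbb Z^{n+2}$ denotes the tuple obtained by appending $j$ and $m$ to $\theta$. Empty sums are $0$. In the defining equation for $V^{d,K,\theta}_{k,n,M}$ the second (double) sum is understood to be $0$ if $k=0$ (because of the factor $\mathbb 1_{\mathbb N}(k)$). *)

(* Defs.v *)
From HB Require Import structures.
From mathcomp Require Import all_boot all_order all_algebra finmap.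
From mathcomp Require Import all_classical all_reals all_analysis.

Set Implicit Arguments.
Unset Strict Implicit.
Unset Printing Implicit Defensive.

Import Order.TTheory GRing.Theory Num.Theory.
Import numFieldNormedType.Exports.

Local Open Scope classical_set_scope.
Local Open Scope ring_scope.

(** The topological space [T] with its Borel sigma-algebra. For a product space
    this is the sigma-algebra generated by the open sets of the product topology. *)
Notation borel T := (g_sigma_algebraType (@open T)).

(** The index set [\bigcup_(n >= 1) Z^n]; [theta_int] is the identification of
    the integers with [Z^1]. *)
Definition Theta := {s : seq int | (0 < size s)%N}.

Definition theta_int (z : int) : Theta := exist _ [:: z] isT.

Fact theta_app_subproof (theta : Theta) (j m : int) :
  (0 < size (val theta ++ [:: j; m]))%N.
Proof. by rewrite size_cat addn2. Qed.

Definition theta_app (theta : Theta) (j m : int) : Theta :=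
  exist _ (val theta ++ [:: j; m]) (theta_app_subproof theta j m).

(** A process [(Z_k)_(0 <= k <= K)] as a random element of the [(K+1)]-fold
    product of [T], tuples carrying the product sigma-algebra. Only the times
    [k <= K] of the sequence [Z] enter. *)
Definition proc {Omega T : Type} (K : nat) (Z : nat -> Omega -> T) :
  Omega -> K.+1.-tuple T := fun w => [tuple Z k w | k < K.+1].

Section independence.
Context {d : measure_display} {Omega : measurableType d} {R : realType}.
Variable P : probability Omega R.

Definition mutually_independent {d'} {T : measurableType d'} {I : choiceType}
    (X : I -> Omega -> T) : Prop :=
  forall (J : {fset I}) (B : I -> set T),
    (forall i, i \in J -> measurable (B i)) ->
    P (\bigcap_(i in [set` J]) (X i @^-1` B i)) =
    (\prod_(i <- J) P (X i @^-1` B i))%E.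

Definition identically_distributed {d'} {T : measurableType d'} {I : Type}
    (X : I -> Omega -> T) : Prop :=
  forall (i j : I) (B : set T), measurable B ->
    P (X i @^-1` B) = P (X j @^-1` B).

Definition iid {d'} {T : measurableType d'} {I : choiceType}
    (X : I -> Omega -> T) : Prop :=
  [/\ forall i, measurable_fun [set: Omega] (X i),
      mutually_independent X & identically_distributed X].

Definition sigma_of_family {d'} {T : measurableType d'} {I : Type}
    (X : I -> Omega -> T) : set (set Omega) :=
  <<s \bigcup_(i in [set: I]) preimage_set_system [set: Omega] (X i) measurable >>.

Definition independent_families {d1 d2} {T1 : measurableType d1}
    {T2 : measurableType d2} {I1 I2 : Type}
    (X : I1 -> Omega -> T1) (Y : I2 -> Omega -> T2) : Prop :=
  forall A B : set Omega, sigma_of_family X A -> sigma_of_family Y B ->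
    P (A `&` B) = (P A * P B)%E.

End independence.

(* Main.v *)
(* The scheme is a sum of sample means. Conditionally on the rest, the random
   time [r], chosen with law [p] and weighted by [1 / p], turns the increment at
   level [j] into an unbiased estimate of [delta_j - delta_(j-1)], where [delta_j]
   is the mean of [\sum_(l < k) g_l (V_(l,j)) - g_l (v_l)] along the chain and
   [g_l x a = f_l (x, a) - a]. Since [v_k] is the mean of
   [v_0 + \sum_(l < k) g_l (v_l)], the means of all levels telescope and the bias
   of [V_n] is exactly [delta_(n-1)]; what remains is centred and is an average of
   [M^(n-j)] independent copies at level [j], so independence divides its L2 norm
   by [M^((n-j)/2)]. The independence used is that of the noises indexed by
   disjoint sets of nodes of the tree [Theta]. As [L_l <= c p_(k,l)], the second
   moment of an increment is at most [c \sum_(l < k) L_l |V_l - v_l|^2]. Measuring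
   the error at time [k] relative to the square root of the weight
   [rho_k = \prod_(l < k) (1 + M L_l / c)] makes this sum telescope, and every use
   of the recursion then costs a factor [c / sqrt M]. Finally [rho_K <= e^M]
   because the [L_l] sum to at most [c]. For the cost, the error bound at
   [M = n] decays like [n^(-n/2)] while the cost grows like [(3n)^n]. *)
Require Import Defs.
From HB Require Import structures.
From mathcomp Require Import all_boot all_order all_algebra finmap.
From mathcomp Require Import all_classical all_reals all_analysis.
From mathcomp Require Import measurable_realfun ring lra.

Set Implicit Arguments.
Unset Strict Implicit.
Unset Printing Implicit Defensive.

Import Order.TTheory GRing.Theory Num.Theory.
Import numFieldNormedType.Exports.

Local Open Scope classical_set_scope.
Local Open Scope ring_scope.

(** * Independence and equality in law *)

(** Neither measurability of [V] nor its dependence on the noise is assumed; both are extracted from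
    the recursion. The device is to write [V theta k n x] as one jointly measurable function, the
    same for all [theta], of [x] and of the noise strictly below [theta]. This yields at once
    measurability, equality in law across nodes and independence of whatever is built on disjoint
    index sets, in particular of a node's own chain and random time from the [V] at that node. Joint
    measurability matters because [V] is evaluated at random positions. The induction on the level
    needs a bound at every time and starting point, while [kappa] controls only [xi]. Errors are
    therefore bounded relative to [kap k x], the size of the data seen from [x] at time [k], which
    does not grow in mean square along the chain. Constants: [expR c] is the Gronwall factor in the
    error of the trivial approximation [0]; [1 + 2 * c] appears because the error of a level enters
    twice, through the increments of two consecutive levels; [expR (M / 2)] bounds the square root
    of the weight. *)

Section integral_distribution_unconditional.
Local Open Scope ereal_scope.
Context {d d' : measure_display} {T : measurableType d} {T' : measurableType d'}.
Context {R : realType}.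
Variable P : probability T R.

(* Unlike [integral_distribution], no integrability is required: both sides are
   differences of the same nonnegative integrals. *)
Lemma integral_distributionE (X : {mfun T >-> T'}) (f : T' -> \bar R) :
  measurable_fun setT f -> \int[distribution P X]_y f y = \int[P]_x f (X x).
Proof.
move=> mf; rewrite integralE [RHS]integralE -[fun x => f (X x)]/(f \o X).
rewrite (funepos_comp f X) (funeneg_comp f X); congr (_ - _).
  by rewrite ge0_integral_distribution//; exact: measurable_funepos.
by rewrite ge0_integral_distribution//; exact: measurable_funeneg.
Qed.

End integral_distribution_unconditional.

Section independent_maps.
Local Open Scope ereal_scope.
Context {d d1 d2 : measure_display} {Omega : measurableType d} {R : realType}.
Context {T1 : measurableType d1} {T2 : measurableType d2}.
Variable P : probability Omega R.

Definition independent_maps (Y1 : Omega -> T1) (Y2 : Omega -> T2) : Prop :=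
  forall A B, measurable A -> measurable B ->
    P (Y1 @^-1` A `&` Y2 @^-1` B) = P (Y1 @^-1` A) * P (Y2 @^-1` B).

Variables (Y1 : Omega -> T1) (Y2 : Omega -> T2).
Hypotheses (mY1 : measurable_fun setT Y1) (mY2 : measurable_fun setT Y2).
Hypothesis Y12 : independent_maps Y1 Y2.

Let Y w := (Y1 w, Y2 w).

Let mY : measurable_fun setT Y.
Proof. exact: measurable_fun_pair. Qed.

HB.instance Definition _ := isMeasurableFun.Build _ _ _ _ Y1 mY1.
HB.instance Definition _ := isMeasurableFun.Build _ _ _ _ Y2 mY2.
HB.instance Definition _ := isMeasurableFun.Build _ _ _ _ Y mY.

Lemma independent_maps_law (A : set (T1 * T2)) : measurable A ->
  (distribution P Y1 \x distribution P Y2) A =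
  distribution P Y A.
Proof.
by move=> mA; apply: (product_measure_unique (m' := distribution P Y)).
Qed.

(** Independence makes the law of the pair a product measure, where Tonelli's theorem applies. This
    replaces conditioning: a random field evaluated at an independent random point is integrated
    first with the point frozen. *)
Lemma ge0_integral_independent (h : T1 * T2 -> \bar R) :
  measurable_fun [set: T1 * T2] h -> (forall z, 0 <= h z) ->
  \int[P]_w h (Y1 w, Y2 w) = \int[P]_w \int[P]_w' h (Y1 w, Y2 w').
Proof.
move=> mh h0.
transitivity (\int[distribution P Y]_z h z).
  by rewrite ge0_integral_pushforward.
rewrite -(eq_measure_integral _ (fun A mA _ => independent_maps_law mA)).
rewrite fubini_tonelli1//.
rewrite ge0_integral_distribution//; last 2 first.
  exact: measurable_fun_fubini_tonelli_F.
  by move=> y; exact: integral_ge0.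
apply: eq_integral => w _ /=.
rewrite /fubini_F ge0_integral_distribution//.
exact: measurable_fun_pair2.
Qed.

Lemma integral_independent (h : T1 * T2 -> \bar R) :
  measurable_fun [set: T1 * T2] h ->
  P.-integrable setT (fun w => h (Y1 w, Y2 w)) ->
  \int[P]_w h (Y1 w, Y2 w) = \int[P]_w \int[P]_w' h (Y1 w, Y2 w').
Proof.
move=> mh ih.
have ih' : (distribution P Y1 \x distribution P Y2).-integrable setT h.
  have : (distribution P Y).-integrable setT h.
    exact: integrable_pushforward.
  move=> /integrableP[_ h1]; apply/integrableP; split => //.
  by rewrite (eq_measure_integral _ (fun A mA _ => independent_maps_law mA)).
transitivity (\int[distribution P Y]_z h z).
  by rewrite integral_pushforward.
rewrite -(eq_measure_integral _ (fun A mA _ => independent_maps_law mA)).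
rewrite -integral12_prod_meas1//.
rewrite integral_distributionE; last exact: (measurable_fubini_F ih').
apply: eq_integral => w _ /=.
rewrite /fubini_F integral_distributionE//.
exact: measurable_fun_pair2.
Qed.

End independent_maps.

Section same_law.
Local Open Scope ereal_scope.
Context {d d1 : measure_display} {Omega : measurableType d} {R : realType}.
Context {T1 : measurableType d1}.
Variable P : probability Omega R.

Definition same_law (Y Z : Omega -> T1) : Prop :=
  forall A, measurable A -> P (Y @^-1` A) = P (Z @^-1` A).

Lemma integral_same_law (Y Z : Omega -> T1) (h : T1 -> \bar R) :
  measurable_fun setT Y -> measurable_fun setT Z -> same_law Y Z ->
  measurable_fun setT h ->
  \int[P]_w h (Y w) = \int[P]_w h (Z w).
Proof.
move=> mY mZ YZ mh.
pose mY' := isMeasurableFun.Build _ _ _ _ Y mY.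
pose Y' : {mfun Omega >-> T1} := HB.pack Y mY'.
pose mZ' := isMeasurableFun.Build _ _ _ _ Z mZ.
pose Z' : {mfun Omega >-> T1} := HB.pack Z mZ'.
transitivity (\int[distribution P Y']_z h z).
  by rewrite integral_distributionE.
rewrite (eq_measure_integral (distribution P Z')).
  by rewrite integral_distributionE.
by move=> A mA _; exact: YZ.
Qed.

End same_law.

(** * Independence of sigma-algebras generated over disjoint index sets *)

Section pi_systems.
Local Open Scope ereal_scope.
Context {d : measure_display} {Omega : measurableType d} {R : realType}.
Context {I : choiceType}.
Variable S : I -> set (set Omega).
Hypothesis S_meas : forall i A, S i A -> measurable A.
Hypothesis S_setI : forall i, setI_closed (S i).
Hypothesis S_setT : forall i, S i setT.

(* Choosing [setT] outside a finite set of indices keeps the family [B] total,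
   which makes these finite intersections trivially stable under [`&`]. *)
Definition finite_meet (D : set I) : set (set Omega) :=
  [set A | exists (J : {fset I}) (B : I -> set Omega),
    [/\ forall i, i \in J -> D i, forall i, S i (B i),
        forall i, i \notin J -> B i = setT & A = \bigcap_i B i]].

Lemma finite_meet_setT D : finite_meet D setT.
Proof.
exists fset0, (fun=> setT); split => //.
by apply/esym; rewrite -subTset => w _ i _.
Qed.

Lemma finite_meet_setI D : setI_closed (finite_meet D).
Proof.
move=> _ _ [J [B [JD SB BT ->]]] [J' [B' [JD' SB' BT' ->]]].
exists (J `|` J')%fset, (fun i => B i `&` B' i); split => [i|i|i|].
- by rewrite inE => /orP[/JD|/JD'].
- exact: S_setI.
- by rewrite inE negb_or => /andP[/BT -> /BT' ->]; rewrite setIT.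
- by rewrite bigcapI.
Qed.

Lemma finite_meet_measurable D A : finite_meet D A -> measurable A.
Proof.
move=> [J [B [_ SB BT ->]]].
have -> : \bigcap_i B i = \bigcap_(i in [set` J]) B i.
  apply/seteqP; split => w Bw i _; first exact: Bw.
  by have [/Bw//|/BT ->] := boolP (i \in J).
rewrite bigcap_fset big_seq.
by elim/big_ind: _ => //= [X Y|i _]; [exact: measurableI|exact: S_meas (SB i)].
Qed.

Lemma sub_finite_meet (D : set I) i : D i -> S i `<=` finite_meet D.
Proof.
move=> Di A SA.
exists [fset i]%fset, (fun k => if k == i then A else setT); split.
- by move=> k; rewrite inE => /eqP ->.
- by move=> k; case: eqP => [->|].
- by move=> k; rewrite inE => /negPf ->.
- apply/seteqP; split => [w Aw k _|w /(_ i Logic.I)]; first by case: eqP.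
  by rewrite eqxx.
Qed.

Lemma sigma_sub_finite_meet (D : set I) :
  <<s \bigcup_(i in D) S i >> `<=` <<s finite_meet D >>.
Proof.
apply: sub_smallest2r; first exact: smallest_sigma_algebra.
by move=> A [i Di SA]; exact: (sub_finite_meet Di).
Qed.

Lemma sigma_family_measurable (D : set I) A :
  <<s \bigcup_(i in D) S i >> A -> measurable A.
Proof.
apply: smallest_sub; first exact: sigma_algebra_measurable.
by move=> {}A [i _] /S_meas.
Qed.

Lemma finite_meet_measure_unique (D : set I)
  (m1 m2 : {measure set Omega -> \bar R}) :
  m1 setT < +oo -> (forall A, finite_meet D A -> m1 A = m2 A) ->
  forall A, <<s \bigcup_(i in D) S i >> A -> m1 A = m2 A.
Proof.
move=> m1T m12 A /sigma_sub_finite_meet sA.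
apply: (@g_sigma_algebra_measure_unique _ _ _ (finite_meet D) _ (fun=> setT)) => //.
- by move=> B; exact: finite_meet_measurable.
- by move=> _; exact: finite_meet_setT.
- by rewrite bigcup_const//; exists 0%N.
- exact: finite_meet_setI.
Qed.

Variable P : probability Omega R.
Hypothesis S_indep : forall (J : {fset I}) (B : I -> set Omega),
  (forall i, S i (B i)) -> (forall i, i \notin J -> B i = setT) ->
  P (\bigcap_i B i) = \prod_(i <- J) P (B i).

(** Two passes through uniqueness of measures, one per argument, carry the product formula from
    finite meets to the generated sigma-algebras. On finite meets it holds because no index
    constrains both sides, [D1] and [D2] being disjoint. *)
Lemma sigma_disjoint_independent (D1 D2 : set I) (A1 A2 : set Omega) :
  D1 `&` D2 = set0 ->
  <<s \bigcup_(i in D1) S i >> A1 -> <<s \bigcup_(i in D2) S i >> A2 ->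
  P (A1 `&` A2) = P A1 * P A2.
Proof.
move=> D12 sA1 sA2.
(* For fixed [C] both sides are finite measures in [A]: the restriction of [P] to [C], and [P]
   scaled by the number [P C]. *)
have extend (D : set I) (C : set Omega) : measurable C ->
    (forall A, finite_meet D A -> P (A `&` C) = P A * P C) ->
    forall A, <<s \bigcup_(i in D) S i >> A -> P (A `&` C) = P A * P C.
  move=> mC H A sA.
  have PC0 : (0 <= fine (P C))%R by exact: fine_ge0.
  have mscaleE B : mscale (NngNum PC0) P B = P B * P C.
    by rewrite /mscale/= fineK ?fin_num_measure// muleC.
  rewrite -mscaleE; apply: (@finite_meet_measure_unique D (mrestr P mC)) => //.
    rewrite /mrestr (le_lt_trans (probability_le1 _ _)) ?ltry//.
    exact: measurableI.
  by move=> B FB; rewrite [RHS]mscaleE; exact: H.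
have mA2 := sigma_family_measurable sA2.
apply: (extend D1) => // B1 FB1.
rewrite setIC muleC; apply: (extend D2) => //.
  exact: finite_meet_measurable FB1.
move=> B2 FB2; move: FB1 FB2.
move=> [J [B [JD SB BT ->]]] [J' [B' [JD' SB' BT' ->]]].
rewrite -bigcapI (S_indep (J := (J `|` J')%fset)); last 2 first.
- by move=> i; exact: S_setI.
- by move=> i; rewrite inE negb_or => /andP[/BT -> /BT' ->]; rewrite setIT.
rewrite (S_indep (J := (J `|` J')%fset))//; last first.
  by move=> i; rewrite inE negb_or => /andP[_ /BT' ->].
rewrite (S_indep (J := (J `|` J')%fset) (B := B))//; last first.
  by move=> i; rewrite inE negb_or => /andP[/BT ->].
rewrite -big_split/=; apply: eq_bigr => i _.
have [iJ|/BT ->] := boolP (i \in J); last by rewrite setIT probability_setT mule1.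
have [iJ'|/BT' ->] := boolP (i \in J').
  suff : set0 i by [].
  by rewrite -D12; split; [exact: JD|exact: JD'].
by rewrite setTI probability_setT mul1e.
Qed.

End pi_systems.

Section independence_of_maps.
Local Open Scope ereal_scope.
Context {d d1 d2 d3 d4 : measure_display} {Omega : measurableType d}.
Context {T1 : measurableType d1} {T2 : measurableType d2}.
Context {T3 : measurableType d3} {T4 : measurableType d4}.
Context {R : realType}.
Variable P : probability Omega R.

Lemma independent_maps_comp (Y1 : Omega -> T1) (Y2 : Omega -> T2)
    (g1 : T1 -> T3) (g2 : T2 -> T4) :
  measurable_fun setT g1 -> measurable_fun setT g2 ->
  independent_maps P Y1 Y2 -> independent_maps P (g1 \o Y1) (g2 \o Y2).
Proof.
move=> mg1 mg2 Y12 A B mA mB; apply: (Y12 (g1 @^-1` A) (g2 @^-1` B)).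
  by rewrite -[X in measurable X]setTI; exact: mg1.
by rewrite -[X in measurable X]setTI; exact: mg2.
Qed.

Lemma sigma_independent_maps (G1 G2 : set (set Omega))
    (Y1 : Omega -> T1) (Y2 : Omega -> T2) :
  (forall A1 A2, <<s G1 >> A1 -> <<s G2 >> A2 -> P (A1 `&` A2) = P A1 * P A2) ->
  measurable_fun setT (Y1 : g_sigma_algebraType G1 -> T1) ->
  measurable_fun setT (Y2 : g_sigma_algebraType G2 -> T2) ->
  independent_maps P Y1 Y2.
Proof.
move=> G12 mY1 mY2 A B mA mB; apply: G12.
  by rewrite -[X in _ X]setTI; exact: mY1.
by rewrite -[X in _ X]setTI; exact: mY2.
Qed.

Lemma same_law_pair (Y1 Z1 : Omega -> T1) (Y2 Z2 : Omega -> T2) :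
  measurable_fun setT Y1 -> measurable_fun setT Y2 ->
  measurable_fun setT Z1 -> measurable_fun setT Z2 ->
  independent_maps P Y1 Y2 -> independent_maps P Z1 Z2 ->
  same_law P Y1 Z1 -> same_law P Y2 Z2 ->
  same_law P (fun w => (Y1 w, Y2 w)) (fun w => (Z1 w, Z2 w)).
Proof.
move=> mY1 mY2 mZ1 mZ2 Y12 Z12 YZ1 YZ2 A mA.
rewrite -[LHS](independent_maps_law mY1 mY2 Y12 mA).
pose Z2' : {mfun Omega >-> T2} := HB.pack Z2 (isMeasurableFun.Build _ _ _ _ Z2 mZ2).
pose Z1' : {mfun Omega >-> T1} := HB.pack Z1 (isMeasurableFun.Build _ _ _ _ Z1 mZ1).
pose Y12' : {mfun Omega >-> (T1 * T2)%type} :=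
  HB.pack (fun w => (Z1 w, Z2 w)) (isMeasurableFun.Build _ _ _ _
    (fun w => (Z1 w, Z2 w)) (measurable_fun_pair mZ1 mZ2)).
rewrite (product_measure_unique (m' := distribution P Y12'))//.
move=> B C mB mC; rewrite [LHS]Z12//.
by congr (_ * _); apply/esym; [exact: YZ1|exact: YZ2].
Qed.

End independence_of_maps.

(** * The product sigma-algebra on families of random elements *)

Section cylinder.
Local Open Scope ereal_scope.

Definition coordinate_sets {J : Type} {d} (T : measurableType d) (j : J) :
    set (set (J -> T)) :=
  preimage_set_system setT (fun u : J -> T => u j) measurable.

Arguments coordinate_sets {J d} T j.

(** The product sigma-algebra for an arbitrary index type. With [Theta] as index, the whole noise
    below a node becomes a single random element. *)
Definition cylinder (J : Type) {d} (T : measurableType d) :=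
  g_sigma_algebraType (\bigcup_(j in [set: J]) coordinate_sets T j).

Arguments cylinder J {d} T.

Context {J : choiceType} {d} {T : measurableType d}.

Lemma measurable_coordinate (j : J) :
  measurable_fun setT (fun u : cylinder J T => u j).
Proof.
by move=> _ A mA; apply: sub_sigma_algebra; exists j => //; exists A.
Qed.

Lemma measurable_cylinder {d'} {T' : measurableType d'} (F : T' -> J -> T) :
  (forall j, measurable_fun setT (F^~ j)) ->
  measurable_fun setT (F : T' -> cylinder J T).
Proof.
move=> mF; apply: (@measurability _ _ T' (cylinder J T : measurableType _) setT F
  (\bigcup_(j in setT) coordinate_sets T j)) => //.
move=> _ [_ [j _ [A mA <-] <-]]; rewrite setTI.
exact: mF.
Qed.

Context {d0} {Omega : measurableType d0} {R : realType}.
Variable P : probability Omega R.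

Lemma mutually_independent_sub {I : choiceType} (Z : I -> Omega -> T)
    (s : J -> I) : injective s ->
  mutually_independent P Z -> mutually_independent P (fun j => Z (s j)).
Proof.
move=> s_inj Zind K B mB.
(* Transports [B] along [s] without inverting it: at [s j] only [B j] enters the intersection, and
   off the image of [s] it is [setT]. *)
pose B' i := \bigcap_(j in [set j | s j = i]) B j.
have B'E j : B' (s j) = B j.
  apply/seteqP; split => [t Bt|t Bt k /s_inj -> //]; exact: Bt.
have := Zind (s @` K)%fset B'.
rewrite big_imfset/=; last by move=> ? ? _ _ /s_inj.
under eq_bigr do rewrite B'E.
move=> <-; last by move=> _ /imfsetP[j /= jK ->]; rewrite B'E; exact: mB.
congr (P _); apply/seteqP; split => [w BZ _ /= /imfsetP[j /= jK ->]|w BZ j /= jK].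
  by rewrite /= B'E; exact: BZ.
by rewrite -B'E; apply: BZ => /=; rewrite in_imfset.
Qed.

Lemma same_law_cylinder (Z Z' : J -> Omega -> T) :
  (forall j, measurable_fun setT (Z j)) ->
  (forall j, measurable_fun setT (Z' j)) ->
  mutually_independent P Z -> mutually_independent P Z' ->
  (forall j, same_law P (Z j) (Z' j)) ->
  same_law P (fun w => Z^~ w : cylinder J T) (fun w => Z'^~ w).
Proof.
move=> mZ mZ' iZ iZ' ZZ' A mA.
have mF : measurable_fun setT (fun w => Z^~ w : cylinder J T).
  exact: measurable_cylinder.
have mF' : measurable_fun setT (fun w => Z'^~ w : cylinder J T).
  exact: measurable_cylinder.
pose F : {mfun Omega >-> cylinder J T} :=
  HB.pack (fun w => Z^~ w : cylinder J T) (isMeasurableFun.Build _ _ _ _ _ mF).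
pose F' : {mfun Omega >-> cylinder J T} :=
  HB.pack (fun w => Z'^~ w : cylinder J T) (isMeasurableFun.Build _ _ _ _ _ mF').
suff : distribution P F A = distribution P F' A by [].
apply: (@finite_meet_measure_unique _ (cylinder J T : measurableType _) R J
  (coordinate_sets T) _ _ _ setT) => //.
- move=> j B jB; apply: sub_sigma_algebra; by exists j.
- by move=> j _ _ [B mB <-] [C mC <-]; exists (B `&` C); [exact: measurableI|rewrite !setTI].
- by move=> j; exists setT => //; rewrite setTI.
- by rewrite (le_lt_trans (probability_le1 _ _)) ?ltry.
move=> _ [K [B [_ SB BT ->]]].
have /choice[C HC] : forall j, exists C : set T,
    measurable C /\ B j = (fun u : J -> T => u j) @^-1` C.
  by move=> j; have [C mC <-] := SB j; exists C; rewrite setTI.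
have E (U : J -> Omega -> T) : (fun w => U^~ w) @^-1` (\bigcap_j B j) =
    \bigcap_(j in [set` K]) (U j @^-1` C j).
  apply/seteqP; split => [w BU j _|w CU j _] /=.
    by have := BU j Logic.I; rewrite (HC j).2.
  have [jK|/BT -> //] := boolP (j \in K).
  by rewrite (HC j).2; exact: CU.
have EF : distribution P F (\bigcap_j B j) =
    P (\bigcap_(j in [set` K]) (Z j @^-1` C j)) by rewrite -E.
have EF' : distribution P F' (\bigcap_j B j) =
    P (\bigcap_(j in [set` K]) (Z' j @^-1` C j)) by rewrite -E.
rewrite [LHS]EF [RHS]EF' iZ ?iZ'; last 2 first.
- by move=> j _; exact: (HC j).1.
- by move=> j _; exact: (HC j).1.
by apply: eq_bigr => j _; exact: (ZZ' j _ (HC j).1).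
Qed.

End cylinder.

(** * Mean square bounds *)

Section L2_bounds.
Context {d} {Omega : measurableType d} {R : realType}.
Variable P : probability Omega R.
Implicit Types (X Y : Omega -> R) (s t : R).

(** A bound on the L2 norm that carries measurability and finiteness along, so that recursions
    combine real bounds and never meet an infinite norm. *)
Definition L2_le X s : Prop :=
  [/\ measurable_fun setT X, 0 <= s &
      (\int[P]_w ((X w) ^+ 2)%:E <= (s ^+ 2)%:E)%E].

Let msq X : measurable_fun setT X ->
  measurable_fun setT (fun w => ((X w) ^+ 2)%:E).
Proof. by move=> mX; apply/measurable_EFinP; exact: measurable_funX. Qed.

Lemma L2_le_meas X s : L2_le X s -> measurable_fun setT X.
Proof. by case. Qed.

Lemma L2_le_ge0 X s : L2_le X s -> 0 <= s.
Proof. by case. Qed.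

Lemma L2_le_mono X Y s : measurable_fun setT X ->
  (forall w, `|X w| <= `|Y w|) -> L2_le Y s -> L2_le X s.
Proof.
move=> mX XY [mY s0 Ys]; split => //; apply: le_trans Ys.
apply: ge0_le_integral => //.
- by move=> w _; rewrite lee_fin sqr_ge0.
- exact: msq.
- exact: msq.
- move=> w _; rewrite lee_fin -(real_normK (num_real (X w))).
  by rewrite -(real_normK (num_real (Y w))) ler_pXn2r ?nnegrE.
Qed.

Lemma L2_le_weaken X s t : s <= t -> L2_le X s -> L2_le X t.
Proof.
move=> st [mX s0 Xs]; split => //; first exact: le_trans st.
by apply: le_trans Xs _; rewrite lee_fin ler_pXn2r ?nnegrE// (le_trans s0).
Qed.

Lemma L2_le_eq X Y s : X =1 Y -> L2_le X s -> L2_le Y s.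
Proof. by move=> /funext ->. Qed.

Lemma L2_le_cst (a : R) : L2_le (fun=> a) `|a|.
Proof.
split => //; rewrite (integral_cst P measurableT (a ^+ 2)%:E)//= probability_setT.
by rewrite mule1 real_normK ?num_real.
Qed.

Lemma L2_le_scale a X s : L2_le X s -> L2_le (fun w => a * X w) (`|a| * s).
Proof.
move=> [mX s0 Xs]; split; first exact: measurable_funM.
  by rewrite mulr_ge0.
under eq_integral do rewrite exprMn EFinM.
rewrite ge0_integralZl_EFin ?sqr_ge0//; last 2 first.
- by move=> w _; rewrite lee_fin sqr_ge0.
- exact: msq.
rewrite exprMn real_normK ?num_real// [leRHS]EFinM.
by apply: lee_wpmul2l => //; rewrite lee_fin sqr_ge0.
Qed.

Lemma L2_le_pscale a X s : 0 <= a -> L2_le X s -> L2_le (fun w => a * X w) (a * s).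
Proof. by move=> a0 Xs; have := L2_le_scale a Xs; rewrite ger0_norm. Qed.

Let sqrD_le (a x y : R) : 0 < a ->
  (x + y) ^+ 2 <= (1 + a) * x ^+ 2 + (1 + a^-1) * y ^+ 2.
Proof.
move=> a0; rewrite -subr_ge0.
have -> : (1 + a) * x ^+ 2 + (1 + a^-1) * y ^+ 2 - (x + y) ^+ 2 =
  a^-1 * (a * x - y) ^+ 2 by field; rewrite gt_eqF.
by rewrite mulr_ge0 ?sqr_ge0// invr_ge0 ltW.
Qed.

(** Minkowski's inequality from the weighted square inequality [sqrD_le]. The weight [t / s] is
    optimal: the bound then equals [(s + t) ^+ 2]. *)
Let L2_le_add_pos X Y s t : 0 < s -> 0 < t -> L2_le X s -> L2_le Y t ->
  L2_le (fun w => X w + Y w) (s + t).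
Proof.
move=> s0 t0 [mX _ Xs] [mY _ Yt]; split; first exact: measurable_funD.
  by rewrite addr_ge0// ltW.
have a0 : 0 < t / s by rewrite divr_gt0.
apply: (@le_trans _ _ (\int[P]_w ((1 + t / s)%:E * ((X w) ^+ 2)%:E +
                          (1 + (t / s)^-1)%:E * ((Y w) ^+ 2)%:E))%E).
  apply: ge0_le_integral => //.
  - by move=> w _; rewrite lee_fin sqr_ge0.
  - by apply: msq; exact: measurable_funD.
  - by apply: emeasurable_funD; apply: measurable_funeM; exact: msq.
  - by move=> w _; rewrite lee_fin sqrD_le.
rewrite ge0_integralD//; last 4 first.
- by move=> w _; rewrite lee_fin mulr_ge0 ?sqr_ge0// addr_ge0// ltW.
- by apply: measurable_funeM; exact: msq.
- by move=> w _; rewrite lee_fin mulr_ge0 ?sqr_ge0// addr_ge0// invr_ge0 ltW.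
- by apply: measurable_funeM; exact: msq.
rewrite !ge0_integralZl_EFin//; last 6 first.
- by move=> w _; rewrite lee_fin sqr_ge0.
- exact: msq.
- by rewrite addr_ge0// invr_ge0 ltW.
- by move=> w _; rewrite lee_fin sqr_ge0.
- exact: msq.
- by rewrite addr_ge0// ltW.
have -> : (s + t) ^+ 2 = (1 + t / s) * s ^+ 2 + (1 + (t / s)^-1) * t ^+ 2.
  by field; rewrite !gt_eqF.
rewrite [leRHS]EFinD (EFinM (1 + t / s)) (EFinM (1 + (t / s)^-1)).
apply: leeD; apply: lee_wpmul2l => //; rewrite lee_fin.
  by rewrite addr_ge0// ltW.
by rewrite addr_ge0// invr_ge0 ltW.
Qed.

(** The optimal weight exists only for positive bounds; both are enlarged by [e / 2], and [e] tends
    to [0]. *)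
Lemma L2_le_add X Y s t : L2_le X s -> L2_le Y t ->
  L2_le (fun w => X w + Y w) (s + t).
Proof.
move=> Xs Yt; have s0 := L2_le_ge0 Xs; have t0 := L2_le_ge0 Yt.
have mXY : measurable_fun setT (fun w => X w + Y w).
  exact: measurable_funD (L2_le_meas Xs) (L2_le_meas Yt).
split; rewrite ?addr_ge0//.
have H e : 0 < e ->
    (\int[P]_w ((X w + Y w) ^+ 2)%:E <= ((s + t + e) ^+ 2)%:E)%E.
  move=> e0; have e20 : 0 < e / 2 by rewrite divr_gt0.
  have -> : s + t + e = (s + e / 2) + (t + e / 2) by field.
  have [] // : L2_le (fun w => X w + Y w) ((s + e / 2) + (t + e / 2)).
  apply: L2_le_add_pos; rewrite ?ltr_wpDl//.
    by apply: L2_le_weaken Xs; rewrite lerDl ltW.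
  by apply: L2_le_weaken Yt; rewrite lerDl ltW.
set v := (X in (X <= _)%E).
have v0 : (0 <= v)%E by apply: integral_ge0 => w _; rewrite lee_fin sqr_ge0.
have vfin : v \is a fin_num.
  by rewrite ge0_fin_numE// (le_lt_trans (H 1 ltr01))// ltry.
rewrite -(fineK vfin) lee_fin -ler_sqrt ?sqr_ge0// sqrtr_sqr ger0_norm ?addr_ge0//.
apply/ler_addgt0Pr => e e0; have := H e e0; rewrite -/v -(fineK vfin) lee_fin.
rewrite -ler_sqrt ?sqr_ge0// sqrtr_sqr ger0_norm//.
by rewrite !addr_ge0// ltW.
Qed.

Lemma L2_le_sum (I : Type) (r : seq I) (p : pred I) (X : I -> Omega -> R)
    (s : I -> R) : (forall i, p i -> L2_le (X i) (s i)) ->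
  L2_le (fun w => \sum_(i <- r | p i) X i w) (\sum_(i <- r | p i) s i).
Proof.
move=> Xs; elim: r => [|i r IH].
  rewrite big_nil; under eq_fun do rewrite big_nil.
  by have := L2_le_cst 0; rewrite normr0.
rewrite big_cons; under eq_fun do rewrite big_cons.
by case: ifP => // pi; apply: L2_le_add => //; exact: Xs.
Qed.

Lemma L2_le_opp X s : L2_le X s -> L2_le (fun w => - X w) s.
Proof.
move=> Xs; apply: L2_le_mono (Xs); last by move=> w; rewrite normrN.
exact: measurable_funN (L2_le_meas Xs).
Qed.

Lemma L2_le_sub X Y s t : L2_le X s -> L2_le Y t ->
  L2_le (fun w => X w - Y w) (s + t).
Proof. by move=> Xs Yt; apply: L2_le_add => //; exact: L2_le_opp. Qed.

Lemma L2_le_sq_integrable X s : L2_le X s ->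
  P.-integrable setT (fun w => ((X w) ^+ 2)%:E).
Proof.
move=> [mX s0 Xs]; apply/integrableP; split; first exact: msq.
under eq_integral do rewrite gee0_abs ?lee_fin ?sqr_ge0//.
by rewrite (le_lt_trans Xs)// ltry.
Qed.

Lemma L2_le_integrableM X Y s t : L2_le X s -> L2_le Y t ->
  P.-integrable setT (fun w => (X w * Y w)%:E).
Proof.
move=> Xs Yt.
apply: (le_integrable measurableT) (integrableD measurableT
  (L2_le_sq_integrable Xs) (L2_le_sq_integrable Yt)).
  by apply/measurable_EFinP; exact: measurable_funM (L2_le_meas Xs) (L2_le_meas Yt).
move=> w _ /=; rewrite lee_fin (ger0_norm (addr_ge0 (sqr_ge0 _) (sqr_ge0 _))).
rewrite normrM -(real_normK (num_real (X w))) -(real_normK (num_real (Y w))).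
have := sqr_ge0 (`|X w| - `|Y w|).
have : 0 <= `|X w| by []. have : 0 <= `|Y w| by [].
by move: `|X w| `|Y w| => x y; nra.
Qed.

Lemma L2_le_integrable X s : L2_le X s -> P.-integrable setT (fun w => (X w)%:E).
Proof.
move=> Xs; have := L2_le_integrableM Xs (L2_le_cst 1).
by apply: eq_integrable => // w _; rewrite mulr1.
Qed.

Lemma L2_leE X s : measurable_fun setT X -> 0 <= s ->
  P.-integrable setT (fun w => ((X w) ^+ 2)%:E) ->
  (\int[P]_w (X w) ^+ 2 <= s ^+ 2) -> L2_le X s.
Proof.
move=> mX s0 iX Xs; split => //.
by rewrite -(fineK (integrable_fin_num measurableT iX)) lee_fin.
Qed.

Lemma L2_le_Rintegral X s : L2_le X s -> \int[P]_w (X w) ^+ 2 <= s ^+ 2.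
Proof.
move=> Xs; have [_ _ h] := Xs; rewrite -lee_fin fineK//.
exact: integrable_fin_num (L2_le_sq_integrable Xs).
Qed.

Lemma Rintegral_cst_probability (a : R) : \int[P]_w a = a.
Proof.
by rewrite Rintegral_cst//= probability_setT mulr1.
Qed.

Lemma Rintegral_sum (I : Type) (r : seq I) (X : I -> Omega -> R) :
  (forall i, P.-integrable setT (EFin \o X i)) ->
  \int[P]_w (\sum_(i <- r) X i w) = \sum_(i <- r) \int[P]_w X i w.
Proof.
move=> iX; elim: r => [|i r IH].
  by rewrite big_nil; under eq_Rintegral do rewrite big_nil; exact: Rintegral_cst_probability.
rewrite big_cons -IH; under eq_Rintegral do rewrite big_cons.
rewrite RintegralD//; apply: eq_integrable (integrable_sum measurableT r (fun i _ => iX i)) => //.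
by move=> w _ /=; rewrite sumEFin.
Qed.

Lemma L2_le_center X s : L2_le X s ->
  \int[P]_w (X w - \int[P]_w' X w') ^+ 2 = \int[P]_w (X w) ^+ 2 - (\int[P]_w X w) ^+ 2.
Proof.
move=> Xs; set m := \int[P]_w' X w'.
have iX := L2_le_integrable Xs; have iX2 := L2_le_sq_integrable Xs.
have -> : \int[P]_w (X w - m) ^+ 2 =
    \int[P]_w ((X w ^+ 2 - (2 * m) * X w) + m ^+ 2).
  by apply: eq_Rintegral => w _; ring.
have i2 : P.-integrable setT (EFin \o (fun w => (2 * m) * X w)).
  exact: (integrableZl measurableT (2 * m) iX).
have i1 : P.-integrable setT (EFin \o (fun w => X w ^+ 2 - (2 * m) * X w)).
  exact: (integrableB measurableT iX2 i2).
rewrite RintegralD//; last exact: finite_measure_integrable_cst.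
rewrite RintegralB// RintegralZl// Rintegral_cst_probability -/m; ring.
Qed.

(** The variance is nonnegative. *)
Lemma L2_le_mean X s : L2_le X s -> `|\int[P]_w X w| <= s.
Proof.
move=> Xs; have s0 := L2_le_ge0 Xs.
rewrite -(@ler_pXn2r _ 2)// ?nnegrE// real_normK ?num_real//.
apply: le_trans (L2_le_Rintegral Xs).
by rewrite -subr_ge0 -(L2_le_center Xs); apply: Rintegral_ge0 => w _; rewrite sqr_ge0.
Qed.

End L2_bounds.

Section sample_mean.
Context {d} {Omega : measurableType d} {R : realType}.
Variable P : probability Omega R.

Lemma Rintegral_mul_independent (X Y : Omega -> R) (s t : R) :
  L2_le P X s -> L2_le P Y t -> independent_maps P X Y ->
  \int[P]_w (X w * Y w) = (\int[P]_w X w) * (\int[P]_w Y w).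
Proof.
move=> Xs Yt XY; have mX := L2_le_meas Xs; have mY := L2_le_meas Yt.
have iX := L2_le_integrable Xs; have iY := L2_le_integrable Yt.
rewrite /Rintegral.
rewrite (integral_independent mX mY XY (h := fun z => (z.1 * z.2)%:E)); last 2 first.
- by apply/measurable_EFinP; exact: measurable_funM.
- exact: L2_le_integrableM Xs Yt.
rewrite -fineM ?integrable_fin_num//; congr fine.
have EY : (\int[P]_w (Y w)%:E)%E = (\int[P]_w Y w)%:E.
  by rewrite fineK// integrable_fin_num.
rewrite EY muleC -integralZl//; apply: eq_integral => w _.
under eq_integral do rewrite EFinM.
by rewrite integralZl// EY muleC.
Qed.

(** Splits the value of the random time from the squared error at that time; summed over [l], this
    stands in for conditioning on the time. *)
Lemma ge0_integral_indicator_independent (U1 : Omega -> nat) (U2 : Omega -> R) l :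
  measurable_fun setT U1 -> measurable_fun setT U2 -> (forall w, 0 <= U2 w) ->
  independent_maps P U1 U2 ->
  (\int[P]_w ((U1 w == l)%:R * U2 w)%:E =
   P [set w | U1 w = l] * \int[P]_w (U2 w)%:E)%E.
Proof.
move=> mU1 mU2 U20 U12.
have mn d' (T' : measurableType d') (g : nat -> T') : measurable_fun setT g by [].
have mind : measurable_fun setT (fun z : nat * R => ((z.1 == l)%:R * z.2)%:E).
  apply/measurable_EFinP; apply: measurable_funM => //.
  exact: (measurableT_comp (mn _ _ (fun r => (r == l)%:R : R)) measurable_fst).
pose U2' w := `|U2 w|.
have U2E w : U2 w = `|U2 w| by rewrite ger0_norm.
(* The integrand must be nonnegative on the whole product, not only along [U2]; hence the absolute
   value. *)
transitivity (\int[P]_w (((U1 w) == l)%:R * `|U2 w|)%:E)%E.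
  by apply: eq_integral => w _; rewrite -U2E.
have mh : measurable_fun setT (fun z : nat * R => ((z.1 == l)%:R * `|z.2|)%:E).
  apply/measurable_EFinP; apply: measurable_funM; last exact: measurableT_comp.
  exact: (measurableT_comp (mn _ _ (fun r => (r == l)%:R : R)) measurable_fst).
rewrite (ge0_integral_independent mU1 mU2 U12 mh) => [|z]; last first.
  by rewrite lee_fin mulr_ge0.
have mA : measurable [set w | U1 w = l].
  by have := mU1 measurableT [set l] I; rewrite setTI.
rewrite -[P _]mul1e -(integral_cst P mA 1%E) -ge0_integralZr//; last first.
  by apply: integral_ge0 => w _; rewrite lee_fin.
rewrite [RHS]integral_mkcond; apply: eq_integral => w _; rewrite patchE.
case: (eqVneq (U1 w) l) => [E|NE].
  rewrite mem_set// mul1e; apply: eq_integral => w' _ /=.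
  by rewrite mul1r -U2E.
rewrite memNset; last by move=> /= /eqP; rewrite (negPf NE).
by rewrite [LHS]integral0_eq// => w' _; rewrite mul0r.
Qed.

(* Pairwise independence suffices: the cross terms of the variance vanish. *)
Lemma L2_le_sample_mean (n : nat) (X : nat -> Omega -> R) (s mu : R) :
  (0 < n)%N ->
  (forall i, (0 < i <= n)%N -> L2_le P (X i) s) ->
  (forall i, (0 < i <= n)%N -> \int[P]_w X i w = mu) ->
  (forall i j, (0 < i <= n)%N -> (0 < j <= n)%N -> i != j ->
     independent_maps P (X i) (X j)) ->
  L2_le P (fun w => n%:R^-1 * \sum_(1 <= i < n.+1) X i w - mu)
    (s / Num.sqrt n%:R).
Proof.
move=> n0 Xs Xmu Xind.
have s0 : 0 <= s by apply: L2_le_ge0 (Xs n _); rewrite n0 leqnn.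
pose Y i w := X i w - mu.
have Ys i : (0 < i <= n)%N -> L2_le P (Y i) (s + `|mu|).
  by move=> hi; apply: L2_le_sub (Xs _ hi) (L2_le_cst P mu).
have Ymean i : (0 < i <= n)%N -> \int[P]_w Y i w = 0.
  move=> hi; rewrite /Y RintegralB//; last 2 first.
  - exact: L2_le_integrable (Xs _ hi).
  - exact: finite_measure_integrable_cst.
  by rewrite Rintegral_cst_probability Xmu// subrr.
have Ysq i : (0 < i <= n)%N -> \int[P]_w (Y i w) ^+ 2 <= s ^+ 2.
  move=> hi; rewrite /Y -{1}(Xmu i hi) (L2_le_center (Xs _ hi)).
  by apply: le_trans (L2_le_Rintegral (Xs _ hi)); rewrite lerBlDr lerDl sqr_ge0.
have Yort i j : (0 < i <= n)%N -> (0 < j <= n)%N -> i != j ->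
    \int[P]_w (Y i w * Y j w) = 0.
  move=> hi hj ij; rewrite (Rintegral_mul_independent (Ys _ hi) (Ys _ hj)).
    by rewrite Ymean// mul0r.
  have mB : measurable_fun setT (fun x : R => x - mu) by exact: measurable_funB.
  exact: (independent_maps_comp mB mB (Xind _ _ hi hj ij)).
(* Partial sums are orthogonal to every later [Y j], so the second moment of [F n] is at most
   [n * s ^+ 2]; division by [n ^ 2] leaves [s ^+ 2 / n]. *)
pose F m w := \sum_(1 <= i < m.+1) Y i w.
have Fs m : (m <= n)%N -> L2_le P (F m) (\sum_(1 <= i < m.+1) (s + `|mu|)).
  move=> mn; rewrite /F big_nat; under eq_fun do rewrite big_nat.
  by apply: L2_le_sum => i /andP[i0 im]; apply: Ys; rewrite i0 (leq_trans _ mn).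
have Fort m j : (m < j <= n)%N -> \int[P]_w (F m w * Y j w) = 0.
  elim: m => [|m IH] in j *.
    move=> _; under eq_Rintegral do rewrite /F big_nil mul0r.
    exact: Rintegral_cst_probability.
  move=> /andP[mj jn].
  have hj : (0 < j <= n)%N by rewrite jn (leq_ltn_trans _ mj).
  have hm : (0 < m.+1 <= n)%N by rewrite /= (leq_trans (ltnW mj)).
  have -> : \int[P]_w (F m.+1 w * Y j w) =
      \int[P]_w (F m w * Y j w + Y m.+1 w * Y j w).
    by apply: eq_Rintegral => w _; rewrite /F big_nat_recr//= mulrDl.
  have Fm : L2_le P (F m) (\sum_(1 <= i < m.+1) (s + `|mu|)).
    by apply: Fs; rewrite ltnW//; case/andP: hm.
  rewrite RintegralD//; last 2 first.
  - exact: L2_le_integrableM Fm (Ys _ hj).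
  - exact: L2_le_integrableM (Ys _ hm) (Ys _ hj).
  by rewrite IH ?(ltnW mj)// Yort// ?addr0// ltn_eqF.
have Fsq m : (m <= n)%N -> \int[P]_w (F m w) ^+ 2 <= m%:R * s ^+ 2.
  elim: m => [|m IH] mn.
    rewrite mul0r; under eq_Rintegral do rewrite /F big_nil expr0n.
    by rewrite Rintegral_cst_probability.
  have Fm := Fs _ (ltnW mn); have hm : (0 < m.+1 <= n)%N by rewrite mn.
  have -> : \int[P]_w (F m.+1 w) ^+ 2 =
      \int[P]_w (((F m w) ^+ 2 + 2 * (F m w * Y m.+1 w)) + (Y m.+1 w) ^+ 2).
    by apply: eq_Rintegral => w _; rewrite /F big_nat_recr//=; ring.
  have iFY := L2_le_integrableM Fm (Ys _ hm).
  have i2 := integrableZl measurableT 2 iFY.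
  have iF2 := L2_le_sq_integrable Fm; have iY2 := L2_le_sq_integrable (Ys _ hm).
  rewrite RintegralD//; last exact: (integrableD measurableT iF2 i2).
  rewrite RintegralD// RintegralZl// Fort ?leqnn// mulr0 addr0.
  by rewrite -natr1 mulrDl mul1r lerD ?Ysq ?IH// ltnW.
have nR0 : 0 < n%:R :> R by rewrite ltr0n.
have E w : n%:R^-1 * \sum_(1 <= i < n.+1) X i w - mu = n%:R^-1 * F n w.
  rewrite /F /Y sumrB mulrBr; congr (_ - _).
  rewrite sumr_const_nat subn1/= -[mu *+ n]mulr_natl mulrA mulVf ?mul1r//.
  by rewrite gt_eqF.
have Fn := L2_le_scale n%:R^-1 (Fs n (leqnn n)).
apply: (L2_le_eq (X := fun w => n%:R^-1 * F n w)) => //.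
have m0 : 0 <= Num.sqrt n%:R :> R by rewrite sqrtr_ge0.
apply: L2_leE (L2_le_meas Fn) _ (L2_le_sq_integrable Fn) _.
  by rewrite divr_ge0.
have -> : \int[P]_w (n%:R^-1 * F n w) ^+ 2 = n%:R^-2 * \int[P]_w (F n w) ^+ 2.
  rewrite -RintegralZl//; last exact: L2_le_sq_integrable (Fs n (leqnn n)).
  by apply: eq_Rintegral => w _; rewrite exprMn exprVn.
rewrite expr_div_n sqr_sqrtr ?ler0n//.
apply: (@le_trans _ _ (n%:R^-2 * (n%:R * s ^+ 2))).
  by apply: ler_wpM2l; [rewrite invr_ge0 sqr_ge0|exact: Fsq].
by rewrite le_eqVlt; apply/orP; left; apply/eqP; field; rewrite gt_eqF.
Qed.

End sample_mean.

(** * Functionals of the noise below a node *)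

Section noise.
Local Open Scope ereal_scope.
Context {disp d1 d2 : measure_display} {Omega : measurableType disp}.
Context {R : realType} {T1 : measurableType d1} {T2 : measurableType d2}.
Context {I : choiceType}.
Variables (P : probability Omega R) (Y : I -> Omega -> T1) (Z : I -> Omega -> T2).
Hypothesis Y_meas : forall i, measurable_fun setT (Y i).
Hypothesis Z_meas : forall i, measurable_fun setT (Z i).
Hypothesis Y_indep : mutually_independent P Y.
Hypothesis Z_indep : mutually_independent P Z.
Hypothesis ZY_indep : independent_families P Z Y.

(** Every node carries two sources: [true] selects [Y], later the driver of the chain, and [false]
    selects [Z], later the random times. Keeping them apart makes a node's random time independent
    of its own chain. *)
Definition atom (ib : I * bool) : set (set Omega) :=
  if ib.2 then preimage_set_system setT (Y ib.1) measurable
  else preimage_set_system setT (Z ib.1) measurable.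

Lemma atom_meas ib A : atom ib A -> measurable A.
Proof.
by case: ib => i [] [B mB <-]; [exact: Y_meas|exact: Z_meas].
Qed.

Lemma atom_setI ib : setI_closed (atom ib).
Proof.
case: ib => i [] _ _ [B mB <-] [C mC <-]; exists (B `&` C) => //=;
  by [exact: measurableI|rewrite !setTI].
Qed.

Lemma atom_setT ib : atom ib setT.
Proof. by case: ib => i []; exists setT => //; rewrite setTI. Qed.

Let sigma_bigcap d' {T : measurableType d'} (U : I -> Omega -> T)
    (J : {fset I}) (C : I -> set T) :
  (forall i, measurable (C i)) ->
  sigma_of_family U (\bigcap_(i in [set` J]) (U i @^-1` C i)).
Proof.
move=> mC; pose OU := g_sigma_algebraType (\bigcup_(i in [set: I])
  preimage_set_system [set: Omega] (U i) measurable).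
suff : measurable (\bigcap_(i in [set` J]) (U i @^-1` C i) : set OU) by [].
rewrite bigcap_fset big_seq.
elim/big_ind: _ => //= [A B|i _]; first exact: measurableI.
by apply: sub_sigma_algebra; exists i => //; exists (C i) => //; rewrite setTI.
Qed.

(** Sorting the indices by their boolean, independence of the two families splits off the [Z] part
    from the [Y] part, and each part factors by its own mutual independence. *)
Lemma atom_indep (J : {fset I * bool}) (B : I * bool -> set Omega) :
  (forall ib, atom ib (B ib)) -> (forall ib, ib \notin J -> B ib = setT) ->
  P (\bigcap_ib B ib) = \prod_(ib <- J) P (B ib).
Proof.
move=> aB BT.
have /choice[C HC] : forall i, exists C : set T1,
    measurable C /\ B (i, true) = Y i @^-1` C.
  by move=> i; have [C mC <-] := aB (i, true); exists C; rewrite setTI.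
have /choice[D HD] : forall i, exists D : set T2,
    measurable D /\ B (i, false) = Z i @^-1` D.
  by move=> i; have [D mD <-] := aB (i, false); exists D; rewrite setTI.
pose J1 := [fset ib.1 | ib in [fset x in J | x.2]]%fset.
pose J2 := [fset ib.1 | ib in [fset x in J | ~~ x.2]]%fset.
have -> : \bigcap_ib B ib =
    \bigcap_(i in [set` J2]) (Z i @^-1` D i) `&`
    \bigcap_(i in [set` J1]) (Y i @^-1` C i).
  apply/seteqP; split => [w Bw|w [Dw Cw] [i b] _].
    split => i _ /=.
      by have := Bw (i, false) Logic.I; rewrite (HD i).2.
    by have := Bw (i, true) Logic.I; rewrite (HC i).2.
  have [iJ|/BT -> //] := boolP ((i, b) \in J).
  case: b iJ => iJ.
    rewrite (HC i).2; apply: Cw => /=; apply/imfsetP; exists (i, true) => //=.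
    by rewrite !inE iJ.
  rewrite (HD i).2; apply: Dw => /=; apply/imfsetP; exists (i, false) => //=.
  by rewrite !inE iJ.
rewrite ZY_indep; last 2 first.
- by apply: sigma_bigcap => i; exact: (HD i).1.
- by apply: sigma_bigcap => i; exact: (HC i).1.
rewrite Y_indep; last by move=> i _; exact: (HC i).1.
rewrite Z_indep; last by move=> i _; exact: (HD i).1.
rewrite (big_fsetID _ (fun x : I * bool => x.2)) /= muleC; congr (_ * _).
  rewrite big_imfset/=.
    apply: eq_big_seq => -[i b]; rewrite !inE /= => /andP[_ ->].
    by rewrite (HC i).2.
  by move=> [i b] [i' b']; rewrite !inE/= => /andP[_ ->] /andP[_ ->] ->.
rewrite big_imfset/=.
  apply: eq_big_seq => -[i b]; rewrite !inE /= => /andP[_ /negPf ->].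
  by rewrite (HD i).2.
by move=> [i b] [i' b']; rewrite !inE/= => /andP[_ /negPf ->] /andP[_ /negPf ->] ->.
Qed.

(* [Omega] with the sigma-algebra of the noise indexed by [D]. *)
Definition observing (D : set (I * bool)) :=
  g_sigma_algebraType (\bigcup_(ib in D) atom ib).

Lemma measurable_observing {d'} {T : measurableType d'} (D : set (I * bool))
    (U : Omega -> T) :
  measurable_fun setT (U : observing D -> T) -> measurable_fun setT U.
Proof.
move=> mU mT A mA; apply: (@sigma_family_measurable _ _ _ _ atom_meas D).
exact: mU.
Qed.

Lemma observing_Y (D : set (I * bool)) i : D (i, true) ->
  measurable_fun setT (Y i : observing D -> T1).
Proof.
by move=> Di _ A mA; apply: sub_sigma_algebra; exists (i, true) => //; exists A.
Qed.

Lemma observing_Z (D : set (I * bool)) i : D (i, false) ->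
  measurable_fun setT (Z i : observing D -> T2).
Proof.
by move=> Di _ A mA; apply: sub_sigma_algebra; exists (i, false) => //; exists A.
Qed.

(** Reduces independence claims about the scheme to disjointness of two index sets. *)
Lemma independent_observing {d' d''} {T : measurableType d'}
    {T' : measurableType d''} (D1 D2 : set (I * bool)) (U1 : Omega -> T)
    (U2 : Omega -> T') : D1 `&` D2 = set0 ->
  measurable_fun setT (U1 : observing D1 -> T) ->
  measurable_fun setT (U2 : observing D2 -> T') ->
  independent_maps P U1 U2.
Proof.
move=> D12 mU1 mU2; apply: sigma_independent_maps mU1 mU2 => A1 A2.
exact: (sigma_disjoint_independent atom_meas atom_setI atom_setT atom_indep).
Qed.

End noise.

(** * The noise below a node, and functionals of it *)

Section tree.
Local Open Scope ereal_scope.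
Context {disp d1 d2 : measure_display} {Omega : measurableType disp}.
Context {R : realType} {T1 : measurableType d1} {T2 : measurableType d2}.
Variables (P : probability Omega R).
Variables (Y : Theta -> Omega -> T1) (Z : Theta -> Omega -> T2).
Hypothesis Y_iid : iid P Y.
Hypothesis Z_iid : iid P Z.
Hypothesis ZY_indep : independent_families P Z Y.

Let Y_meas i : measurable_fun setT (Y i). Proof. by case: Y_iid. Qed.
Let Z_meas i : measurable_fun setT (Z i). Proof. by case: Z_iid. Qed.
Let Y_indep : mutually_independent P Y. Proof. by case: Y_iid. Qed.
Let Z_indep : mutually_independent P Z. Proof. by case: Z_iid. Qed.

Fact theta_cat_subproof (theta eta : Theta) : (0 < size (val theta ++ val eta))%N.
Proof. by rewrite size_cat addn_gt0 (valP theta). Qed.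

Definition theta_cat (theta eta : Theta) : Theta :=
  exist _ (val theta ++ val eta) (theta_cat_subproof theta eta).

Lemma theta_cat_inj theta : injective (theta_cat theta).
Proof.
by move=> e1 e2 /(congr1 val) /= /eqP; rewrite eqseq_cat// eqxx => /eqP /val_inj.
Qed.

Definition theta_pair (j m : int) : Theta := exist _ [:: j; m] isT.

Lemma theta_appE theta j m : theta_app theta j m = theta_cat theta (theta_pair j m).
Proof. exact: val_inj. Qed.

Lemma theta_catA t1 t2 t3 :
  theta_cat (theta_cat t1 t2) t3 = theta_cat t1 (theta_cat t2 t3).
Proof. by apply: val_inj; rewrite /= catA. Qed.

Lemma theta_cat_neq (t1 t2 eta : Theta) : size (val t1) = size (val t2) ->
  t1 <> theta_cat t2 eta.
Proof.
move=> s12 /(congr1 (fun t => size (val t))) /=; rewrite size_cat s12 => /eqP.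
by rewrite -[X in X == _]addn0 eqn_add2l eq_sym; case: eta => -[].
Qed.

Definition tree_noise := (cylinder Theta T1 * cylinder Theta T2)%type.

(** The noise is indexed by the position relative to [theta], so the trees of all nodes live in one
    space and can be compared in law. *)
Definition tree (theta : Theta) (w : Omega) : tree_noise :=
  (fun eta => Y (theta_cat theta eta) w, fun eta => Z (theta_cat theta eta) w).

(** Strict descendants: [eta] is nonempty, so [theta] itself is left out. This keeps the chain and
    random time of a node independent of approximations computed at the same node. *)
Definition below (theta : Theta) : set (Theta * bool) :=
  [set ib | exists eta, ib.1 = theta_cat theta eta].

Lemma observing_tree (D : set (Theta * bool)) theta : below theta `<=` D ->
  measurable_fun setT (tree theta : observing Y Z D -> tree_noise).
Proof.
move=> bD; apply: measurable_fun_pair; apply: measurable_cylinder => eta.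
  by apply: observing_Y; apply: bD; exists eta.
by apply: observing_Z; apply: bD; exists eta.
Qed.

Lemma tree_meas theta : measurable_fun setT (tree theta).
Proof.
by apply: (measurable_observing Y_meas Z_meas); apply: (observing_tree (subsetT _)).
Qed.

(** Prefixing by [theta] is injective, so the re-indexed noise is again an independent family with
    the same marginals, whatever [theta] is. *)
Lemma tree_same_law theta theta' : same_law P (tree theta) (tree theta').
Proof.
have Yid : identically_distributed P Y by case: Y_iid.
have Zid : identically_distributed P Z by case: Z_iid.
have mY t : measurable_fun setT (fun w => (fun eta => Y (theta_cat t eta) w) : cylinder Theta T1).
  by apply: measurable_cylinder.
have mZ t : measurable_fun setT (fun w => (fun eta => Z (theta_cat t eta) w) : cylinder Theta T2).
  by apply: measurable_cylinder.
have ind t : independent_maps P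
    (fun w => (fun eta => Y (theta_cat t eta) w) : cylinder Theta T1)
    (fun w => (fun eta => Z (theta_cat t eta) w) : cylinder Theta T2).
  apply: (independent_observing Y_meas Z_meas Y_indep Z_indep ZY_indep
    (D1 := [set ib | ib.2 = true]) (D2 := [set ib | ib.2 = false])).
  - by rewrite -subset0 => -[i b] [/= ->].
  - by apply: measurable_cylinder => eta; exact: observing_Y.
  - by apply: measurable_cylinder => eta; exact: observing_Z.
apply: same_law_pair => //.
- apply: (same_law_cylinder (Z := fun eta => Y (theta_cat theta eta))
     (Z' := fun eta => Y (theta_cat theta' eta))) => //.
  + exact: mutually_independent_sub (@theta_cat_inj _) Y_indep.
  + exact: mutually_independent_sub (@theta_cat_inj _) Y_indep.
  + by move=> eta A mA; exact: Yid.
- apply: (same_law_cylinder (Z := fun eta => Z (theta_cat theta eta))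
     (Z' := fun eta => Z (theta_cat theta' eta))) => //.
  + exact: mutually_independent_sub (@theta_cat_inj _) Z_indep.
  + exact: mutually_independent_sub (@theta_cat_inj _) Z_indep.
  + by move=> eta A mA; exact: Zid.
Qed.

Context {dS : measure_display} {S : measurableType dS}.

(** The order of the quantifiers is essential: one [G] serves all nodes. Through [tree_same_law] the
    law does not depend on the node, and through [observing_tree] only noise below the node is
    seen. *)
Definition tree_measurable {d} {T : measurableType d}
    (U : Theta -> S -> Omega -> T) : Prop :=
  exists G : S * tree_noise -> T, measurable_fun setT G /\
    forall theta x w, U theta x w = G (x, tree theta w).

Section closure.
Context {d d' : measure_display} {T : measurableType d} {T' : measurableType d'}.
Implicit Types U : Theta -> S -> Omega -> T.

Lemma tree_measurable_id : tree_measurable (fun _ x _ => x).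
Proof. by exists fst; split. Qed.

Lemma tree_measurable_comp (h : T -> T') U : measurable_fun setT h ->
  tree_measurable U -> tree_measurable (fun theta x w => h (U theta x w)).
Proof.
move=> mh [G [mG UG]]; exists (h \o G); split; first exact: measurableT_comp.
by move=> theta x w; rewrite UG.
Qed.

Lemma tree_measurable_pair U (U' : Theta -> S -> Omega -> T') :
  tree_measurable U -> tree_measurable U' ->
  tree_measurable (fun theta x w => (U theta x w, U' theta x w)).
Proof.
move=> [G [mG UG]] [G' [mG' UG']]; exists (fun z => (G z, G' z)); split.
  exact: measurable_fun_pair.
by move=> theta x w; rewrite UG UG'.
Qed.

Lemma tree_measurable_cst (t : T) : tree_measurable (fun _ _ _ => t).
Proof. by exists (fun=> t). Qed.

(** The tree of a descendant is a coordinate shift of the tree of [theta]; joint measurability of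
    [G] permits substituting the random point [y]. *)
Lemma tree_measurable_app U (y : Theta -> S -> Omega -> S) j m :
  tree_measurable U -> tree_measurable y ->
  tree_measurable (fun theta x w => U (theta_app theta j m) (y theta x w) w).
Proof.
move=> [G [mG UG]] [H [mH yH]].
pose shift (u : tree_noise) : tree_noise :=
  (fun eta => u.1 (theta_cat (theta_pair j m) eta),
   fun eta => u.2 (theta_cat (theta_pair j m) eta)).
have mshift : measurable_fun setT shift.
  apply: measurable_fun_pair; apply: measurable_cylinder => eta.
    exact: (measurableT_comp (measurable_coordinate _) measurable_fst).
  exact: (measurableT_comp (measurable_coordinate _) measurable_snd).
exists (fun z => G (H z, shift z.2)); split.
  apply: measurableT_comp => //; apply: measurable_fun_pair => //.
  exact: measurableT_comp.
move=> theta x w; rewrite UG yH; congr (G (_, _)).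
by rewrite /tree /shift /=; congr pair; apply/funext => eta;
  rewrite theta_appE theta_catA.
Qed.

Lemma observing_tree_measurable U (D : set (Theta * bool)) theta :
  below theta `<=` D -> tree_measurable U ->
  measurable_fun setT (fun z : S * observing Y Z D => U theta z.1 z.2).
Proof.
move=> bD [G [mG UG]].
have -> : (fun z : S * observing Y Z D => U theta z.1 z.2) =
    (fun z => G (z.1, tree theta z.2)) by apply/funext => z; rewrite UG.
apply: measurableT_comp => //; apply: measurable_fun_pair => //.
exact: (measurableT_comp (observing_tree bD) measurable_snd).
Qed.

End closure.

Lemma tree_measurable_Y j m :
  tree_measurable (fun theta _ => Y (theta_app theta j m)).
Proof.
exists (fun z => z.2.1 (theta_pair j m)); split.
  exact: (measurableT_comp (measurable_coordinate (theta_pair j m))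
    (measurableT_comp measurable_fst measurable_snd)).
by move=> theta x w; rewrite theta_appE.
Qed.

Lemma tree_measurable_Z j m :
  tree_measurable (fun theta _ => Z (theta_app theta j m)).
Proof.
exists (fun z => z.2.2 (theta_pair j m)); split.
  exact: (measurableT_comp (measurable_coordinate (theta_pair j m))
    (measurableT_comp measurable_snd measurable_snd)).
by move=> theta x w; rewrite theta_appE.
Qed.

Lemma tree_measurable_add (U U' : Theta -> S -> Omega -> R) :
  tree_measurable U -> tree_measurable U' ->
  tree_measurable (fun theta x w => (U theta x w + U' theta x w)%R).
Proof.
move=> [G [mG UG]] [G' [mG' UG']]; exists (fun z => (G z + G' z)%R); split.
  exact: measurable_funD.
by move=> theta x w; rewrite UG UG'.
Qed.

Lemma tree_measurable_mul (U U' : Theta -> S -> Omega -> R) :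
  tree_measurable U -> tree_measurable U' ->
  tree_measurable (fun theta x w => (U theta x w * U' theta x w)%R).
Proof.
move=> [G [mG UG]] [G' [mG' UG']]; exists (fun z => (G z * G' z)%R); split.
  exact: measurable_funM.
by move=> theta x w; rewrite UG UG'.
Qed.

Lemma tree_measurable_sum (J : eqType) (r : seq J) (U : J -> Theta -> S -> Omega -> R) :
  (forall j, j \in r -> tree_measurable (U j)) ->
  tree_measurable (fun theta x w => (\sum_(j <- r) U j theta x w)%R).
Proof.
elim: r => [|j r IH] mU.
  have [G [mG UG]] := tree_measurable_cst (0%R : R).
  by exists G; split => // theta x w; rewrite big_nil -UG.
have h1 : tree_measurable (U j) by apply: mU; rewrite mem_head.
have h2 : tree_measurable (fun theta x w => (\sum_(j <- r) U j theta x w)%R).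
  by apply: IH => i ir; apply: mU; rewrite inE ir orbT.
have [G [mG UG]] := tree_measurable_add h1 h2.
by exists G; split => // theta x w; rewrite big_cons -UG.
Qed.

End tree.

(** * The multilevel Picard scheme *)

Section mlp.
Context {dS disp : measure_display} {S : measurableType dS}.
Context {Omega : measurableType disp} {R : realType}.
Variables (P : probability Omega R) (K : nat).
Variable f : nat -> S * R -> R.
Hypothesis f_meas : forall k, (k <= K)%N -> measurable_fun setT (f k).
Variable L : nat -> R.
Hypothesis f_lip : forall k, (k <= K)%N -> forall x a b,
  `|(f k (x, a) - a) - (f k (x, b) - b)| <= L k * `|a - b|.
Variable phi : nat -> S * S -> S.
Hypothesis phi_meas : forall k, (k <= K)%N -> measurable_fun setT (phi k).
Variable W : Theta -> nat -> Omega -> S.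
Hypothesis W_iid : iid P (fun theta => proc K (W theta)).
Hypothesis W_indep : forall theta,
  mutually_independent P (fun k : 'I_K => W theta k).
Variable X : Theta -> nat -> S -> nat -> Omega -> S.
Hypothesis X_eq : forall k theta l x w, (k <= K)%N -> (l <= k)%N ->
  X theta k x l w =
    if l == k then x else phi l (X theta k x l.+1 w, W theta l w).

(** * The backward chain as a function of its driver *)

Definition driver theta w := proc K (W theta) w.

Lemma driver_meas theta : measurable_fun setT (driver theta).
Proof. by case: W_iid => + _ _; exact. Qed.

Lemma driverE theta k w : (k <= K)%N -> tnth (driver theta w) (inord k) = W theta k w.
Proof. by move=> kK; rewrite tnth_mktuple inordK. Qed.

Lemma W_meas theta k : (k <= K)%N -> measurable_fun setT (W theta k).
Proof.
move=> kK; have -> : W theta k = (fun w => tnth (driver theta w) (inord k)).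
  by apply/funext => w; rewrite driverE.
exact: (measurableT_comp (measurable_tnth _) (driver_meas theta)).
Qed.

(** The chain runs downwards in time: this is its position at time [l] when it leaves [x] at time
    [l + j]. As a deterministic function of one tuple, it transfers equality in law from the drivers
    to the chains. *)
Fixpoint flow (l j : nat) (x : S) (u : K.+1.-tuple S) : S :=
  if j is j'.+1 then phi l (flow l.+1 j' x u, tnth u (inord l)) else x.

Lemma flow_meas l j : (l + j <= K)%N ->
  measurable_fun setT (fun z : S * K.+1.-tuple S => flow l j z.1 z.2).
Proof.
elim: j l => [|j IH] l ljK /=; first exact: measurable_fst.
apply: (measurableT_comp (phi_meas _)); first by rewrite (leq_trans _ ljK)// leq_addr.
apply: measurable_fun_pair; first by apply: IH; rewrite addSnnS.
exact: (measurableT_comp (measurable_tnth _) measurable_snd).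
Qed.

Lemma X_flow theta k l x w : (k <= K)%N -> (l <= k)%N ->
  X theta k x l w = flow l (k - l) x (driver theta w).
Proof.
move=> kK lk; rewrite -{1}(subKn lk); move: (leq_subr l k).
rewrite -[X in flow X](subKn lk).
elim: (k - l)%N => [|j IH] jk.
  by rewrite subn0 X_eq// eqxx.
rewrite X_eq ?leq_subr// ifF; last first.
  by apply/negbTE; rewrite neq_ltn ltn_subrL /= (leq_trans _ jk).
have E : (k - j.+1).+1 = (k - j)%N by rewrite subnSK.
rewrite /= E IH ?(ltnW jk)// driverE//.
by rewrite (leq_trans (leq_subr _ _)).
Qed.

Lemma X_meas theta k l : (k <= K)%N -> (l <= k)%N ->
  measurable_fun setT (fun z : S * Omega => X theta k z.1 l z.2).
Proof.
move=> kK lk.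
have -> : (fun z : S * Omega => X theta k z.1 l z.2) =
    (fun z => flow l (k - l) z.1 (driver theta z.2)).
  by apply/funext => z; rewrite X_flow.
have hl : (l + (k - l) <= K)%N by rewrite subnKC.
have md : measurable_fun setT (fun z : S * Omega => (z.1, driver theta z.2)).
  apply: measurable_fun_pair => //.
  exact: (measurableT_comp (driver_meas theta) measurable_snd).
exact: (measurableT_comp (flow_meas hl) md).
Qed.

Lemma X_meas2 theta k l x : (k <= K)%N -> (l <= k)%N ->
  measurable_fun setT (X theta k x l).
Proof. by move=> kK lk; exact: (measurable_fun_pair2 x (X_meas theta kK lk)). Qed.

Lemma X_same_law theta theta' k l x : (k <= K)%N -> (l <= k)%N ->
  same_law P (X theta k x l) (X theta' k x l).
Proof.
move=> kK lk A mA.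
have E t : X t k x l @^-1` A = driver t @^-1` [set u | A (flow l (k - l) x u)].
  by apply/seteqP; split => w /=; rewrite X_flow.
rewrite !E; case: W_iid => _ _; apply.
rewrite -[X in measurable X]setTI.
have /measurable_fun_pair2 : measurable_fun setT
    (fun z : S * K.+1.-tuple S => flow l (k - l) z.1 z.2).
  by apply: flow_meas; rewrite subnKC.
by move=> /(_ x); apply.
Qed.

(** Both sides obey the same recursion below time [i], with the same driver, and agree at time
    [i]. *)
Lemma X_restart theta k i l x w : (k <= K)%N -> (l <= i <= k)%N ->
  X theta k x l w = X theta i (X theta k x i w) l w.
Proof.
move=> kK /andP[li ik]; have iK := leq_trans ik kK.
rewrite -(subKn li); move: (leq_subr l i).
elim: (i - l)%N => [|j IH] ji.
  by rewrite subn0 [RHS]X_eq// eqxx.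
rewrite X_eq ?(leq_trans (leq_subr _ _))// [RHS]X_eq ?leq_subr//.
have E : (i - j.+1).+1 = (i - j)%N by rewrite subnSK.
have ij : (i - j.+1 < i)%N by rewrite ltn_subrL /= (leq_trans _ ji).
rewrite (ltn_eqF ij) (ltn_eqF (leq_trans ij ik)) E IH//; exact: ltnW.
Qed.

(** * The Markov property of the chain *)

Section markov.
Variables (theta : Theta) (k i l : nat) (x : S).
Hypotheses (kK : (k <= K)%N) (lik : (l <= i <= k)%N).

Let watom (j : 'I_K) := preimage_set_system setT (W theta j) measurable.

Let watom_meas j A : watom j A -> measurable A.
Proof. by case=> B mB <-; apply: W_meas => //; exact: ltnW. Qed.

Let watom_setI j : setI_closed (watom j).
Proof.
move=> _ _ [B mB <-] [C mC <-]; exists (B `&` C) => //=;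
  by [exact: measurableI|rewrite !setTI].
Qed.

Let watom_setT j : watom j setT.
Proof. by exists setT => //; rewrite setTI. Qed.

Let watom_indep (J : {fset 'I_K}) (B : 'I_K -> set Omega) :
  (forall j, watom j (B j)) -> (forall j, j \notin J -> B j = setT) ->
  P (\bigcap_j B j) = (\prod_(j <- J) P (B j))%E.
Proof.
move=> aB BT.
have /choice[C HC] : forall j, exists C : set S,
    measurable C /\ B j = W theta j @^-1` C.
  by move=> j; have [C mC <-] := aB j; exists C; rewrite setTI.
have -> : \bigcap_j B j = \bigcap_(j in [set` J]) (W theta j @^-1` C j).
  apply/seteqP; split => [w Bw j _|w Cw j _].
    by have := Bw j Logic.I; rewrite (HC j).2.
  have [jJ|/BT -> //] := boolP (j \in J).
  by rewrite (HC j).2; exact: Cw.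
rewrite W_indep; last by move=> j _; exact: (HC j).1.
by apply: eq_bigr => j _; rewrite (HC j).2.
Qed.

Let OD (D : set 'I_K) := g_sigma_algebraType (\bigcup_(j in D) watom j).

Let W_OD (D : set 'I_K) (j : 'I_K) : D j ->
  measurable_fun setT (W theta j : OD D -> S).
Proof.
by move=> Dj _ A mA; apply: sub_sigma_algebra; exists j => //; exists A.
Qed.

(** The start [y] and the sample [g] both depend on a parameter, which covers the chain from a fixed
    point as well as the chain as a joint function of start and sample. *)
Let X_OD (D : set 'I_K) n m (dy : measure_display) (Ty : measurableType dy)
  (y : Ty -> S) (g : Ty -> OD D) : (n <= K)%N -> (m <= n)%N ->
  (forall j : 'I_K, (m <= j < n)%N -> D j) ->
  measurable_fun setT y -> measurable_fun setT g ->
  measurable_fun setT (fun z : Ty => X theta n (y z) m (g z)).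
Proof.
move=> nK mn + my mg.
have [j jn ->] : exists2 j, (j <= n)%N & m = (n - j)%N.
  by exists (n - m)%N; rewrite ?leq_subr ?subKn.
elim: j jn => [|j IH] jn HD.
  rewrite subn0; rewrite (_ : (fun z => _) = y)//.
  by apply/funext => z; rewrite X_eq// eqxx.
have ij : (n - j.+1 < n)%N by rewrite ltn_subrL /= (leq_trans _ jn).
have E : (n - j.+1).+1 = (n - j)%N by rewrite subnSK.
have njK : (n - j.+1 < K)%N := leq_trans ij nK.
rewrite (_ : (fun z => _) = (fun z =>
    phi (n - j.+1) (X theta n (y z) (n - j) (g z), W theta (n - j.+1) (g z)))); last first.
  by apply/funext => z; rewrite X_eq ?leq_subr// (ltn_eqF ij) E.
apply: (measurableT_comp (phi_meas (ltnW njK))).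
apply: measurable_fun_pair.
  apply: IH => [|j' /andP[h1 h2]]; first exact: ltnW.
  by apply: HD; rewrite h2 andbT (leq_trans _ h1)// leq_sub2l.
apply: (measurableT_comp (W_OD (j := Ordinal njK) _) mg).
by apply: HD => /=; rewrite leqnn.
Qed.

Let D1 := [set j : 'I_K | (i <= j)%N].
Let D2 := [set j : 'I_K | (j < i)%N].

Let lk : (l <= k)%N. Proof. by case/andP: lik => /leq_trans h /h. Qed.
Let ik : (i <= k)%N. Proof. by case/andP: lik. Qed.
Let li : (l <= i)%N. Proof. by case/andP: lik. Qed.
Let iK : (i <= K)%N. Proof. exact: leq_trans kK. Qed.

Let id_meas : measurable_fun setT (idfun : Omega -> OD D2).
Proof.
move=> _ A mA; rewrite setTI.
exact: (@sigma_family_measurable _ _ _ watom watom_meas D2).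
Qed.

Let XD2 : measurable_fun setT (fun z : S * OD D2 => X theta i z.1 l z.2).
Proof.
apply: (X_OD (D := D2) (y := fst) (g := snd)) => //.
by move=> j /andP[].
Qed.

Let indep : independent_maps P (X theta k x i) (idfun : Omega -> OD D2).
Proof.
apply: (sigma_independent_maps (G1 := \bigcup_(j in D1) watom j)
    (G2 := \bigcup_(j in D2) watom j)).
- move=> A1 A2.
  apply: (sigma_disjoint_independent watom_meas watom_setI watom_setT watom_indep).
  by rewrite -subset0 => j [/=]; rewrite /D1 /D2 /= leqNgt => /negP.
- apply: (X_OD (D := D1) (y := fun=> x) (g := idfun)) => //.
  by move=> j /andP[].
- by move=> _ A mA; rewrite setTI.
- by move=> _ A mA; rewrite setTI.
Qed.

(** The position at time [i] uses only [W theta j] with [i <= j], the continuation only those with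
    [j < i]; these are independent, so the position can be frozen. *)
Lemma X_markov_ge0 (h : S -> \bar R) : measurable_fun setT h ->
  (forall y, 0 <= h y)%E ->
  (\int[P]_w \int[P]_w' h (X theta i (X theta k x i w) l w') =
   \int[P]_w h (X theta k x l w))%E.
Proof.
move=> mh h0; apply/esym.
transitivity (\int[P]_w h (X theta i (X theta k x i w) l (idfun w)))%E.
  by apply: eq_integral => w _; rewrite (X_restart theta x w kK lik).
apply: (ge0_integral_independent (X_meas2 theta x kK ik) id_meas indep
  (h := fun z => h (X theta i z.1 l z.2))) => //.
exact: (measurableT_comp mh XD2).
Qed.

Lemma X_markov (h : S -> \bar R) : measurable_fun setT h ->
  P.-integrable setT (fun w => h (X theta k x l w)) ->
  (\int[P]_w \int[P]_w' h (X theta i (X theta k x i w) l w') =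
   \int[P]_w h (X theta k x l w))%E.
Proof.
move=> mh ih; apply/esym.
transitivity (\int[P]_w h (X theta i (X theta k x i w) l (idfun w)))%E.
  by apply: eq_integral => w _; rewrite (X_restart theta x w kK lik).
apply: (integral_independent (X_meas2 theta x kK ik) id_meas indep
  (h := fun z => h (X theta i z.1 l z.2))) => //.
  exact: (measurableT_comp mh XD2).
by apply: eq_integrable ih => // w _; rewrite (X_restart theta x w kK lik).
Qed.

End markov.

(** * Moments along the chain and a priori bounds on [v] *)

Variable v : nat -> S -> R.
Hypothesis v_meas : forall k, (k <= K)%N -> measurable_fun setT (v k).
Let t0 : Theta := theta_int 0.
Hypothesis moment_fin : forall k x, (0 < k <= K)%N ->
  ('E_P[fun w => (`|v 0%N (X t0 k x 0%N w)| ^+ 2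
    + \sum_(0 <= l < k) `|f l (X t0 k x l w, 0)| ^+ 2)%R] < +oo)%E.
Hypothesis v_eq : forall k x, (0 < k <= K)%N ->
  ((v k x)%:E = 'E_P[fun w =>
     f k.-1 (X t0 k x k.-1 w, v k.-1 (X t0 k x k.-1 w))])%E.

Implicit Types (h : S -> R).

(** An L2 norm along the chain. The real-valued integral is [0] when the true one is infinite, a
    case excluded by [finite_moment]. *)
Definition nrm k l h x := Num.sqrt (\int[P]_w (h (X t0 k x l w)) ^+ 2).
Definition mean k l h x := \int[P]_w h (X t0 k x l w).
Definition finite_moment l h := forall k x, (l <= k <= K)%N ->
  (\int[P]_w ((h (X t0 k x l w)) ^+ 2)%:E < +oo)%E.

Lemma nrm_ge0 k l h x : 0 <= nrm k l h x.
Proof. exact: sqrtr_ge0. Qed.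

Let sq_meas h : measurable_fun setT h -> measurable_fun setT (fun y => ((h y) ^+ 2)%:E).
Proof. by move=> mh; apply/measurable_EFinP; exact: measurable_funX. Qed.

Lemma nrm_sqE k l h x : finite_moment l h -> (l <= k <= K)%N ->
  ((nrm k l h x) ^+ 2)%:E = (\int[P]_w ((h (X t0 k x l w)) ^+ 2)%:E)%E.
Proof.
move=> fin lkK; have i0 : (0 <= \int[P]_w ((h (X t0 k x l w)) ^+ 2)%:E)%E.
  by apply: integral_ge0 => w _; rewrite lee_fin sqr_ge0.
rewrite /nrm sqr_sqrtr; last by rewrite fine_ge0.
by rewrite fineK// ge0_fin_numE// fin.
Qed.

Lemma nrm_L2 theta k l h x : measurable_fun setT h -> finite_moment l h ->
  (l <= k <= K)%N -> L2_le P (fun w => h (X theta k x l w)) (nrm k l h x).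
Proof.
move=> mh fin lkK; have /andP[lk kK] := lkK.
split; [|exact: nrm_ge0|].
  exact: measurableT_comp (X_meas2 _ _ _ _).
rewrite nrm_sqE//.
by rewrite (integral_same_law (X_meas2 theta x kK lk) (X_meas2 t0 x kK lk)
  (X_same_law _ _ _ kK lk) (sq_meas mh)).
Qed.

Lemma L2_finite_moment l h (s : nat -> S -> R) :
  (forall k x, (l <= k <= K)%N -> L2_le P (fun w => h (X t0 k x l w)) (s k x)) ->
  finite_moment l h.
Proof.
by move=> hs k x lkK; have [_ _ H] := hs k x lkK; rewrite (le_lt_trans H)// ltry.
Qed.

Lemma nrm_meas k l h : (l <= k <= K)%N -> measurable_fun setT h ->
  measurable_fun setT (nrm k l h).
Proof.
move=> /andP[lk kK] mh.
have ms : measurable_fun setT (Num.sqrt : R -> R).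
  exact: (continuous_measurable_fun (@sqrt_continuous R)).
apply: (measurableT_comp ms).
apply: (measurableT_comp (f := fine)) => //.
have mH : measurable_fun setT (fun z : S * Omega => ((h (X t0 k z.1 l z.2)) ^+ 2)%:E).
  exact: (measurableT_comp (sq_meas mh) (X_meas t0 kK lk)).
apply: (measurable_fun_fubini_tonelli_F _ mH).
by move=> z; rewrite lee_fin sqr_ge0.
Qed.

Lemma mean_meas k l h : (l <= k <= K)%N -> measurable_fun setT h ->
  measurable_fun setT (mean k l h).
Proof.
move=> /andP[lk kK] mh.
pose H (z : S * Omega) := (h (X t0 k z.1 l z.2))%:E.
have mH : measurable_fun setT H.
  by apply/measurable_EFinP; exact: (measurableT_comp mh (X_meas t0 kK lk)).
apply: (measurableT_comp (f := fine)) => //.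
(* Positive and negative parts are treated separately: Tonelli gives measurability in the starting
   point without integrability. *)
rewrite (_ : (fun y => _) = (fubini_F P H^\+ \- fubini_F P H^\-)%E).
  apply: emeasurable_funB.
    exact: (measurable_fun_fubini_tonelli_F _ (measurable_funepos mH)).
  exact: (measurable_fun_fubini_tonelli_F _ (measurable_funeneg mH)).
apply/funext => y; transitivity (\int[P]_w (H \o pair y) w)%E => //.
by rewrite integralE funepos_comp funeneg_comp.
Qed.

Lemma mean_le_nrm k l h x : measurable_fun setT h -> finite_moment l h ->
  (l <= k <= K)%N -> `|mean k l h x| <= nrm k l h x.
Proof. by move=> mh fin lkK; exact: L2_le_mean (nrm_L2 t0 x mh fin lkK). Qed.

(** The tower property for squares: restarting the chain at its random position at time [i]
    preserves the mean square at time [l]. *)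
Lemma nrm_markov theta k i l h x : measurable_fun setT h -> finite_moment l h ->
  (l <= i <= k)%N -> (k <= K)%N ->
  L2_le P (fun w => nrm i l h (X theta k x i w)) (nrm k l h x).
Proof.
move=> mh fin /andP[li ik] kK; have iK := leq_trans ik kK.
have lk := leq_trans li ik.
split; [|exact: nrm_ge0|].
  by apply: measurableT_comp (X_meas2 _ _ _ _) => //; apply: nrm_meas => //; rewrite li.
rewrite nrm_sqE//; last by rewrite lk.
under eq_integral do rewrite nrm_sqE ?li//.
rewrite (integral_same_law (X_meas2 theta x kK ik) (X_meas2 t0 x kK ik)
  (X_same_law _ _ _ kK ik) (h := fun y => (\int[P]_w ((h (X t0 i y l w)) ^+ 2)%:E)%E)); last first.
  have mH : measurable_fun setT (fun z : S * Omega => ((h (X t0 i z.1 l z.2)) ^+ 2)%:E).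
    exact: (measurableT_comp (sq_meas mh) (X_meas t0 iK li)).
  apply: (measurable_fun_fubini_tonelli_F _ mH).
  by move=> z; rewrite lee_fin sqr_ge0.
have lik : (l <= i <= k)%N by rewrite li.
rewrite (@X_markov_ge0 t0 k i l x kK lik (fun y => ((h y) ^+ 2)%:E))//.
  exact: sq_meas.
by move=> y; rewrite lee_fin sqr_ge0.
Qed.

Lemma mean_markov k i l h x : measurable_fun setT h -> finite_moment l h ->
  (l <= i <= k)%N -> (k <= K)%N ->
  \int[P]_w mean i l h (X t0 k x i w) = mean k l h x.
Proof.
move=> mh fin /andP[li ik] kK; have iK := leq_trans ik kK.
have lk := leq_trans li ik.
congr fine.
have lik : (l <= i <= k)%N by rewrite li.
rewrite -(@X_markov t0 k i l x kK lik (fun y => (h y)%:E)).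
- apply: eq_integral => w _; rewrite fineK// integrable_fin_num//.
  by apply: L2_le_integrable (nrm_L2 t0 _ mh fin _); rewrite li.
- exact/measurable_EFinP.
- by apply: L2_le_integrable (nrm_L2 t0 _ mh fin _); rewrite lk.
Qed.

Lemma X_start theta k x w : (k <= K)%N -> X theta k x k w = x.
Proof. by move=> kK; rewrite X_eq// eqxx. Qed.

Lemma nrm_start k h x : (k <= K)%N -> nrm k k h x = `|h x|.
Proof.
move=> kK; rewrite -sqrtr_sqr; congr Num.sqrt.
under eq_Rintegral do rewrite X_start//.
exact: Rintegral_cst_probability.
Qed.

Definition f0 l x := f l (x, 0).

Lemma f0_meas l : (l <= K)%N -> measurable_fun setT (f0 l).
Proof.
move=> lK; apply: (measurableT_comp (f_meas lK)).
exact: measurable_fun_pair.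
Qed.

Let finite_moment_start l h : (l <= K)%N -> forall x,
  (\int[P]_w ((h (X t0 l x l w)) ^+ 2)%:E < +oo)%E.
Proof.
move=> lK x; under eq_integral do rewrite X_start//.
by rewrite (integral_cst P measurableT ((h x) ^+ 2)%:E)//= probability_setT mule1 ltry.
Qed.

Lemma v0_finite_moment : finite_moment 0 (v 0).
Proof.
(* [moment_fin] is silent at time [0], but there the chain has not moved and the integrand is
   constant. *)
move=> [|k] x /andP[_ kK]; first exact: finite_moment_start.
have := moment_fin x (k := k.+1) kK; rewrite unlock; apply: le_lt_trans.
apply: ge0_le_integral => //.
- by move=> w _; rewrite lee_fin sqr_ge0.
- exact: (measurableT_comp (sq_meas (v_meas (leq0n K))) (X_meas2 _ _ _ _)).
- apply/measurable_EFinP; apply: measurable_funD.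
    apply: measurable_funX; apply: measurableT_comp => //.
    exact: (measurableT_comp (v_meas (leq0n K)) (X_meas2 _ _ _ _)).
  under eq_fun do rewrite big_mkord.
  apply: measurable_sum => l; apply: measurable_funX.
  have lk : (l <= k.+1)%N by exact/ltnW/ltn_ord.
  apply: measurableT_comp => //.
  exact: (measurableT_comp (f0_meas (leq_trans lk kK)) (X_meas2 _ _ kK lk)).
- move=> w _; rewrite lee_fin real_normK ?num_real// lerDl.
  by apply: sumr_ge0 => l _; rewrite sqr_ge0.
Qed.

Lemma f0_finite_moment l : finite_moment l (f0 l).
Proof.
move=> k x /andP[lk kK].
have [kl|kl] := leqP k l.
  have -> : k = l by apply/eqP; rewrite eqn_leq kl lk.
  exact: finite_moment_start (leq_trans lk kK) _.
have k0 : (0 < k <= K)%N by rewrite kK (leq_ltn_trans _ kl).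
have := moment_fin x k0; rewrite unlock; apply: le_lt_trans.
apply: ge0_le_integral => //.
- by move=> w _; rewrite lee_fin sqr_ge0.
- exact: (measurableT_comp (sq_meas (f0_meas (leq_trans lk kK))) (X_meas2 _ _ kK lk)).
- apply/measurable_EFinP; apply: measurable_funD.
    apply: measurable_funX; apply: measurableT_comp => //.
    exact: (measurableT_comp (v_meas (leq0n K)) (X_meas2 _ _ kK _)).
  under eq_fun do rewrite big_mkord.
  apply: measurable_sum => i; apply: measurable_funX.
  have ik : (i <= k)%N by exact/ltnW/ltn_ord.
  apply: measurableT_comp => //.
  exact: (measurableT_comp (f0_meas (leq_trans ik kK)) (X_meas2 _ _ kK ik)).
- move=> w _; rewrite lee_fin big_mkord (bigD1 (Ordinal kl))//=.
  rewrite (real_normK (num_real (f l _))) addrCA lerDl addr_ge0//.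
  by apply: sumr_ge0 => i _; rewrite sqr_ge0.
Qed.

Lemma L_ge0 k : (k <= K)%N -> 0 <= L k.
Proof.
move=> kK; have := f_lip kK point 1 0; rewrite (subr0 (1 : R)) normr1 mulr1.
exact: le_trans.
Qed.

(** The unit in which all errors are measured. At time [K] and point [xi] it is the quantity bounded
    by [kappa]. *)
Definition kap k x := nrm k 0 (v 0) x + \sum_(0 <= l < k) nrm k l (f0 l) x.

Lemma kap_ge0 k x : 0 <= kap k x.
Proof. by rewrite addr_ge0 ?nrm_ge0// sumr_ge0// => l _; rewrite nrm_ge0. Qed.

Let v0_meas : measurable_fun setT (v 0). Proof. exact: v_meas. Qed.

Lemma kap_markov theta k i x : (i <= k)%N -> (k <= K)%N ->
  L2_le P (fun w => kap i (X theta k x i w))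
    (nrm k 0 (v 0) x + \sum_(0 <= l < i) nrm k l (f0 l) x).
Proof.
move=> ik kK; apply: L2_le_add.
  by apply: nrm_markov => //; exact: v0_finite_moment.
rewrite big_nat; under eq_fun do rewrite big_nat.
apply: L2_le_sum => l /andP[_ li]; apply: nrm_markov => //.
- by apply: f0_meas; exact: ltnW (leq_trans li (leq_trans ik kK)).
- exact: f0_finite_moment.
- by rewrite (ltnW li).
Qed.

(** Restarting at time [i] only loses the source terms of times [i] and later. Hence a bound
    relative to [kap], valid at every point, persists at random positions. *)
Lemma kap_markov_le theta k i x : (i <= k)%N -> (k <= K)%N ->
  L2_le P (fun w => kap i (X theta k x i w)) (kap k x).
Proof.
move=> ik kK; apply: L2_le_weaken (kap_markov theta x ik kK).
rewrite lerD2l [leRHS](@big_cat_nat _ _ _ i)//= lerDl.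
by apply: sumr_ge0 => l _; exact: nrm_ge0.
Qed.

Definition growth k := \prod_(0 <= l < k) (1 + L l).

Lemma growth_ge1 k : (k <= K)%N -> 1 <= growth k.
Proof.
move=> kK; rewrite /growth big_nat.
elim/big_ind: _ => [|a b a1 b1|l /andP[_ lk]]; rewrite ?lexx//.
  exact: mulr_ege1.
by rewrite lerDl L_ge0// ltnW// (leq_trans lk).
Qed.

Definition fv l y := f l (y, v l y).

Lemma fv_meas l : (l <= K)%N -> measurable_fun setT (fv l).
Proof.
move=> lK; apply: (measurableT_comp (f_meas lK)).
by apply: measurable_fun_pair => //; exact: v_meas.
Qed.

Lemma v_mean k x : (k < K)%N -> v k.+1 x = mean k.+1 k (fv k) x.
Proof.
move=> kK; have := @v_eq k.+1 x kK; rewrite unlock => /(congr1 fine) /= ->.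
by [].
Qed.

Lemma f_growth k y a : (k <= K)%N -> `|f k (y, a)| <= `|f0 k y| + (1 + L k) * `|a|.
Proof.
move=> kK; have := f_lip kK y a 0; rewrite !subr0 -/(f0 k y) => H.
have -> : f k (y, a) = (f k (y, a) - a - f0 k y) + f0 k y + a by ring.
rewrite (le_trans (ler_normD _ _))// mulrDl mul1r addrCA.
rewrite (le_trans (lerD (ler_normD _ _) (lexx _)))//.
by move: H; lra.
Qed.

(** Discrete Gronwall: a step costs the factor [1 + L k], since [f k (y, a) - a] is Lipschitz in
    [a]. It supplies the square integrability of [v] along the chain and the base case of the error
    bound. *)
Lemma v_le_kap k x : (k <= K)%N -> `|v k x| <= growth k * kap k x.
Proof.
elim: k x => [|k IH] x kK.
  by rewrite /growth /kap !big_nil mul1r addr0 nrm_start.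
have kK' := ltnW kK; rewrite v_mean//.
have mX := X_meas2 t0 x kK (leqnSn k).
set b := nrm k.+1 k (f0 k) x.
set a := nrm k.+1 0 (v 0) x + \sum_(0 <= l < k) nrm k.+1 l (f0 l) x.
have Lk := L_ge0 kK'; have g1 := growth_ge1 kK'.
have a0 : 0 <= a by rewrite addr_ge0 ?nrm_ge0// sumr_ge0// => l _; rewrite nrm_ge0.
have b0 : 0 <= b by exact: nrm_ge0.
have H : L2_le P (fun w => fv k (X t0 k.+1 x k w)) (b + (1 + L k) * (growth k * a)).
  pose Z w := `|f0 k (X t0 k.+1 x k w)| + (1 + L k) * (growth k * kap k (X t0 k.+1 x k w)).
  apply: (L2_le_mono (Y := Z)).
  - exact: (measurableT_comp (fv_meas kK') mX).
  - move=> w; rewrite (le_trans (f_growth _ _ kK'))// (le_trans _ (ler_norm _))//.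
    by rewrite lerD2l ler_wpM2l ?addr_ge0// IH.
  - apply: L2_le_add.
      apply: L2_le_mono (nrm_L2 t0 x (f0_meas kK') (@f0_finite_moment k) _).
      + by apply: measurableT_comp => //; exact: (measurableT_comp (f0_meas kK') mX).
      + by move=> w; rewrite normr_id.
      + by rewrite leqnSn.
    apply: L2_le_pscale; first by rewrite addr_ge0.
    by apply: L2_le_pscale; [exact: le_trans g1|exact: kap_markov].
rewrite (le_trans (L2_le_mean H))//.
rewrite /growth big_nat_recr//= -/(growth k) /kap big_nat_recr//= -/b addrA -/a.
(* The new source term enters without a growth factor; as the factor is at least [1], it is
   absorbed. *)
have : 0 <= (growth k * (1 + L k) - 1) * b.
  rewrite mulr_ge0// subr_ge0 mulr_ege1// lerDl//.
by lra.
Qed.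

Lemma mean_L2 theta k i l h x : measurable_fun setT h -> finite_moment l h ->
  (l <= i <= k)%N -> (k <= K)%N ->
  L2_le P (fun w => mean i l h (X theta k x i w)) (nrm k l h x).
Proof.
move=> mh fin lik kK; have /andP[li ik] := lik.
have liK : (l <= i <= K)%N by rewrite li (leq_trans ik).
apply: L2_le_mono (nrm_markov theta x mh fin lik kK).
  exact: (measurableT_comp (mean_meas liK mh) (X_meas2 _ _ kK ik)).
by move=> w; rewrite (ger0_norm (nrm_ge0 _ _ _ _)) mean_le_nrm.
Qed.

Lemma v_L2 theta k l x : (l <= k <= K)%N ->
  L2_le P (fun w => v l (X theta k x l w)) (growth l * kap k x).
Proof.
move=> /andP[lk kK]; have lK := leq_trans lk kK; have g1 := growth_ge1 lK.
have g0 := le_trans ler01 g1.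
apply: L2_le_mono (L2_le_pscale g0 (kap_markov_le theta x lk kK)).
  exact: (measurableT_comp (v_meas lK) (X_meas2 _ _ kK lk)).
by move=> w; rewrite (le_trans (v_le_kap _ lK))// ler_norm.
Qed.

Lemma fv_L2 theta k l x : (l <= k <= K)%N ->
  L2_le P (fun w => fv l (X theta k x l w))
    (nrm k l (f0 l) x + (1 + L l) * (growth l * kap k x)).
Proof.
move=> lkK; have /andP[lk kK] := lkK; have lK := leq_trans lk kK.
have fin := @f0_finite_moment l; have mf0 := f0_meas lK; have Ll := L_ge0 lK.
have mX := X_meas2 theta x kK lk.
pose Z w := `|f0 l (X theta k x l w)| + (1 + L l) * `|v l (X theta k x l w)|.
apply: (L2_le_mono (Y := Z)).
- exact: (measurableT_comp (fv_meas lK) mX).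
- by move=> w; rewrite (le_trans (f_growth _ _ lK))// ler_norm.
- apply: L2_le_add.
    apply: L2_le_mono (nrm_L2 theta x mf0 fin lkK) => [|w]; last by rewrite normr_id.
    by apply: measurableT_comp => //; exact: (measurableT_comp mf0 mX).
  apply: L2_le_pscale; first by rewrite addr_ge0.
  apply: L2_le_mono (v_L2 theta x lkK) => [|w]; last by rewrite normr_id.
  by apply: measurableT_comp => //; exact: (measurableT_comp (v_meas lK) mX).
Qed.

Definition gv l y := fv l y - v l y.

Lemma gv_meas l : (l <= K)%N -> measurable_fun setT (gv l).
Proof. by move=> lK; apply: measurable_funB; [exact: fv_meas|exact: v_meas]. Qed.

Lemma gv_finite_moment l : (l <= K)%N -> finite_moment l (gv l).
Proof.
move=> lK; apply: L2_finite_moment => k x lkK.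
exact: (L2_le_sub (fv_L2 t0 x lkK) (v_L2 t0 x lkK)).
Qed.

(** Each step of [v_eq], with [fv] split as [gv + v], contributes one mean of [gv]; the Markov
    property turns means seen from the intermediate position into means seen from the start. *)
Lemma v_expansion k x : (k <= K)%N ->
  v k x = mean k 0 (v 0) x + \sum_(0 <= l < k) mean k l (gv l) x.
Proof.
elim: k x => [|k IH] x kK.
  rewrite big_nil addr0 /mean; under eq_Rintegral do rewrite X_start//.
  by rewrite Rintegral_cst_probability.
have kK' := ltnW kK; rewrite v_mean//.
have kkK : (k <= k.+1 <= K)%N by rewrite leqnSn.
have iv := L2_le_integrable (v_L2 t0 x kkK).
have ig := L2_le_integrable (nrm_L2 t0 x (gv_meas kK') (gv_finite_moment kK') kkK).
have -> : mean k.+1 k (fv k) x = mean k.+1 k (gv k) x + mean k.+1 k (v k) x.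
  rewrite -RintegralD//; apply: eq_Rintegral => w _.
  by rewrite /gv subrK.
rewrite big_nat_recr//= addrA [RHS]addrC; congr (_ + _).
have -> : mean k.+1 k (v k) x = \int[P]_w (mean k 0 (v 0) (X t0 k.+1 x k w) +
    \sum_(l < k) mean k l (gv l) (X t0 k.+1 x k w)).
  by apply: eq_Rintegral => w _; rewrite IH// big_mkord.
have h0 : (0 <= k <= k.+1)%N by rewrite leqnSn.
have i0 : P.-integrable setT (EFin \o (fun w => mean k 0 (v 0) (X t0 k.+1 x k w))).
  exact: (L2_le_integrable (mean_L2 t0 x v0_meas v0_finite_moment h0 kK)).
have i1 (l : 'I_k) : P.-integrable setT
    (EFin \o (fun w => mean k l (gv l) (X t0 k.+1 x k w))).
  have lk := ltn_ord l; have lK := ltnW (leq_trans lk kK').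
  apply: L2_le_integrable (mean_L2 _ _ (gv_meas lK) (gv_finite_moment lK) _ kK).
  by rewrite (ltnW lk) leqnSn.
rewrite RintegralD//; last first.
  apply: eq_integrable (integrable_sum measurableT (index_enum 'I_k) (fun l _ => i1 l)) => //.
  by move=> w _ /=; rewrite sumEFin.
rewrite Rintegral_sum// (mean_markov x v0_meas v0_finite_moment h0 kK).
rewrite big_mkord; congr (_ + _); apply: eq_bigr => l _.
have lk := ltn_ord l; have lK := ltnW (leq_trans lk kK').
by rewrite mean_markov ?(ltnW lk) ?leqnSn//; [exact: gv_meas|exact: gv_finite_moment].
Qed.

(** * The scheme as a functional of the noise *)

Variable c : R.
Hypothesis c_ge0 : 0 <= c.
Variable Rc : Theta -> nat -> Omega -> nat.
Hypothesis Rc_iid : iid P (fun theta => proc K (Rc theta)).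
Variable pf : nat -> nat -> R.
Hypothesis Rc_le : forall theta k w, (0 < k <= K)%N -> (Rc theta k w <= k - 1)%N.
Hypothesis pf_eq : forall k l, (0 < k <= K)%N -> (l < k)%N ->
  pf k l * fine (P [set w | Rc t0 k w = l]) =
  `|fine (P [set w | Rc t0 k w = l])| ^+ 2.
Hypothesis L_le : forall k l, (0 < k <= K)%N -> (l < k)%N ->
  L l <= c * fine (P [set w | Rc t0 k w = l]).
Hypothesis Rc_W_indep : independent_families P
  (fun theta => proc K (Rc theta)) (fun theta => proc K (W theta)).
Variable M : nat.
Hypothesis M_gt0 : (0 < M)%N.
Variable V : Theta -> nat -> nat -> S -> Omega -> R.
Hypothesis V_eq : forall n theta k x w, (k <= K)%N ->
  V theta k n x w =
    (0 < n)%N%:R / M%:R ^+ n *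
      \sum_(1 <= m < (M ^ n).+1)
        (v 0%N (X (theta_app theta 0 (- m%:Z)) k x 0%N w)
         + \sum_(0 <= l < k) f l (X (theta_app theta 0 m%:Z) k x l w, 0))
    + \sum_(1 <= j < n)
        (M%:R ^+ (n - j))^-1 *
        \sum_(1 <= m < (M ^ (n - j)).+1)
          let theta1 := theta_app theta j%:Z m%:Z in
          let theta2 := theta_app theta j%:Z (- m%:Z) in
          let r := Rc theta1 k w in
          let Y := X theta1 k x r w in
          (0 < k)%N%:R / pf k r *
            (f r (Y, V theta1 r j Y w)
             - V theta1 r j Y w
             - f r (Y, V theta2 r j.-1 Y w)
             + V theta2 r j.-1 Y w).

Definition clock theta w := proc K (Rc theta) w.

Lemma clock_meas theta : measurable_fun setT (clock theta).
Proof. by case: Rc_iid => + _ _; exact. Qed.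

Lemma clockE theta k w : (k <= K)%N -> tnth (clock theta w) (inord k) = Rc theta k w.
Proof. by move=> kK; rewrite tnth_mktuple inordK. Qed.

Definition first_term theta k x m w :=
  v 0 (X (theta_app theta 0 (- m%:Z)) k x 0 w) +
  \sum_(0 <= l < k) f0 l (X (theta_app theta 0 m%:Z) k x l w).

(** The indicator turns the random index into a sum over fixed ones. Subtracting [gv] centres at the
    exact solution and cancels in the difference of two levels. *)
Definition term k l r y a : R := (r == l)%:R / pf k l * (f l (y, a) - a - gv l y).

(** The node [t1] supplies the random time and the chain, [t2] the inner approximation: in the
    scheme [t2] is [t1] at level [j] and the node with the sign of [m] flipped at level [j.-1]. *)
Definition incr (t1 t2 : Theta) k j x w : R :=
  \sum_(0 <= l < k)
    term k l (Rc t1 k w) (X t1 k x l w) (V t2 l j (X t1 k x l w) w).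

Lemma V_decomp n theta k x w : (k <= K)%N ->
  V theta k n x w =
    (0 < n)%N%:R / M%:R ^+ n *
      \sum_(1 <= m < (M ^ n).+1) first_term theta k x m w
    + \sum_(1 <= j < n) (M%:R ^+ (n - j))^-1 * \sum_(1 <= m < (M ^ (n - j)).+1)
       (incr (theta_app theta j%:Z m%:Z) (theta_app theta j%:Z m%:Z) k j x w -
        incr (theta_app theta j%:Z m%:Z) (theta_app theta j%:Z (- m%:Z)) k j.-1 x w).
Proof.
move=> kK; rewrite V_eq//; congr (_ + _); apply: eq_bigr => j _.
congr (_ * _); apply: eq_bigr => m _ /=.
rewrite /incr -sumrB big_mkord.
case: k kK => [|k] kK; first by rewrite big_ord0 !mul0r.
set t1 := theta_app theta j m%:Z; set t2 := theta_app theta _ _.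
have rk : (Rc t1 k.+1 w < k.+1)%N.
  by rewrite ltnS (leq_trans (@Rc_le t1 k.+1 w kK))// subn1.
rewrite [RHS](bigD1 (Ordinal rk))//= [X in _ = _ + X]big1 ?addr0; last first.
  move=> l /eqP lr; rewrite /term.
  have /negPf -> : Rc t1 k.+1 w != l by apply/eqP => rl; apply: lr; exact: val_inj.
  by rewrite !mul0r subrr.
rewrite /term eqxx -mulrBr; congr (_ * _).
have cancel_gv (a b e a' b' : R) : a - b - a' + b' = a - b - e - (a' - b' - e) by ring.
exact: cancel_gv.
Qed.

Let nat_meas d (T : measurableType d) (g : nat -> T) : measurable_fun setT g.
Proof. by move=> _ A _. Qed.

Local Notation trees := (@tree_measurable disp _ _ Omega _ _ driver clock _ S _ _).

Lemma X_tree (y : Theta -> S -> Omega -> S) j m k l : (k <= K)%N -> (l <= k)%N ->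
  trees y ->
  trees (fun theta x w => X (theta_app theta j m) k (y theta x w) l w).
Proof.
move=> kK lk ty; have hl : (l + (k - l) <= K)%N by rewrite subnKC.
have := tree_measurable_comp (flow_meas hl)
  (tree_measurable_pair ty (@tree_measurable_Y disp _ _ _ _ _ driver clock _ S j m)).
move=> [G [mG E]]; exists G; split => // theta x w.
by rewrite X_flow// -E.
Qed.

Lemma first_term_tree k m : (k <= K)%N ->
  trees (fun theta x w => first_term theta k x m w).
Proof.
move=> kK; apply: tree_measurable_add.
  apply: (tree_measurable_comp v0_meas).
  by apply: X_tree => //; exact: tree_measurable_id.
apply: tree_measurable_sum => l; rewrite mem_index_iota => /andP[_ lk].
have lK := leq_trans (ltnW lk) kK.
apply: (tree_measurable_comp (f0_meas lK)).
by apply: X_tree => //; [exact: ltnW|exact: tree_measurable_id].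
Qed.

Lemma term_meas k l : (l <= K)%N ->
  measurable_fun setT (fun z : nat * (S * R) => term k l z.1 z.2.1 z.2.2).
Proof.
move=> lK; apply: measurable_funM.
  apply: measurable_funM => //.
  exact: (measurableT_comp (@nat_meas _ _ (fun r => (r == l)%:R : R)) measurable_fst).
apply: measurable_funB.
  apply: measurable_funB; last exact: (measurableT_comp measurable_snd measurable_snd).
  have -> : (fun z : nat * (S * R) => f l (z.2.1, z.2.2)) = f l \o snd.
    by apply/funext => -[? []].
  exact: (measurableT_comp (f_meas lK) measurable_snd).
exact: (measurableT_comp (gv_meas lK) (measurableT_comp measurable_fst measurable_snd)).
Qed.

Lemma incr_tree k j a m m' : (k <= K)%N ->
  (forall l, (l < k)%N -> trees (fun theta x w => V theta l j x w)) ->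
  trees (fun theta x w =>
    incr (theta_app theta a m) (theta_app theta a m') k j x w).
Proof.
move=> kK Vt; apply: tree_measurable_sum => l; rewrite mem_index_iota => /andP[_ lk].
have lK := leq_trans (ltnW lk) kK.
have tX : trees (fun theta x w => X (theta_app theta a m) k x l w).
  by apply: X_tree => //; [exact: ltnW|exact: tree_measurable_id].
apply: (tree_measurable_comp (term_meas k lK) (U := fun theta x w =>
  (Rc (theta_app theta a m) k w, (X (theta_app theta a m) k x l w,
     V (theta_app theta a m') l j (X (theta_app theta a m) k x l w) w)))).
apply: tree_measurable_pair.
  have [G [mG E]] := tree_measurable_comp (@measurable_tnth _ _ K.+1 (inord k))
    (@tree_measurable_Z disp _ _ _ _ _ driver clock _ S a m).
  by exists G; split => // theta x w; rewrite -E clockE.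
apply: tree_measurable_pair => //.
exact: (tree_measurable_app a m' (Vt l lk) tX).
Qed.

(** Strong induction on the level: the recursion calls only smaller levels, at child nodes and at
    positions that are themselves functionals of the noise. *)
Lemma V_tree n k : (k <= K)%N -> trees (fun theta x w => V theta k n x w).
Proof.
elim/ltn_ind: n k => n IH k kK.
suff [G [mG E]] : trees (fun theta x w => (0 < n)%N%:R / M%:R ^+ n *
      \sum_(1 <= m < (M ^ n).+1) first_term theta k x m w
    + \sum_(1 <= j < n) (M%:R ^+ (n - j))^-1 * \sum_(1 <= m < (M ^ (n - j)).+1)
       (incr (theta_app theta j%:Z m%:Z) (theta_app theta j%:Z m%:Z) k j x w +
        - 1 * incr (theta_app theta j%:Z m%:Z) (theta_app theta j%:Z (- m%:Z)) k j.-1 x w)).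
  exists G; split => // theta x w; rewrite -E V_decomp//; congr (_ + _).
  by apply: eq_bigr => j _; congr (_ * _); apply: eq_bigr => m _; rewrite mulN1r.
apply: tree_measurable_add.
  apply: tree_measurable_mul; first exact: tree_measurable_cst.
  by apply: tree_measurable_sum => m _; exact: first_term_tree.
apply: tree_measurable_sum => j; rewrite mem_index_iota => /andP[j0 jn].
apply: tree_measurable_mul; first exact: tree_measurable_cst.
apply: tree_measurable_sum => m _; apply: tree_measurable_add.
  by apply: incr_tree => // l lk; apply: IH => //; exact: leq_trans (ltnW lk) kK.
apply: tree_measurable_mul; first exact: tree_measurable_cst.
apply: incr_tree => // l lk; apply: IH; last exact: leq_trans (ltnW lk) kK.
exact: leq_ltn_trans (leq_pred _) jn.
Qed.

Local Notation obs := (observing driver clock).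

Let driver_iid : iid P driver := W_iid.
Let clock_iid : iid P clock := Rc_iid.
Let clock_driver_indep : independent_families P clock driver := Rc_W_indep.
Let driver_indep : mutually_independent P driver. Proof. by case: driver_iid. Qed.
Let clock_indep : mutually_independent P clock. Proof. by case: clock_iid. Qed.

Lemma indep_obs d' d'' (T : measurableType d') (T' : measurableType d'')
  (D1 D2 : set (Theta * bool)) (U1 : Omega -> T) (U2 : Omega -> T') :
  D1 `&` D2 = set0 ->
  measurable_fun setT (U1 : obs D1 -> T) -> measurable_fun setT (U2 : obs D2 -> T') ->
  independent_maps P U1 U2.
Proof.
exact: (independent_observing driver_meas clock_meas driver_indep clock_indep
  clock_driver_indep).
Qed.

Lemma X_obs (D : set (Theta * bool)) t k l x : (k <= K)%N -> (l <= k)%N ->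
  D (t, true) -> measurable_fun setT (X t k x l : obs D -> S).
Proof.
move=> kK lk Dt; have hl : (l + (k - l) <= K)%N by rewrite subnKC.
rewrite (_ : X t k x l = (fun w => flow l (k - l) x (driver t w))); last first.
  by apply/funext => w; rewrite X_flow.
have md : measurable_fun setT (driver t : obs D -> _) by exact: observing_Y.
exact: (measurableT_comp (measurable_fun_pair2 x (flow_meas hl)) md).
Qed.

Lemma Rc_obs (D : set (Theta * bool)) t k : (k <= K)%N ->
  D (t, false) -> measurable_fun setT (Rc t k : obs D -> nat).
Proof.
move=> kK Dt.
rewrite (_ : Rc t k = (fun w => tnth (clock t w) (inord k))); last first.
  by apply/funext => w; rewrite clockE.
have mc : measurable_fun setT (clock t : obs D -> _) by exact: observing_Z.
exact: (measurableT_comp (measurable_tnth _) mc).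
Qed.

Lemma V_obs (D : set (Theta * bool)) t k n : (k <= K)%N -> below t `<=` D ->
  measurable_fun setT (fun z : S * obs D => V t k n z.1 z.2).
Proof. by move=> kK bD; exact: (observing_tree_measurable bD (V_tree n kK)). Qed.

Lemma V_obs_at (D : set (Theta * bool)) t k n (y : Omega -> S) :
  (k <= K)%N -> below t `<=` D -> measurable_fun setT (y : obs D -> S) ->
  measurable_fun setT ((fun w => V t k n (y w) w) : obs D -> R).
Proof.
move=> kK bD my.
have my' : measurable_fun setT (fun w : obs D => (y w, w)).
  by apply: measurable_fun_pair.
exact: (measurableT_comp (V_obs n kK bD) my').
Qed.

Lemma incr_obs (D : set (Theta * bool)) t1 t2 k j x : (k <= K)%N ->
  D (t1, true) -> D (t1, false) -> below t2 `<=` D ->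
  measurable_fun setT (incr t1 t2 k j x : obs D -> R).
Proof.
move=> kK Dt Df bD.
rewrite (_ : incr _ _ _ _ _ = fun w => \sum_(l < k) term k l (Rc t1 k w)
  (X t1 k x l w) (V t2 l j (X t1 k x l w) w)); last first.
  by apply/funext => w; rewrite /incr big_mkord.
apply: measurable_sum => l; have lk := ltnW (ltn_ord l).
have mX := X_obs x kK lk Dt; have lK := leq_trans lk kK.
apply: (measurableT_comp (term_meas k lK)
  (g := fun w : obs D => (Rc t1 k w, (X t1 k x l w, V t2 l j (X t1 k x l w) w)))).
apply: measurable_fun_pair; first exact: Rc_obs.
by apply: measurable_fun_pair => //; exact: V_obs_at.
Qed.

Definition detached (t1 t2 : Theta) := forall eta, t1 <> theta_cat t2 eta.

Definition hit k l := fine (P [set w | Rc t0 k w = l]).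

Lemma hitE t k l : (k <= K)%N -> P [set w | Rc t k w = l] = (hit k l)%:E.
Proof.
move=> kK; have mR t' : measurable [set w | Rc t' k w = l].
  have mR : measurable_fun setT (Rc t' k).
    exact: (measurable_observing driver_meas clock_meas (Rc_obs (D := setT) kK I)).
  by have := mR measurableT [set l] Logic.I; rewrite setTI.
rewrite /hit fineK ?fin_num_measure//.
have E t' : [set w | Rc t' k w = l] = clock t' @^-1` [set u | tnth u (inord k) = l].
  by apply/seteqP; split => w /=; rewrite clockE.
rewrite !E; case: clock_iid => _ _; apply.
have := @measurable_tnth _ nat K.+1 (inord k) measurableT [set l] Logic.I.
by rewrite setTI.
Qed.

Lemma hit_ge0 k l : 0 <= hit k l. Proof. exact: fine_ge0. Qed.

Lemma hit_pf k l : (0 < k <= K)%N -> (l < k)%N -> hit k l <> 0 -> pf k l = hit k l.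
Proof.
move=> kK lk h0; have := pf_eq kK lk; rewrite -/(hit k l) real_normK ?num_real//.
by rewrite expr2 => /mulIf; apply; apply/eqP.
Qed.

Lemma hit0_L k l : (0 < k <= K)%N -> (l < k)%N -> hit k l = 0 -> L l = 0.
Proof.
move=> kK lk h0; have := L_le kK lk; rewrite -/(hit k l) h0 mulr0 => Ll.
apply/eqP; rewrite eq_le Ll L_ge0//; case/andP: kK => _ kK.
exact: leq_trans (ltnW lk) kK.
Qed.

(** Where [hit] is positive it equals [pf], so the left side is [L l ^+ 2 / hit k l]; where it
    vanishes, so does [L l]. *)
Lemma hit_weight k l : (0 < k <= K)%N -> (l < k)%N ->
  hit k l * (L l / pf k l) ^+ 2 <= c * L l.
Proof.
move=> kK lk; have [h0|/eqP h0] := eqVneq (hit k l) 0.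
  by rewrite h0 mul0r (hit0_L kK lk h0) mulr0.
have hp : 0 < hit k l by rewrite lt_neqAle hit_ge0 andbT eq_sym; apply/eqP.
have L0 : 0 <= L l.
  by apply: L_ge0; case/andP: kK => _; exact: leq_trans (ltnW lk).
rewrite hit_pf//.
have -> : hit k l * (L l / hit k l) ^+ 2 = L l / hit k l * L l.
  by field; apply/eqP.
by rewrite ler_wpM2r// ler_pdivrMr//; exact: L_le.
Qed.

Lemma hit_sum k : (0 < k <= K)%N -> \sum_(0 <= l < k) hit k l = 1.
Proof.
move=> kK; have /andP[k0 kK'] := kK; rewrite big_mkord.
have mR l : measurable [set w | Rc t0 k w = l].
  have mR : measurable_fun setT (Rc t0 k).
    exact: (measurable_observing driver_meas clock_meas (Rc_obs (D := setT) kK' I)).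
  by have := mR measurableT [set l] Logic.I; rewrite setTI.
apply: EFin_inj; rewrite -sumEFin -(probability_setT P).
under eq_bigr do rewrite -(hitE t0)//.
transitivity (P (\big[setU/set0]_(l < k) [set w | Rc t0 k w = l])).
  rewrite measure_bigsetU_ord//.
  by move=> i j _ _ [w [/= wi wj]]; apply: val_inj; rewrite /= -wi -wj.
congr (P _); rewrite -subTset => w _; rewrite -bigcup_seq /=.
have rk : (Rc t0 k w < k)%N.
  by rewrite (leq_ltn_trans (Rc_le t0 w kK))// subn1 prednK.
by exists (Ordinal rk) => //=; rewrite mem_index_enum.
Qed.

Lemma L_sum k : (k <= K)%N -> \sum_(0 <= l < k) L l <= c.
Proof.
case: k => [|k] kK; first by rewrite big_nil.
rewrite -[leRHS]mulr1 -(@hit_sum k.+1)// mulr_sumr.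
by rewrite !big_mkord; apply: ler_sum => l _; exact: L_le.
Qed.

Lemma V0 t k x w : (k <= K)%N -> V t k 0 x w = 0.
Proof. by move=> kK; rewrite V_eq// !mul0r big_geq// addr0. Qed.

Lemma measurable_obs d' (T : measurableType d') (D : set (Theta * bool))
    (U : Omega -> T) :
  measurable_fun setT (U : obs D -> T) -> measurable_fun setT U.
Proof. exact: (measurable_observing driver_meas clock_meas). Qed.

Let id_obs (D : set (Theta * bool)) : measurable_fun setT (idfun : Omega -> obs D).
Proof. by apply: (@measurable_obs _ _ D) => _ A mA; rewrite setTI. Qed.

Lemma incr_meas t1 t2 k j x : (k <= K)%N -> measurable_fun setT (incr t1 t2 k j x).
Proof. by move=> kK; apply: (@measurable_obs _ _ setT); exact: incr_obs. Qed.

(** The position of the chain is independent of the noise below [t2]. Freezing it reduces the claim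
    to the pointwise bound, and averaging [kap] over the position costs nothing. *)
Lemma V_X_L2 t1 t2 k l j x s : (l <= k <= K)%N -> detached t1 t2 -> 0 <= s ->
  (forall y, L2_le P (fun w => V t2 l j y w - v l y) (s * kap l y)) ->
  L2_le P (fun w => V t2 l j (X t1 k x l w) w - v l (X t1 k x l w)) (s * kap k x).
Proof.
move=> /andP[lk kK] t12 s0 H; have lK := leq_trans lk kK.
pose D1 : set (Theta * bool) := [set ib | ib.1 = t1].
have D12 : D1 `&` below t2 = set0.
  by rewrite -subset0 => -[i b] [/= i1 [eta /= i2]]; apply: (t12 eta); rewrite -i2 -i1.
have mX := X_obs (D := D1) x kK lk (erefl _).
have ind : independent_maps P (X t1 k x l) (idfun : Omega -> obs (below t2)).
  by apply: (indep_obs D12 mX) => _ A mA; rewrite setTI.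
have mXO : measurable_fun setT (X t1 k x l) := measurable_obs mX.
have mD : measurable_fun setT (fun z : S * obs (below t2) => V t2 l j z.1 z.2 - v l z.1).
  apply: measurable_funB; first exact: V_obs.
  exact: (measurableT_comp (v_meas lK) measurable_fst).
have [_ _ Hk] := L2_le_pscale s0 (kap_markov_le t1 x lk kK).
split; last 1 first.
- rewrite (ge0_integral_independent mXO (@id_obs _) ind
    (h := fun z => ((V t2 l j z.1 z.2 - v l z.1) ^+ 2)%:E)) => [||z]; last 2 first.
  + by apply/measurable_EFinP; exact: measurable_funX.
  + by rewrite lee_fin sqr_ge0.
  apply: le_trans Hk; apply: ge0_le_integral => //.
  + by move=> w _; apply: integral_ge0 => w' _; rewrite lee_fin sqr_ge0.
  + have mF := measurable_fun_fubini_tonelli_F (m2 := P) (fun z : S * Omega =>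
      ((V t2 l j z.1 z.2 - v l z.1) ^+ 2)%:E).
    apply: (measurableT_comp (mF _ _) mXO) => [|z]; last by rewrite lee_fin sqr_ge0.
    apply/measurable_EFinP; apply: measurable_funX; apply: measurable_funB.
      have mi : measurable_fun setT (fun z : S * Omega => (z.1, idfun z.2 : obs (below t2))).
        apply: measurable_fun_pair => //.
        exact: (measurableT_comp (@id_obs _) measurable_snd).
      exact: (measurableT_comp (V_obs j lK (@subset_refl _ (below t2))) mi).
    exact: (measurableT_comp (v_meas lK) measurable_fst).
  + have [mk _ _] := L2_le_pscale s0 (kap_markov_le t1 x lk kK).
    by apply/measurable_EFinP; exact: measurable_funX.
  + by move=> w _; have [_ _] := H (X t1 k x l w).
- apply: measurable_funB; last exact: (measurableT_comp (v_meas lK) mXO).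
  apply: (@measurable_obs _ _ setT); apply: V_obs_at => //.
  exact: X_obs.
- by rewrite mulr_ge0// kap_ge0.
Qed.

Lemma term_pick (k r : nat) (b : nat -> R) :
  \sum_(0 <= l < k) (r == l)%:R * b l = if (r < k)%N then b r else 0.
Proof.
rewrite big_mkord; case: ltnP => [rk|kr].
  rewrite (bigD1 (Ordinal rk))//= eqxx mul1r big1 ?addr0// => l /eqP lr.
  suff /negPf -> : r != l by rewrite mul0r.
  by apply/eqP => rl; apply: lr; exact: val_inj.
apply: big1 => l _; suff /negPf -> : r != l by rewrite mul0r.
by apply/eqP => rl; move: (ltn_ord l); rewrite -rl ltnNge kr.
Qed.

(** The random time is independent of the chain and of the inner error, so the second moment splits
    over [l] with weights [hit_weight]. *)
Lemma incr_L2 t1 t2 k j x (s : nat -> R) B : (0 < k <= K)%N -> detached t1 t2 ->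
  0 <= B -> c * (\sum_(0 <= l < k) L l * s l ^+ 2) <= B ^+ 2 ->
  (forall l, (l < k)%N ->
    L2_le P (fun w => V t2 l j (X t1 k x l w) w - v l (X t1 k x l w)) (s l)) ->
  L2_le P (incr t1 t2 k j x) B.
Proof.
move=> kK t12 B0 sB Vs; have /andP[k0 kK'] := kK.
split; [exact: incr_meas|by []|].
pose G l w := (L l / pf k l) ^+ 2 * (V t2 l j (X t1 k x l w) w - v l (X t1 k x l w)) ^+ 2.
have G0 l w : 0 <= G l w by rewrite mulr_ge0 ?sqr_ge0.
have mV l : (l < k)%N ->
    measurable_fun setT (fun w => V t2 l j (X t1 k x l w) w - v l (X t1 k x l w)).
  by move=> lk; exact: L2_le_meas (Vs l lk).
have mG l : (l < k)%N -> measurable_fun setT (G l).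
  by move=> lk; apply: measurable_funM => //; exact/measurable_funX/mV.
have mR : measurable_fun setT (Rc t1 k).
  exact: (measurable_obs (Rc_obs (D := setT) kK' I)).
have mind l : measurable_fun setT (fun w => (Rc t1 k w == l)%:R : R).
  exact: (measurableT_comp (@nat_meas _ _ (fun r => (r == l)%:R : R)) mR).
(* At most one indicator is nonzero, so squaring creates no cross terms; the Lipschitz bound is
   applied to the surviving summand. *)
apply: (@le_trans _ _ (\int[P]_w (\sum_(l < k) ((Rc t1 k w == l)%:R * G l w)%:E))%E).
  apply: ge0_le_integral => //.
  - by move=> w _; rewrite lee_fin sqr_ge0.
  - by apply/measurable_EFinP; apply: measurable_funX; exact: incr_meas.
  - apply: emeasurable_sum => l; apply/measurable_EFinP; apply: measurable_funM => //.
    exact: mG.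
  - move=> w _; rewrite sumEFin lee_fin.
    rewrite -(big_mkord xpredT (fun l => (Rc t1 k w == l)%:R * G l w)) term_pick.
    have -> : incr t1 t2 k j x w = if (Rc t1 k w < k)%N then
        let l := Rc t1 k w in let y := X t1 k x l w in
        (pf k l)^-1 * (f l (y, V t2 l j y w) - V t2 l j y w - gv l y) else 0.
      rewrite -(term_pick _ _ (fun l => let y := X t1 k x l w in
        (pf k l)^-1 * (f l (y, V t2 l j y w) - V t2 l j y w - gv l y))).
      by apply: eq_bigr => l _; rewrite /term mulrA.
    case: ifP => [rk|_]; last by rewrite expr0n.
    set l := Rc t1 k w in rk *; cbv zeta; set y := X t1 k x l w.
    have lK := leq_trans (ltnW rk) kK'.
    have := f_lip lK y (V t2 l j y w) (v l y); rewrite -/(fv l y) -/(gv l y) => Hl.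
    rewrite /G -/y [leLHS]exprMn exprVn expr_div_n [leRHS]mulrAC [leRHS]mulrC.
    rewrite ler_wpM2l ?invr_ge0 ?sqr_ge0//.
    rewrite -exprMn -(real_normK (num_real (f _ _ - _ - _))).
    rewrite -(real_normK (num_real (L l * _))) ler_pXn2r ?nnegrE//.
    by rewrite normrM (ger0_norm (L_ge0 lK)).
rewrite ge0_integral_sum//; last 2 first.
- by move=> l; apply/measurable_EFinP; apply: measurable_funM => //; exact: mG.
- by move=> l w _; rewrite lee_fin mulr_ge0.
apply: (@le_trans _ _ (\sum_(l < k) (c * (L l * s l ^+ 2))%:E)%E); last first.
  by rewrite sumEFin lee_fin -mulr_sumr -(big_mkord xpredT (fun l => L l * s l ^+ 2)).
apply: lee_sum => l _; have lk := ltn_ord l.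
(* The random time of [t1] on one side, its driver together with all noise below [t2] on the
   other. *)
pose D1 : set (Theta * bool) := [set (t1, false)].
pose D2 : set (Theta * bool) := [set (t1, true)] `|` below t2.
have D12 : D1 `&` D2 = set0.
  rewrite -subset0 => -[i b] [[/= i1 b1] [[/= _ b2]|[eta /= i2]]].
    by rewrite b1 in b2.
  by apply: (t12 eta); rewrite -i2 -i1.
rewrite (ge0_integral_indicator_independent l mR (mG l lk) (G0 l)); last first.
  apply: (indep_obs D12); first exact: Rc_obs.
  have lK := leq_trans (ltnW lk) kK'.
  have mX : measurable_fun setT (X t1 k x l : obs D2 -> S).
    by apply: X_obs => //; [exact: ltnW|left].
  apply: measurable_funM => //; apply: measurable_funX; apply: measurable_funB.
    by apply: V_obs_at => //; exact: subsetUr.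
  exact: (measurableT_comp (v_meas lK) mX).
rewrite hitE// /G; under eq_integral do rewrite EFinM.
rewrite ge0_integralZl_EFin ?sqr_ge0//; last 2 first.
- by move=> w _; rewrite lee_fin sqr_ge0.
- by apply/measurable_EFinP; exact/measurable_funX/mV.
rewrite muleA -EFinM mulrA [leRHS]EFinM.
have [_ _ Hs] := Vs l lk.
apply: lee_pmul => //.
- by rewrite lee_fin mulr_ge0 ?sqr_ge0 ?hit_ge0.
- by apply: integral_ge0 => w _; rewrite lee_fin sqr_ge0.
- by rewrite lee_fin hit_weight.
Qed.

Lemma detached_same_size t1 t2 : size (val t1) = size (val t2) -> detached t1 t2.
Proof. by move=> s12 eta; exact: theta_cat_neq. Qed.

Let driver_clock_indep t : independent_maps P (driver t) (clock t).
Proof.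
apply: (indep_obs (D1 := [set (t, true)]) (D2 := [set (t, false)])).
- by rewrite -subset0 => -[i b] [[/= _ ->]] [].
- exact: observing_Y.
- exact: observing_Z.
Qed.

Let driver_same_law t t' : same_law P (driver t) (driver t').
Proof. by move=> A mA; case: driver_iid => _ _; apply. Qed.

Let clock_same_law t t' : same_law P (clock t) (clock t').
Proof. by move=> A mA; case: clock_iid => _ _; apply. Qed.

(** An increment is a fixed function of the driver and clock of [t1] and the tree of [t2]. These are
    independent, with laws not depending on the nodes, so the mean of a level can be computed at any
    pair. *)
Lemma incr_mean t1 t2 t1' t2' k j x : (k <= K)%N ->
  detached t1 t2 -> detached t1' t2' ->
  \int[P]_w incr t1 t2 k j x w = \int[P]_w incr t1' t2' k j x w.
Proof.
move=> kK t12 t12'.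
pose noise := @tree_noise _ _ (K.+1.-tuple S : measurableType _)
  (K.+1.-tuple nat : measurableType _).
(* Choice wants a functional for every [l]; from [k] on it is a dummy. *)
have /choice[G HG] : forall l, exists G : S * noise -> R, (l < k)%N ->
    measurable_fun setT G /\ forall t y w, V t l j y w = G (y, tree driver clock t w).
  move=> l; case: (ltnP l k) => lk; last by exists (fun=> 0).
  by have [G HG] := V_tree j (leq_trans (ltnW lk) kK); exists G.
pose H (z : (K.+1.-tuple S * K.+1.-tuple nat) * noise) : R :=
  \sum_(l < k) term k l (tnth z.1.2 (inord k)) (flow l (k - l) x z.1.1)
    (G l (flow l (k - l) x z.1.1, z.2)).
have mH : measurable_fun setT H.
  apply: measurable_sum => l; have lk := ltn_ord l.
  have lK := leq_trans (ltnW lk) kK; have [mG _] := HG l lk.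
  have hl : (l + (k - l) <= K)%N by rewrite subnKC// ltnW.
  have mfl : measurable_fun setT (fun z : (K.+1.-tuple S * K.+1.-tuple nat) * noise =>
      flow l (k - l) x z.1.1).
    exact: (measurableT_comp (measurable_fun_pair2 x (flow_meas hl))
      (measurableT_comp measurable_fst measurable_fst)).
  apply: (measurableT_comp (term_meas k lK)
    (g := fun z : (K.+1.-tuple S * K.+1.-tuple nat) * noise =>
      (tnth z.1.2 (inord k), (flow l (k - l) x z.1.1,
        G l (flow l (k - l) x z.1.1, z.2))))).
  apply: measurable_fun_pair.
    exact: (measurableT_comp (measurable_tnth _)
      (measurableT_comp measurable_snd measurable_fst)).
  apply: measurable_fun_pair => //; apply: (measurableT_comp mG).
  exact: measurable_fun_pair.
have E t t' w : incr t t' k j x w = H ((driver t w, clock t w), tree driver clock t' w).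
  rewrite /incr big_mkord; apply: eq_bigr => l _; have lk := ltn_ord l.
  by rewrite -X_flow ?(ltnW lk)// clockE// (HG l lk).2.
have mDC t : measurable_fun setT (fun w => (driver t w, clock t w)).
  by apply: measurable_fun_pair; [exact: driver_meas|exact: clock_meas].
have mT t : measurable_fun setT (tree driver clock t).
  exact: (tree_meas driver_iid clock_iid).
have mDCT t t' : measurable_fun setT (fun w => ((driver t w, clock t w), tree driver clock t' w)).
  exact: measurable_fun_pair.
have ind t t' : detached t t' -> independent_maps P (fun w => (driver t w, clock t w))
    (tree driver clock t').
  move=> tt'; apply: (indep_obs (D1 := [set ib | ib.1 = t]) (D2 := below t')).
  - by rewrite -subset0 => -[i b] [/= i1 [eta /= i2]]; apply: (tt' eta); rewrite -i2 -i1.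
  - by apply: measurable_fun_pair; [exact: observing_Y|exact: observing_Z].
  - exact: observing_tree.
congr fine; under eq_integral do rewrite E; under [RHS]eq_integral do rewrite E.
apply: (integral_same_law (mDCT t1 t2) (mDCT t1' t2') _ (h := fun z => (H z)%:E)).
  apply: same_law_pair => //; try exact: ind.
    apply: same_law_pair => //; do ?[exact: driver_meas|exact: clock_meas].
  exact: (tree_same_law driver_iid clock_iid clock_driver_indep).
exact/measurable_EFinP.
Qed.

Lemma meanE t k l h x : (l <= k <= K)%N -> measurable_fun setT h ->
  \int[P]_w h (X t k x l w) = mean k l h x.
Proof.
move=> /andP[lk kK] mh; congr fine.
apply: (integral_same_law (X_meas2 t x kK lk) (X_meas2 t0 x kK lk)
  (X_same_law t t0 x kK lk) (h := fun y => (h y)%:E)).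
exact/measurable_EFinP.
Qed.

(** Level [0] approximates by [0], and the increment is plain importance sampling of the sum: the
    probability [hit k l] cancels the weight [1 / pf k l]. *)
Lemma incr0_mean t1 t2 k x : (0 < k <= K)%N ->
  \int[P]_w incr t1 t2 k 0 x w =
  \sum_(0 <= l < k) (mean k l (f0 l) x - mean k l (gv l) x).
Proof.
move=> kK; have /andP[k0 kK'] := kK.
pose D l w := f0 l (X t1 k x l w) - gv l (X t1 k x l w).
pose s l := nrm k l (f0 l) x + nrm k l (gv l) x.
have lkK l : (l < k)%N -> (l <= k <= K)%N by move=> lk; rewrite (ltnW lk).
have lK l : (l < k)%N -> (l <= K)%N by move=> lk; exact: leq_trans (ltnW lk) kK'.
have D2 (l : 'I_k) : L2_le P (D l) (s l).
  have lk := ltn_ord l; apply: L2_le_sub; apply: nrm_L2 => //; try exact: lkK.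
  - exact: f0_meas (lK l lk).
  - exact: f0_finite_moment.
  - exact: gv_meas (lK l lk).
  - exact: gv_finite_moment (lK l lk).
have mR : measurable_fun setT (Rc t1 k).
  exact: (measurable_obs (Rc_obs (D := setT) kK' I)).
have I2 (l : 'I_k) : L2_le P (fun w => (Rc t1 k w == l)%:R) 1.
  apply: L2_le_mono (_ : L2_le P (fun=> 1) 1) => [|w|].
  - exact: (measurableT_comp (@nat_meas _ _ (fun r => (r == l)%:R : R)) mR).
  - by rewrite normr1 ger0_norm// lern1 leq_b1.
  - by have := L2_le_cst P 1; rewrite normr1.
transitivity (\int[P]_w \sum_(l < k) (pf k l)^-1 * ((Rc t1 k w == l)%:R * D l w)).
  apply: eq_Rintegral => w _; rewrite /incr big_mkord; apply: eq_bigr => l _.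
  have lk := ltn_ord l.
  by rewrite V0 ?lK// /term /D /f0 subr0 mulrAC [RHS]mulrC.
rewrite Rintegral_sum; last first.
  move=> l.
  exact: (integrableZl measurableT (pf k l)^-1 (L2_le_integrableM (I2 l) (D2 l))).
rewrite [RHS]big_mkord; apply: eq_bigr => l _; have lk := ltn_ord l.
rewrite RintegralZl//; last exact: (L2_le_integrableM (I2 l) (D2 l)).
rewrite (Rintegral_mul_independent (I2 l) (D2 l)); last first.
  have mi : measurable_fun setT (fun r : nat => (r == l)%:R : R) by exact: nat_meas.
  have mfg : measurable_fun setT (fun y => f0 l y - gv l y).
    by apply: measurable_funB; [exact: f0_meas (lK l lk)|exact: gv_meas (lK l lk)].
  apply: (independent_maps_comp mi mfg (Y1 := Rc t1 k) (Y2 := X t1 k x l)).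
  apply: (indep_obs (D1 := [set (t1, false)]) (D2 := [set (t1, true)])).
  - by rewrite -subset0 => -[i b] [[/= _ ->]] [].
  - exact: Rc_obs.
  - by apply: X_obs => //; exact: ltnW.
have -> : \int[P]_w D l w = mean k l (f0 l) x - mean k l (gv l) x.
  rewrite RintegralB//.
  - by rewrite !meanE ?lkK//; [exact: gv_meas (lK l lk)|exact: f0_meas (lK l lk)].
  - apply: L2_le_integrable (nrm_L2 _ _ (f0_meas (lK l lk)) (@f0_finite_moment l) _).
    exact: lkK.
  - apply: L2_le_integrable (nrm_L2 _ _ (gv_meas (lK l lk)) (gv_finite_moment (lK l lk)) _).
    exact: lkK.
have -> : \int[P]_w (Rc t1 k w == l)%:R = hit k l.
  have mA : measurable [set w | Rc t1 k w = l].
    by have := mR measurableT [set (l : nat)] Logic.I; rewrite setTI.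
  rewrite /Rintegral -[hit k l]/(fine (hit k l)%:E) -(hitE t1 l kK'); congr fine.
  rewrite -[RHS]mul1e -(integral_cst P mA 1%E) [RHS]integral_mkcond.
  apply: eq_integral => w _; rewrite patchE.
  by case: eqP => [rl|rl]; [rewrite mem_set|rewrite memNset].
rewrite mulrA; have [h0|/eqP h0] := eqVneq (hit k l) 0; last first.
  by rewrite (hit_pf kK lk h0) mulVf ?mul1r//; exact/eqP.
(* A time that is never sampled loses nothing: then [L l = 0], so [f l (y, a) - a] is constant in
   [a] and [f0 l] equals [gv l]. *)
rewrite h0 mulr0 mul0r; apply/esym/eqP; rewrite subr_eq0; apply/eqP.
apply: eq_Rintegral => w _; apply/eqP; rewrite -subr_eq0 -normr_le0.
have := f_lip (lK l lk) (X t0 k x l w) 0 (v l (X t0 k x l w)).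
by rewrite (hit0_L kK lk h0) mul0r subr0.
Qed.

Lemma first_term_L2 t k x m : (k <= K)%N ->
  L2_le P (first_term t k x m) (kap k x).
Proof.
move=> kK; apply: L2_le_add.
  by apply: nrm_L2 => //; exact: v0_finite_moment.
rewrite big_mkord.
apply: (L2_le_eq (X := fun w => \sum_(l < k) f0 l (X (theta_app t 0 m%:Z) k x l w))).
  by move=> w; rewrite big_mkord.
apply: L2_le_sum => l _; have lk := ltnW (ltn_ord l).
by apply: nrm_L2; [exact: f0_meas (leq_trans lk kK)|exact: f0_finite_moment|rewrite lk].
Qed.

Lemma first_term_mean t k x m : (k <= K)%N ->
  \int[P]_w first_term t k x m w =
  mean k 0 (v 0) x + \sum_(0 <= l < k) mean k l (f0 l) x.
Proof.
move=> kK; have iv t' : P.-integrable setT (EFin \o (fun w => v 0 (X t' k x 0 w))).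
  by apply: L2_le_integrable (nrm_L2 _ _ v0_meas v0_finite_moment _).
have if0 t' (l : 'I_k) : P.-integrable setT (EFin \o (fun w => f0 l (X t' k x l w))).
  have lk := ltnW (ltn_ord l).
  apply: L2_le_integrable (nrm_L2 _ _ (f0_meas (leq_trans lk kK)) (@f0_finite_moment l) _).
  by rewrite lk.
transitivity (\int[P]_w (v 0 (X (theta_app t 0 (- m%:Z)) k x 0 w) +
    \sum_(l < k) f0 l (X (theta_app t 0 m%:Z) k x l w))).
  by apply: eq_Rintegral => w _; rewrite /first_term big_mkord.
rewrite RintegralD//; last first.
  apply: eq_integrable (integrable_sum measurableT (index_enum 'I_k)
    (fun l _ => if0 (theta_app t 0 m%:Z) l)) => //.
  by move=> w _ /=; rewrite sumEFin.
rewrite meanE// Rintegral_sum// big_mkord; congr (_ + _); apply: eq_bigr => l _.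
have lk := ltnW (ltn_ord l).
by rewrite meanE ?lk//; exact: f0_meas (leq_trans lk kK).
Qed.

(** * Separating the samples of one average *)

Section blocks.
Variable theta : Theta.

(** The entry read off is the sample number appended to [theta]. Sample [m] uses nodes with [m] and
    with [-m], whence the absolute value. *)
Definition block (m : nat) : set (Theta * bool) :=
  [set ib | absz (nth 0 (val ib.1) (size (val theta)).+1) = m].

Lemma block_disjoint m m' : m != m' -> block m `&` block m' = set0.
Proof.
move=> /eqP mm'; rewrite -subset0 => ib [/= h1 h2]; apply: mm'.
exact: (etrans (esym h1) h2).
Qed.

Lemma block_root j (a : int) b : block `|a|%N (theta_app theta j a, b).
Proof.
by rewrite /block /= nth_cat ltnNge leqnSn /= subSn// subnn.
Qed.

Lemma block_below j (a : int) : below (theta_app theta j a) `<=` block `|a|%N.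
Proof.
move=> ib [eta /= ibE]; rewrite /block /= ibE /= -catA nth_cat ltnNge leqnSn /=.
by rewrite subSn// subnn.
Qed.

Lemma first_term_block k x m : (k <= K)%N ->
  measurable_fun setT (first_term theta k x m : obs (block m) -> R).
Proof.
move=> kK; apply: measurable_funD.
  apply: (measurableT_comp v0_meas); apply: X_obs => //.
  by have := block_root 0 (- m%:Z) true; rewrite abszN.
rewrite (_ : (fun w => _) = (fun w => \sum_(l < k) f0 l (X (theta_app theta 0 m%:Z) k x l w))).
  apply: measurable_sum => l; have lk := ltnW (ltn_ord l).
  apply: (measurableT_comp (f0_meas (leq_trans lk kK))); apply: X_obs => //.
  exact: (block_root 0 m%:Z true).
by apply/funext => w; rewrite big_mkord.
Qed.

Lemma incr_block k j a x m m' : (k <= K)%N -> `|m'|%N = m ->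
  measurable_fun setT (incr (theta_app theta a m%:Z) (theta_app theta a m') k j x
    : obs (block m) -> R).
Proof.
move=> kK m'm; apply: incr_obs => //; try exact: (block_root a m%:Z).
by rewrite -m'm; exact: block_below.
Qed.

End blocks.

(** The slope [M / c] trades the gain [1 / M] in [rho_sum] against the size [expR M] in [rho_le]. *)
Definition rho k := \prod_(0 <= l < k) (1 + M%:R / c * L l).

Lemma rho_ge1 k : (k <= K)%N -> 1 <= rho k.
Proof.
move=> kK; rewrite /rho big_nat.
elim/big_ind: _ => [|a b a1 b1|l /andP[_ lk]]; rewrite ?lexx//.
  exact: mulr_ege1.
by rewrite lerDl mulr_ge0 ?divr_ge0// L_ge0// ltnW// (leq_trans lk).
Qed.

(* [rho] is the discrete exponential making this sum telescope.
   For [c = 0] all the [L l] vanish, and both sides are [0]. *)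
Lemma rho_sum k : (k <= K)%N ->
  c * \sum_(0 <= l < k) L l * rho l <= c ^+ 2 / M%:R * rho k.
Proof.
move=> kK; have MR : 0 < M%:R :> R by rewrite ltr0n.
have [c0|c0] := eqVneq c 0; first by rewrite c0 mul0r expr0n/= !mul0r.
have E : (M%:R / c) * \sum_(0 <= l < k) L l * rho l = rho k - 1.
  elim: k {kK} => [|k IH]; first by rewrite /rho !big_nil mulr0 subrr.
  by rewrite big_nat_recr//= mulrDr IH /rho big_nat_recr//= -/(rho k); ring.
have -> : c * \sum_(0 <= l < k) L l * rho l =
    c ^+ 2 / M%:R * ((M%:R / c) * \sum_(0 <= l < k) L l * rho l).
  by field; rewrite c0 gt_eqF.
rewrite E; apply: ler_wpM2l; last by rewrite gerBl.
by rewrite divr_ge0 ?sqr_ge0// ltW.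
Qed.

(** Used with [a = 1] for the Gronwall factor [growth] and with [a = M / c] for the weight [rho]. *)
Lemma prod_expR_bound (a : R) k : (k <= K)%N -> 0 <= a ->
  \prod_(0 <= l < k) (1 + a * L l) <= expR (a * c).
Proof.
move=> kK a0; apply: (@le_trans _ _ (expR (a * \sum_(0 <= l < k) L l))); last first.
  by rewrite ler_expR ler_wpM2l// L_sum.
elim: k kK => [|k IH] kK; first by rewrite !big_nil mulr0 expR0.
have kK' := ltnW kK; rewrite !big_nat_recr//= [a * (_ + _)]mulrDr expRD.
have Lk := L_ge0 kK'; apply: ler_pM; rewrite ?IH ?expR_ge1Dx//.
  rewrite big_nat; apply: prodr_ge0 => l /andP[_ lk].
  by rewrite addr_ge0// mulr_ge0// L_ge0// ltnW// (leq_trans lk).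
by rewrite addr_ge0// mulr_ge0.
Qed.

Lemma growth_le k : (k <= K)%N -> growth k <= expR c.
Proof.
move=> kK; have := prod_expR_bound kK ler01; rewrite mul1r; apply: le_trans.
by rewrite le_eqVlt /growth; apply/orP; left; apply/eqP/eq_bigr => l _; rewrite mul1r.
Qed.

Lemma rho_le k : (k <= K)%N -> rho k <= expR M%:R.
Proof.
move=> kK; have Mc0 : 0 <= M%:R / c by rewrite divr_ge0.
apply: le_trans (prod_expR_bound kK Mc0) _; rewrite ler_expR.
have [->|c0] := eqVneq c 0; first by rewrite mulr0.
by rewrite divfK.
Qed.

(** The error at level [0] is at most [expR c] times [kap], and each level multiplies the bound by
    [(1 + 2 * c) / sqrt M]. *)
Definition rate n := expR c * (1 + 2 * c) ^+ n / Num.sqrt M%:R ^+ n.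

Lemma rate_ge0 n : 0 <= rate n.
Proof.
by rewrite divr_ge0 ?mulr_ge0 ?exprn_ge0 ?sqrtr_ge0 ?expR_ge0// addr_ge0// mulr_ge0.
Qed.

Let sM_ge1 : 1 <= Num.sqrt M%:R :> R.
Proof. by rewrite -[leLHS]sqrtr1 ler_wsqrtr// ler1n. Qed.

Let sM_gt0 : 0 < Num.sqrt M%:R :> R.
Proof. exact: lt_le_trans sM_ge1. Qed.

(** The bound on an increment in units of [kap]; the factor [c / sqrt M] is the root of the one in
    [rho_sum]. *)
Let noise_size n k := rate n * (c / Num.sqrt M%:R) * Num.sqrt (rho k).

(** The summands on the left are the fluctuation of the first terms, the fluctuations of the levels
    and the bias. All share the factor [T], and a geometric sum remains. *)
Let rate_recursion n k : (0 < n)%N -> (k <= K)%N ->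
  (Num.sqrt M%:R ^+ n)^-1 +
  (\sum_(1 <= j < n) (noise_size j k + noise_size j.-1 k) / Num.sqrt M%:R ^+ (n - j)
   + noise_size n.-1 k) <= rate n * Num.sqrt (rho k).
Proof.
move=> n0 kK; have sM1 := sM_ge1; have sM0 := sM_gt0.
set a := Num.sqrt M%:R in sM1 sM0 *.
have aE m : a ^+ m != 0 by rewrite expf_eq0 negb_and gt_eqF ?orbT.
have r1 : 1 <= Num.sqrt (rho k) by rewrite -[leLHS]sqrtr1 ler_wsqrtr// rho_ge1.
set r := Num.sqrt (rho k) in r1 *.
pose q : R := 1 + 2 * c.
have q1 : 1 <= q by rewrite lerDl mulr_ge0.
have q0 : 0 <= q by exact: le_trans q1.
have e1 : 1 <= expR c by rewrite (le_trans _ (expR_ge1Dx c))// lerDl.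
have e0 := expR_ge0 c.
pose T := r / a ^+ n.
have r0 : 0 <= r by exact: le_trans r1.
have T0 : 0 <= T by rewrite divr_ge0 ?exprn_ge0// ltW.
have EcT0 : 0 <= expR c * c * T by exact: mulr_ge0 (mulr_ge0 e0 c_ge0) T0.
have h1 : (a ^+ n)^-1 <= T.
  by rewrite /T -[leLHS]mul1r ler_wpM2r// invr_ge0 exprn_ge0// ltW.
(* The part of level [j] has a spare factor [1 / sqrt M], at most [1]; the part of level [j.-1] fits
   exactly. *)
have h2 j : (0 < j < n)%N ->
    (noise_size j k + noise_size j.-1 k) / a ^+ (n - j) <=
    (expR c * c * T) * (q ^+ j + q ^+ j.-1).
  case: j => // j /= jn; rewrite mulrDl mulrDr lerD//.
    rewrite /noise_size /rate -/a -/r -/q.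
    have -> : expR c * q ^+ j.+1 / a ^+ j.+1 * (c / a) * r / a ^+ (n - j.+1) =
        (expR c * c * T * q ^+ j.+1) * a^-1.
      rewrite /T -[in RHS](subnKC (ltnW jn)) [in RHS]exprD.
      by field; rewrite !aE gt_eqF.
    rewrite ler_piMr//; first exact: mulr_ge0 EcT0 (exprn_ge0 _ q0).
    by rewrite invf_le1.
  rewrite /noise_size /rate -/a -/r -/q le_eqVlt; apply/orP; left; apply/eqP.
  rewrite /T -[in RHS](subnKC (ltnW jn)) [in RHS]exprD [in RHS]exprS.
  by field; rewrite !aE gt_eqF.
have h3 : noise_size n.-1 k = (expR c * c * T) * q ^+ n.-1.
  rewrite /noise_size /rate -/a -/r -/q /T -[in RHS](prednK n0) [in RHS]exprS /=.
  by field; rewrite !aE gt_eqF.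
pose Q := \sum_(0 <= j < n) q ^+ j.
(* This identity dictates the base [q = 1 + 2 * c]. *)
have QE : 2 * c * Q = q ^+ n - 1.
  rewrite /Q; elim: (n) => [|m IH]; first by rewrite big_nil mulr0 expr0 subrr.
  by rewrite big_nat_recr//= mulrDr IH exprS /q; ring.
(* Every power of [q] below [n] occurs at most twice; the bias supplies the last missing power of
   the shifted sum. *)
have hQ : \sum_(1 <= j < n) (q ^+ j + q ^+ j.-1) + q ^+ n.-1 <= 2 * Q.
  rewrite big_split/= -addrA.
  have -> : \sum_(1 <= j < n) q ^+ j.-1 + q ^+ n.-1 = Q.
    have aux m : \sum_(1 <= j < m.+1) q ^+ j.-1 + q ^+ m = \sum_(0 <= j < m.+1) q ^+ j.
      by rewrite big_add1 /= [RHS]big_nat_recr.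
    by have := aux n.-1; rewrite prednK.
  rewrite mulr2n mulrDl !mul1r lerD2r /Q [leRHS]big_ltn// lerDr.
  by rewrite expr0.
apply: (@le_trans _ _ (T + (expR c * c * T) *
    (\sum_(1 <= j < n) (q ^+ j + q ^+ j.-1) + q ^+ n.-1))).
  rewrite lerD// h3 mulrDr lerD2r mulr_sumr big_nat [leRHS]big_nat.
  by apply: ler_sum => j; exact: h2.
apply: (@le_trans _ _ (T + (expR c * c * T) * (2 * Q))).
  by rewrite lerD2l ler_wpM2l.
have -> : expR c * c * T * (2 * Q) = expR c * T * (2 * c * Q) by ring.
rewrite QE.
have -> : rate n * r = expR c * T * q ^+ n.
  by rewrite /rate -/a -/q /T; field; rewrite aE.
have : 0 <= (expR c - 1) * T by rewrite mulr_ge0// subr_ge0.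
by lra.
Qed.

(** The claim is uniform in node, time and point because the induction hypothesis is applied at
    other nodes, earlier times and random positions. *)
Lemma V_error n t k x : (k <= K)%N ->
  L2_le P (fun w => V t k n x w - v k x) (rate n * Num.sqrt (rho k) * kap k x).
Proof.
elim/ltn_ind: n t k x => n IH t k x kK.
have kap0 := kap_ge0 k x.
have r1 : 1 <= Num.sqrt (rho k) by rewrite -[leLHS]sqrtr1 ler_wsqrtr// rho_ge1.
have [n0|n0] := posnP n.
  rewrite n0; apply: (L2_le_eq (X := fun=> - v k x)).
    by move=> w; rewrite V0// sub0r.
  apply: L2_le_weaken (L2_le_cst _ _); rewrite normrN.
  apply: le_trans (v_le_kap x kK) _; rewrite ler_wpM2r//.
  rewrite /rate !expr0 mulr1 divr1 -[leLHS]mulr1.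
  apply: ler_pM => //; first by rewrite (le_trans _ (growth_ge1 kK)).
  exact: growth_le.
(* At time [0] the scheme is exact: it averages copies of [v 0 x], and the increments are empty
   sums. *)
have [k0|k0] := posnP k.
  rewrite k0 in kK *; apply: (L2_le_eq (X := fun=> 0)).
    move=> w; rewrite V_decomp// n0 [X in _ = _ + X - _]big1 ?addr0; last first.
      move=> j _; rewrite big1 ?mulr0// => m _.
      by rewrite /incr !big_nil subrr.
    rewrite (eq_bigr (fun=> v 0 x)); last first.
      by move=> m _; rewrite /first_term big_nil addr0 X_start.
    rewrite sumr_const_nat subn1 /= -[v 0 x *+ _]mulr_natl natrX mulrA.
    rewrite mul1r mulVf ?mul1r ?subrr//.
    by rewrite expf_eq0 pnatr_eq0 negb_and -lt0n M_gt0 orbT.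
  have := L2_le_cst P 0; rewrite normr0; apply: L2_le_weaken.
  by apply: mulr_ge0 (kap_ge0 _ _); exact: mulr_ge0 (rate_ge0 _) (sqrtr_ge0 _).
have k0K : (0 < k <= K)%N by rewrite k0.
pose u j := noise_size j k * kap k x.
have incrL2 j t1 t2 : (j < n)%N -> detached t1 t2 ->
    L2_le P (incr t1 t2 k j x) (u j).
  move=> jn t12.
  apply: (incr_L2 k0K t12 (s := fun l => rate j * Num.sqrt (rho l) * kap k x)).
  - apply: mulr_ge0 kap0; apply: mulr_ge0 (sqrtr_ge0 _).
    exact: mulr_ge0 (rate_ge0 j) (divr_ge0 c_ge0 (sqrtr_ge0 _)).
  - have sq_rho l : (l <= K)%N -> Num.sqrt (rho l) ^+ 2 = rho l.
      by move=> lK; rewrite sqr_sqrtr// (le_trans ler01)// rho_ge1.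
    have -> : u j ^+ 2 = (rate j * kap k x) ^+ 2 * (c ^+ 2 / M%:R * rho k).
      rewrite /u /noise_size -[in RHS](sq_rho k kK) -[in RHS](sqr_sqrtr (ler0n R M)).
      by field; rewrite gt_eqF.
    have -> : c * (\sum_(0 <= l < k) L l * (rate j * Num.sqrt (rho l) * kap k x) ^+ 2) =
        (rate j * kap k x) ^+ 2 * (c * \sum_(0 <= l < k) L l * rho l).
      rewrite mulrCA; congr (_ * _); rewrite mulr_sumr big_nat [RHS]big_nat.
      apply: eq_bigr => l /andP[_ lk].
      by rewrite -[in RHS](sq_rho l (leq_trans (ltnW lk) kK)); ring.
    by rewrite ler_wpM2l ?sqr_ge0// rho_sum.
  - move=> l lk; have lK := leq_trans (ltnW lk) kK.
    apply: V_X_L2 => //; first by rewrite (ltnW lk).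
      exact: mulr_ge0 (rate_ge0 j) (sqrtr_ge0 _).
    by move=> y; exact: IH.
have det a b m m' : detached (theta_app t a m) (theta_app t b m').
  by apply: detached_same_size; rewrite /= !size_cat.
have det0 : detached t0 t0 by exact: detached_same_size.
pose delta j := \int[P]_w incr t0 t0 k j x w.
pose EA := mean k 0 (v 0) x + \sum_(0 <= l < k) mean k l (f0 l) x.
(* The first terms miss [v k x] in the mean by [delta 0], which cancels the lower end of the
   telescoping sum of the levels. *)
have EAv : EA - v k x = delta 0.
  rewrite /delta incr0_mean// v_expansion// /EA sumrB.
  by rewrite opprD addrACA subrr add0r.
pose A w := (M ^ n)%:R^-1 * (\sum_(1 <= m < (M ^ n).+1) first_term t k x m w) - EA.
pose D j m w := incr (theta_app t j%:Z m%:Z) (theta_app t j%:Z m%:Z) k j x w -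
  incr (theta_app t j%:Z m%:Z) (theta_app t j%:Z (- m%:Z)) k j.-1 x w.
pose B j w := (M ^ (n - j))%:R^-1 * (\sum_(1 <= m < (M ^ (n - j)).+1) D j m w) -
  (delta j - delta j.-1).
have Mpow m : (0 < M ^ m)%N by rewrite expn_gt0 M_gt0.
have sqrtM m : Num.sqrt (M ^ m)%:R = Num.sqrt M%:R ^+ m :> R.
  elim: m => [|m IHm]; first by rewrite expn0 expr0 sqrtr1.
  by rewrite expnS natrM sqrtrM ?ler0n// IHm exprS.
have AL2 : L2_le P A (kap k x / Num.sqrt M%:R ^+ n).
  rewrite -sqrtM; apply: L2_le_sample_mean => //.
  - by move=> m _; exact: first_term_L2.
  - by move=> m _; exact: first_term_mean.
  - move=> m m' _ _ mm'.
    by apply: (indep_obs (block_disjoint t mm')); exact: first_term_block.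
have BL2 j : (0 < j < n)%N ->
    L2_le P (B j) ((u j + u j.-1) / Num.sqrt M%:R ^+ (n - j)).
  move=> /andP[j0 jn]; have j1n : (j.-1 < n)%N by rewrite (leq_ltn_trans (leq_pred _)).
  rewrite -sqrtM; apply: L2_le_sample_mean => //.
  - by move=> m _; apply: L2_le_sub; exact: incrL2.
  - move=> m _; rewrite RintegralB//; last 2 first.
    + by apply: L2_le_integrable; exact: incrL2.
    + by apply: L2_le_integrable; exact: incrL2.
    by congr (_ - _); exact: incr_mean.
  - move=> m m' _ _ mm'.
    by apply: (indep_obs (block_disjoint t mm')); apply: measurable_funB;
      apply: incr_block => //; rewrite ?abszN.
apply: (L2_le_eq (X := fun w => A w + (\sum_(1 <= j < n) B j w + delta n.-1))).
  move=> w; rewrite V_decomp// n0 mul1r /A /B sumrB.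
  have -> : \sum_(1 <= j < n) (delta j - delta j.-1) = delta n.-1 - delta 0.
    case: (n) n0 => // m _; rewrite big_add1 /=.
    by elim: m => [|m IHm]; rewrite ?big_nil ?subrr// big_nat_recr//= IHm; ring.
  have -> : EA = delta 0 + v k x by rewrite -EAv subrK.
  rewrite natrX.
  have -> : \sum_(1 <= j < n) (M ^ (n - j))%:R^-1 *
      (\sum_(1 <= m < (M ^ (n - j)).+1) D j m w) =
      \sum_(1 <= j < n) M%:R ^- (n - j) *
      (\sum_(1 <= m < (M ^ (n - j)).+1) D j m w).
    by apply: eq_bigr => j _; rewrite natrX.
  by rewrite /D; ring.
apply: L2_le_weaken; last first.
  apply: L2_le_add AL2 (L2_le_add _ (L2_le_weaken _ (L2_le_cst P (delta n.-1)))).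
    apply: (L2_le_eq (X := fun w => \sum_(1 <= j < n | (1 <= j < n)%N) B j w)).
      by move=> w; rewrite [RHS]big_nat.
    by apply: L2_le_sum => j; exact: BL2.
  by apply: L2_le_mean; apply: incrL2 => //; rewrite prednK.
rewrite -big_nat.
have := rate_recursion n0 kK => /(ler_wpM2r kap0); apply: le_trans.
rewrite [leRHS]mulrDl [X in _ <= _ + X]mulrDl mulr_suml.
rewrite [(Num.sqrt M%:R ^+ n)^-1 * _]mulrC lerD2l lerD2r.
rewrite le_eqVlt; apply/predU1P; left.
by apply: eq_bigr => j _; rewrite /u; ring.
Qed.

(** * From mean square bounds to the stated expectations *)

Lemma sqr_poweR_half (s : R) : 0 <= s -> ((s ^+ 2)%:E `^ 2^-1)%E = s%:E.
Proof. by move=> s0; rewrite poweR_EFin powR12_sqrt ?sqr_ge0// sqrtr_sqr ger0_norm. Qed.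

Lemma expectation_sqrE (Z : Omega -> R) :
  'E_P[fun w => (`|Z w| ^+ 2)%R]%E = (\int[P]_w ((Z w) ^+ 2)%:E)%E.
Proof. by rewrite unlock; apply: eq_integral => w _; rewrite real_normK ?num_real. Qed.

Lemma L2_le_expectation (Z : Omega -> R) s : L2_le P Z s ->
  ('E_P[fun w => (`|Z w| ^+ 2)%R] `^ (2^-1)%R <= s%:E)%E.
Proof.
move=> [_ s0 Zs]; rewrite expectation_sqrE -(sqr_poweR_half s0).
apply: (gt0_ler_poweR _ _ _ Zs); rewrite ?invr_ge0// in_itv/= ?leey ?andbT ?lee_fin ?sqr_ge0//.
by apply: integral_ge0 => w _; rewrite lee_fin sqr_ge0.
Qed.

Lemma nrm_expectation k l h x : finite_moment l h -> (l <= k <= K)%N ->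
  ('E_P[fun w => (`|h (X t0 k x l w)| ^+ 2)%R] `^ (2^-1)%R)%E = (nrm k l h x)%:E.
Proof.
by move=> fh lkK; rewrite expectation_sqrE -nrm_sqE// sqr_poweR_half// nrm_ge0.
Qed.

Lemma kap_expectation k x : (k <= K)%N -> (kap k x)%:E =
  ('E_P[fun w => (`|v 0 (X t0 k x 0 w)| ^+ 2)%R] `^ (2^-1)%R +
   \sum_(0 <= l < k) 'E_P[fun w => (`|f l (X t0 k x l w, 0%R)| ^+ 2)%R] `^ (2^-1)%R)%E.
Proof.
move=> kK; rewrite EFinD -sumEFin -(nrm_expectation x v0_finite_moment)//.
congr (_ + _)%E; apply: eq_big_nat => l /andP[_ lk].
by rewrite -(nrm_expectation x (@f0_finite_moment l))// (ltnW lk).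
Qed.

Lemma expectation_error kappa n x : 0 <= kappa ->
  ('E_P[fun w => (`|v 0 (X t0 K x 0 w)| ^+ 2)%R] `^ (2^-1)%R +
   \sum_(0 <= l < K) 'E_P[fun w => (`|f l (X t0 K x l w, 0%R)| ^+ 2)%R] `^ (2^-1)%R
   <= kappa%:E)%E ->
  ('E_P[fun w => (`|V t0 K n x w - v K x| ^+ 2)%R] `^ (2^-1)%R <=
   (kappa * (1 + 2 * c) ^+ n * M%:R `^ (- (n%:R / 2)) * expR (M%:R / 2 + c))%:E)%E.
Proof.
rewrite -kap_expectation// lee_fin => kappa0 kapK.
have := L2_le_expectation (V_error n t0 x (leqnn K)).
move=> /le_trans; apply; rewrite lee_fin.
have M0 : 0 < M%:R :> R by rewrite ltr0n.
have sqrt_rho : Num.sqrt (rho K) <= expR (M%:R / 2).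
  rewrite -[leRHS]ger0_norm ?expR_ge0// -sqrtr_sqr ler_wsqrtr//.
  by rewrite expr2 -expRD -splitr rho_le.
have -> : M%:R `^ (- (n%:R / 2)) = (Num.sqrt M%:R ^+ n)^-1 :> R.
  rewrite powRN; congr (_^-1).
  by rewrite -powR12_sqrt ?ler0n// -powR_mulrn ?powR_ge0// -powRrM mulrC.
have rate0 : 0 <= rate n.
  by rewrite /rate !mulr_ge0 ?expR_ge0 ?invr_ge0 ?exprn_ge0 ?sqrtr_ge0// addr_ge0 ?mulr_ge0.
rewrite expRD [leRHS](_ : _ = rate n * expR (M%:R / 2) * kappa); last by rewrite /rate; ring.
apply: ler_pM => //.
- by rewrite mulr_ge0 ?sqrtr_ge0.
- exact: kap_ge0.
- by rewrite ler_wpM2l.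
Qed.

End mlp.

(** * Borel sets of products *)

Section borel_product.
Context {R : realType}.

Definition dense_sequence {T : pseudoMetricType R} (e : nat -> T) : Prop :=
  forall (x : T) (r : R), 0 < r -> exists n, ball x r (e n).

(** Separability makes rectangles of balls with dense centres and radii [1 / (m + 1)] a countable
    base; those not inside [O] are replaced by the empty set. Hence Borel sets of the product lie in
    the product of the Borel sigma-algebras. *)
Lemma open_prod_bigcup {T1 T2 : pseudoMetricType R} (e1 : nat -> T1)
    (e2 : nat -> T2) (O : set (T1 * T2)) :
  dense_sequence e1 -> dense_sequence e2 -> open O ->
  exists (A : nat * nat * nat -> set T1) (B : nat * nat * nat -> set T2),
    [/\ forall i, open (A i), forall i, open (B i) & O = \bigcup_i (A i `*` B i)].
Proof.
move=> d1 d2 oO.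
pose r (m : nat) : R := m.+1%:R^-1.
have r0 m : 0 < r m by rewrite invr_gt0 ltr0n.
(* Interiors, because balls of a pseudometric structure need not be open. *)
pose A1 (i : nat * nat * nat) := (ball (e1 i.1.1) (r i.2))^°.
pose B1 (i : nat * nat * nat) := (ball (e2 i.1.2) (r i.2))^°.
pose good i := `[< A1 i `*` B1 i `<=` O >].
exists (fun i => if good i then A1 i else set0), (fun i => if good i then B1 i else set0).
split.
- by move=> i; case: ifP => _; [exact: open_interior|exact: open0].
- by move=> i; case: ifP => _; [exact: open_interior|exact: open0].
have near_center (T : pseudoMetricType R) (z e : T) s : 0 < s ->
    ball z (s / 2) e -> (ball e s)^° z.
  move=> s0 ze; apply/nbhs_ballP; exists (s / 2) => /=; first by rewrite divr_gt0.
  move=> z' zz'; rewrite (splitr s); apply: ball_triangle zz'.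
  exact: ball_sym.
apply/seteqP; split => [[x y] Oxy|z [i _]]; last first.
  by case: ifP => [/asboolP gi /gi|_ []].
have [[C D] /= [nC nD] CDO] : nbhs (x, y) O by exact: open_nbhs_nbhs.
move: nC nD => /nbhs_ballP[c /= c0 cC] /nbhs_ballP[d /= d0 dD].
have cd0 : 0 < Num.min c d by rewrite lt_min c0.
(* With a centre within [r m / 2] of the point, the ball of radius [r m] around the centre stays
   within [3 / 2 * r m] of it. *)
have [m rm] : exists m, 2 * r m < Num.min c d.
  have := @archi_boundP _ (2 / Num.min c d) (divr_ge0 (ler0n R 2) (ltW cd0)).
  set m := Num.bound _ => hm; exists m.
  rewrite /r ltr_pdivrMr ?ltr0n// mulrC -ltr_pdivrMr//.
  by rewrite (lt_le_trans hm)// ler_nat.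
have r20 : 0 < r m / 2 by rewrite divr_gt0.
have [n1 h1] := d1 x _ r20; have [n2 h2] := d2 y _ r20.
have sub (T : pseudoMetricType R) (z e : T) (E : set T) s : Num.min c d <= s ->
    ball z s `<=` E -> ball z (r m / 2) e -> (ball e (r m))^° `<=` E.
  move=> ms zE ze z' /interior_subset ez'; apply: zE.
  apply: (@le_ball _ _ _ (r m / 2 + r m)).
    by rewrite (le_trans _ ms)// (le_trans _ (ltW rm))//; have := r0 m; lra.
  exact: ball_triangle ez'.
exists (n1, n2, m) => //.
have -> : good (n1, n2, m).
  apply/asboolP => -[x' y'] [/= hx hy]; apply: (CDO (x', y')); split => /=.
    by apply: (sub _ x _ C c _ cC h1) hx; rewrite ge_min lexx.
  by apply: (sub _ y _ D d _ dD h2) hy; rewrite ge_min lexx orbT.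
by split; exact: near_center.
Qed.

Lemma dense_sequence_real : exists e : nat -> R, dense_sequence e.
Proof.
exists (fun n => if @choice.unpickle rat n is Some q then ratr q else 0) => x r r0.
have [q] := @rat_in_itvoo R (x - r) (x + r) (ltac:(lra)).
rewrite in_itv/= => /andP[h1 h2]; exists (choice.pickle q); rewrite choice.pickleK.
by rewrite /ball /= ltr_distlC h1 h2.
Qed.

Lemma dense_sequence_rV d : exists e : nat -> 'rV[R]_d, dense_sequence e.
Proof.
exists (fun n => if @choice.unpickle 'rV[rat]_d n is Some q then map_mx ratr q else 0).
move=> x r r0.
have /choice[q Hq] : forall j : 'I_d, exists q : rat, ball (x 0 j) r (ratr q).
  move=> j; have [q] := @rat_in_itvoo R (x 0 j - r) (x 0 j + r) (ltac:(lra)).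
  by rewrite in_itv/= => /andP[h1 h2]; exists q; rewrite /ball /= ltr_distlC h1 h2.
exists (choice.pickle (\row_j q j)); rewrite choice.pickleK; split => // i j.
by rewrite !mxE (ord1 i); exact: Hq.
Qed.

(** The maps [j1] and [j2] decouple the sigma-algebra from the topology on the same carrier; both
    uses take identities. *)
Lemma open_prod_measurable {T1 T2 : pseudoMetricType R} {d1 d2 : measure_display}
    (M1 : measurableType d1) (M2 : measurableType d2)
    (j1 : M1 -> T1) (j2 : M2 -> T2) (O : set (T1 * T2)) :
  (exists e : nat -> T1, dense_sequence e) ->
  (exists e : nat -> T2, dense_sequence e) ->
  (forall A, open A -> measurable (j1 @^-1` A)) ->
  (forall A, open A -> measurable (j2 @^-1` A)) ->
  open O -> measurable [set z : M1 * M2 | O (j1 z.1, j2 z.2)].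
Proof.
move=> [e1 de1] [e2 de2] m1 m2 oO.
have [A [B [oA oB OE]]] := open_prod_bigcup de1 de2 oO.
have -> : [set z : M1 * M2 | O (j1 z.1, j2 z.2)] =
    \bigcup_i ((j1 @^-1` A i) `*` (j2 @^-1` B i)).
  by rewrite OE; apply/seteqP; split => z [i _ [/= h1 h2]]; exists i.
apply: countable_bigcupT_measurable => // i.
by apply: measurableX; [exact: m1|exact: m2].
Qed.

Lemma borel_open_measurable (T : ptopologicalType) (A : set T) :
  open A -> measurable (A : set (borel T)).
Proof. exact: sub_sigma_algebra. Qed.

Lemma continuous_borel_rV_measurable d (g : 'rV[R]_d * R -> R) : continuous g ->
  measurable_fun [set: borel 'rV[R]_d * R] g.
Proof.
move=> cg; apply: (measurability _ (RGenOpens.measurableE R)).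
move=> _ [_ [a [b ->] <-]]; rewrite setTI.
have oab : open (g @^-1` `]a, b[) by move/continuousP: cg; apply; exact: interval_open.
have := @open_prod_measurable 'rV[R]_d R _ _ (borel 'rV[R]_d) R id id _
  (dense_sequence_rV d) dense_sequence_real (@borel_open_measurable _) (@open_measurable R) oab.
by congr measurable; apply/seteqP; split => -[].
Qed.

(** [phi] is measurable for the Borel sets of the product, whereas composition with pairs needs the
    product sigma-algebra. *)
Lemma borel_rV_pair_measurable d (g : 'rV[R]_d * 'rV[R]_d -> 'rV[R]_d) :
  measurable_fun [set: borel ('rV[R]_d * 'rV[R]_d)%type]
    (g : borel ('rV[R]_d * 'rV[R]_d)%type -> borel 'rV[R]_d) ->
  measurable_fun [set: borel 'rV[R]_d * borel 'rV[R]_d] (g : _ -> borel 'rV[R]_d).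
Proof.
move=> mg _ A mA.
pose T2 := borel ('rV[R]_d * 'rV[R]_d)%type.
pose j (z : borel 'rV[R]_d * borel 'rV[R]_d) : T2 := z.
suff mid : measurable_fun setT j.
  have := mg measurableT A mA; rewrite !setTI => h.
  by have := mid measurableT _ h; rewrite setTI.
apply: (@measurability _ _ _ T2 setT j (@open ('rV[R]_d * 'rV[R]_d)%type) erefl).
move=> _ [U oU <-]; rewrite setTI.
have := @open_prod_measurable 'rV[R]_d 'rV[R]_d _ _
  (borel 'rV[R]_d) (borel 'rV[R]_d) id id U
  (dense_sequence_rV d) (dense_sequence_rV d)
  (@borel_open_measurable _) (@borel_open_measurable _) oU.
by congr measurable; apply/seteqP; split => -[].
Qed.

End borel_product.

(** * Cost of reaching a prescribed accuracy *)

Section cost.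
Context {R : realType}.

(** Divided by [(1 + g) * M ^+ n], the induction step is the inequality [geom]; with base [2] in
    place of [3] it would fail at [n = 2]. *)
Lemma cost_recursion (g M : R) (u : nat -> R) : 0 <= g -> 1 <= M ->
  (forall n, u n <= g * M ^+ n +
    \sum_(1 <= j < n) M ^+ (n - j) * (1 + g + u j + u j.-1)) ->
  forall n, u n <= (1 + g) * (3 * M) ^+ n.
Proof.
move=> g0 M1 hu; elim/ltn_ind => n IH.
have M0 : 0 <= M by rewrite (le_trans ler01).
have b0 : 0 <= 1 + g by rewrite addr_ge0.
have bMn : 0 <= (1 + g) * M ^+ n by rewrite mulr_ge0// exprn_ge0.
have geom : 1 + \sum_(1 <= j < n) (1 + 3 ^+ j + 3 ^+ j.-1) <= 3 ^+ n :> R.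
  elim: (n) => [|m IHm]; first by rewrite big_geq// addr0.
  case: m IHm => [|m] IHm; first by rewrite big_geq// addr0 expr1 ler1n.
  rewrite big_nat_recr//= addrA (le_trans (lerD IHm (lexx _)))// !exprS.
  have : 1 <= 3 ^+ m :> R by rewrite exprn_ege1// ler1n.
  by lra.
apply: le_trans (_ : _ <= (1 + g) * M ^+ n *
    (1 + \sum_(1 <= j < n) (1 + 3 ^+ j + 3 ^+ j.-1))) _.
  rewrite mulrDr mulr1 mulr_sumr; apply: le_trans (hu n) _.
  apply: lerD; first by rewrite ler_wpM2r ?exprn_ge0// lerDr.
  apply: ler_sum_nat => j /andP[j0 jn].
  have bound i : (i <= j)%N -> M ^+ (n - j) * u i <= (1 + g) * M ^+ n * 3 ^+ i.
    move=> ij; apply: le_trans (_ : _ <= M ^+ (n - j) * ((1 + g) * (3 * M) ^+ i)) _.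
      by rewrite ler_wpM2l ?exprn_ge0// IH// (leq_ltn_trans ij).
    rewrite exprMn -!mulrA [leLHS]mulrCA ler_wpM2l// mulrCA [leRHS]mulrC ler_wpM2l ?exprn_ge0//.
    by rewrite -exprD ler_weXn2l// -[leqRHS](subnK (ltnW jn)) leq_add2l.
  have := bound _ (leqnn j); have := bound _ (leq_pred j).
  have : M ^+ (n - j) * (1 + g) <= (1 + g) * M ^+ n.
    by rewrite mulrC ler_wpM2l// ler_weXn2l// leq_subr.
  by rewrite !mulrDr !mulr1; lra.
by rewrite exprMn [3 ^+ n * _]mulrC mulrA ler_wpM2l.
Qed.

Variables (A a : R).
Hypotheses (A_ge0 : 0 <= A) (a_ge1 : 1 <= a).

(** The error bound on the diagonal, with [n] both as level and as sample base, written as an [n]-th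
    power. *)
Definition err (n : nat) : R := A * (a * n%:R `^ (- 2^-1)) ^+ n.

Let a_ge0 : 0 <= a. Proof. exact: le_trans a_ge1. Qed.

Let err_base_ge0 (n : nat) : 0 <= a * n%:R `^ (- 2^-1).
Proof. by rewrite mulr_ge0 ?powR_ge0. Qed.

Lemma err_small (eps : R) : 0 < eps -> exists n, (0 < n)%N && (err n <= eps).
Proof.
move=> eps0.
(* [m1] brings the base below [1 / 2], and [m2] makes [A / 2 ^ n] at most [eps]. *)
pose m1 := Num.bound ((2 * a) `^ 2); pose m2 := Num.bound (A / eps).
exists (maxn m1 m2).+1; rewrite ltn0Sn/=; set n := (maxn m1 m2).+1.
have n0 : 0 < n%:R :> R by rewrite ltr0n.
have h1 : a * n%:R `^ (- 2^-1) <= 2^-1.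
  rewrite powRN ler_pdivrMr ?powR_gt0// ler_pdivlMl//.
  rewrite -[leLHS]powRr1 ?mulr_ge0// [X in _ `^ X](_ : _ = 2 * 2^-1); last by rewrite mulfV.
  rewrite powRrM ge0_ler_powR ?nnegrE ?powR_ge0 ?invr_ge0 ?ler0n//.
  apply/ltW/(lt_le_trans (archi_boundP (powR_ge0 _ _))).
  by rewrite ler_nat ltnW// ltnS leq_maxl.
apply: le_trans (_ : A * 2^-1 ^+ n <= _); first by rewrite ler_wpM2l// lerXn2r ?nnegrE.
rewrite exprVn ler_pdivrMr ?exprn_gt0// mulrC -ler_pdivrMr//.
have : A / eps <= m2%:R by rewrite ltW// archi_boundP// divr_ge0// ltW.
move=> /le_trans; apply; rewrite -natrX ler_nat.
by rewrite (leq_trans _ (ltnW (ltn_expl n _)))// ltnW// ltnS leq_maxr.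
Qed.

(* [3 (m+1)] to the power [m+1] is at most [3 * 12^m * m^m], and the error to
   the power [2 + delta] contributes [m^(-m(1 + delta/2))]. *)
Lemma cost_err_bounded (delta : R) : 0 < delta -> exists2 Q, 0 <= Q &
  forall m, (0 < m)%N -> (3 * m.+1%:R) ^+ m.+1 * err m `^ (2 + delta) <= Q.
Proof.
(* [D] collects [12] from the cost and [a] to the power [2 + delta] from the error. Beyond [m0] the
   decay [m ^ (- delta / 2)] beats [D]; up to [m0] the power is at most [D ^+ m0]. *)
move=> delta0; pose D := 12 * a `^ (2 + delta); pose m0 := Num.bound (D `^ (2 / delta)).
have d2 : 0 <= 2 + delta by rewrite addr_ge0// ltW.
have D1 : 1 <= D.
  have : 1 <= a `^ (2 + delta) by rewrite -[leLHS](powRr0 a) ler_powR.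
  by rewrite /D; lra.
have D0 : 0 <= D by rewrite (le_trans ler01).
exists (3 * A `^ (2 + delta) * D ^+ m0); first by rewrite !mulr_ge0 ?powR_ge0 ?exprn_ge0.
move=> m m_gt0; have mR : 0 < m%:R :> R by rewrite ltr0n.
have errE : err m `^ (2 + delta) =
    A `^ (2 + delta) * (a `^ (2 + delta) * m%:R `^ (- (delta / 2))) ^+ m / m%:R ^+ m.
  rewrite /err powRM ?exprn_ge0// -mulrA; congr (_ * _).
  rewrite -powR_mulrn// -powRrM [_ * (2 + delta)]mulrC powRrM powR_mulrn ?powR_ge0//.
  rewrite powRM ?powR_ge0// -powRrM -expr_div_n; congr (_ ^+ _); rewrite -mulrA; congr (_ * _).
  rewrite -[X in _ / X]powRr1 ?ler0n// -powRN -powRD; last by rewrite (gt_eqF mR) implybT.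
  by congr (_ `^ _); field.
rewrite errE.
(* One factor [m + 1] is at most [2 ^ m]; in the remaining [m] factors it is at most [2 * m]. *)
have base : (3 * m.+1%:R) ^+ m.+1 <= 3 * 12 ^+ m * m%:R ^+ m :> R.
  suff : ((3 * m.+1) ^ m.+1 <= 3 * 12 ^ m * m ^ m)%N by rewrite -(ler_nat R) !(natrX, natrM).
  rewrite expnS -!mulnA leq_mul2l/= (_ : 12 = 2 * (3 * 2))%N//.
  rewrite [X in (_ <= X * _)%N]expnMn -mulnA.
  apply: leq_mul; first exact: ltn_expl.
  rewrite -(expnMn (3 * 2)) leq_exp2r// -(mulnA 3) leq_mul2l/=.
  by rewrite mul2n -addnn -addn1 leq_add2l.
apply: le_trans (_ : 3 * A `^ (2 + delta) * (D * m%:R `^ (- (delta / 2))) ^+ m <= _).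
  rewrite [X in _ <= X](_ : _ = (3 * 12 ^+ m * m%:R ^+ m) *
    (A `^ (2 + delta) * (a `^ (2 + delta) * m%:R `^ (- (delta / 2))) ^+ m / m%:R ^+ m)).
    by rewrite ler_wpM2r// !mulr_ge0 ?invr_ge0 ?exprn_ge0 ?mulr_ge0 ?powR_ge0.
  rewrite /D -[12 * _ * _]mulrA [in LHS]exprMn; field.
  by rewrite expf_neq0// gt_eqF.
rewrite ler_wpM2l ?mulr_ge0 ?powR_ge0//.
have [mm0|m0m] := leqP m m0.
  apply: le_trans (_ : D ^+ m <= _); last by rewrite ler_weXn2l.
  rewrite lerXn2r ?nnegrE ?mulr_ge0 ?powR_ge0// ler_piMr//.
  by rewrite -[leRHS](powRr0 m%:R) ler_powR ?ler1n// oppr_le0 divr_ge0// ltW.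
apply: le_trans (_ : 1 <= _); last by rewrite exprn_ege1.
rewrite exprn_ile1 ?mulr_ge0 ?powR_ge0// powRN ler_pdivrMr ?powR_gt0// mul1r.
have -> : D = (D `^ (2 / delta)) `^ (delta / 2).
  rewrite -powRrM (_ : 2 / delta * (delta / 2) = 1) ?powRr1//.
  by field; rewrite gt_eqF.
rewrite ge0_ler_powR ?nnegrE ?powR_ge0 ?ler0n// ?divr_ge0 ?ltW//.
by rewrite (lt_trans (archi_boundP (powR_ge0 _ _)))// ltr_nat.
Qed.

(** [NN eps] is the least positive index with error at most [eps]. By minimality [eps] lies below
    the error at the preceding index, where [cost_err_bounded] compares it with the cost. *)
Lemma complexity : exists (NN : R -> nat) (Q : R -> R),
  [/\ forall eps, (0 < NN eps)%N,
      forall eps, 0 < eps -> err (NN eps) <= eps,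
      forall delta, 0 <= Q delta
    & forall delta eps, 0 < delta -> 0 < eps <= 1 ->
      (3 * (NN eps)%:R) ^+ NN eps <= Q delta * eps `^ (- (2 + delta))].
Proof.
have /choice[NN hN] : forall eps : R, exists n, (0 < n)%N /\ (0 < eps ->
    err n <= eps /\ forall m, (0 < m < n)%N -> eps < err m).
  move=> eps; have [eps0|eps0] := ltP 0 eps; last by exists 1%N.
  pose n := ex_minn (err_small eps0).
  exists n; rewrite /n; case: ex_minnP => k /andP[k0 ke] kmin.
  split => // _; split => // m /andP[m0 mk].
  by rewrite ltNge; apply/negP => me; have := kmin m; rewrite m0 me leqNgt mk => /(_ isT).
have /choice[Q hQ] : forall delta : R, exists q, 0 <= q /\ (0 < delta -> forall m, (0 < m)%N ->
    (3 * m.+1%:R) ^+ m.+1 * err m `^ (2 + delta) <= q).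
  move=> delta; have [delta0|delta0] := ltP 0 delta; last by exists 0.
  by have [q q0 hq] := cost_err_bounded delta0; exists q.
(* The summand [3] is the cost at [NN eps = 1], which has no positive predecessor. *)
exists NN, (fun delta => 3 + Q delta); split.
- by move=> eps; case: (hN eps).
- by move=> eps eps0; have [_ /(_ eps0)[]] := hN eps.
- by move=> delta; rewrite addr_ge0//; case: (hQ delta).
move=> delta eps delta0 /andP[eps0 eps1].
have [n0 /(_ eps0)[_ nmin]] := hN eps; have [Q0 /(_ delta0) hq] := hQ delta.
have d2 : 0 <= 2 + delta by rewrite addr_ge0// ltW.
rewrite powRN ler_pdivlMr ?powR_gt0//.
have [n1|n1] := leqP (NN eps) 1.
  have -> : NN eps = 1%N by apply/eqP; rewrite eqn_leq n1.
  have : eps `^ (2 + delta) <= 1.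
    by rewrite (le_trans (ge0_ler_powR d2 _ _ eps1)) ?nnegrE ?powR1// ltW.
  by rewrite expr1 mulr1; lra.
have m0 : (0 < (NN eps).-1)%N by rewrite -ltnS prednK.
have := hq _ m0; rewrite prednK// => h.
apply: (@le_trans _ _ (Q delta)); last by rewrite lerDr.
apply: le_trans h; rewrite ler_wpM2l ?exprn_ge0 ?mulr_ge0//.
rewrite ge0_ler_powR ?nnegrE//.
- exact: ltW.
- by rewrite mulr_ge0 ?exprn_ge0.
- by rewrite ltW// nmin// m0 ltn_predL.
Qed.

End cost.

Lemma err_rateE (R : realType) (kappa c : R) n :
  err (kappa * expR c) ((1 + 2 * c) * expR 2^-1) n =
  kappa * (1 + 2 * c) ^+ n * n%:R `^ (- (n%:R / 2)) * expR (n%:R / 2 + c).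
Proof.
have -> : n%:R `^ (- (n%:R / 2)) = (n%:R `^ (- 2^-1)) ^+ n :> R.
  by rewrite -powR_mulrn ?powR_ge0// -powRrM; congr (_ `^ _); field.
have -> : expR (n%:R / 2 + c) = expR 2^-1 ^+ n * expR c :> R.
  by rewrite expRD -expRM_natl mulrC.
by rewrite /err !exprMn; ring.
Qed.

Theorem theorem4p1
  (R : realType) (alpha gamma c kappa p : R)
  (alpha_ge0 : 0 <= alpha) (gamma_ge0 : 0 <= gamma) (c_ge0 : 0 <= c)
  (kappa_ge0 : 0 <= kappa) (p_ge0 : 0 <= p)
  (xi : forall d : nat, 'rV[R]_d)
  (L : nat -> nat -> nat -> R)
  (f : forall d : nat, nat -> nat -> 'rV[R]_d * R -> R)
  (f_cont : forall d K k : nat, (0 < d)%N -> (0 < K)%N -> (k <= K)%N ->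
    continuous (f d K k))
  (f_lip : forall d K k : nat, (0 < d)%N -> (0 < K)%N -> (k <= K)%N ->
    forall (x : 'rV[R]_d) (a b : R),
      `|(f d K k (x, a) - a) - (f d K k (x, b) - b)| <= L d K k * `|a - b|)
  (phi : forall d : nat, nat -> nat -> 'rV[R]_d * 'rV[R]_d -> 'rV[R]_d)
  (phi_meas : forall d K k : nat, (0 < d)%N -> (0 < K)%N -> (k <= K)%N ->
    measurable_fun [set: borel ('rV[R]_d * 'rV[R]_d)%type]
      (phi d K k : borel ('rV[R]_d * 'rV[R]_d)%type -> borel 'rV[R]_d))
  (disp : measure_display) (Omega : measurableType disp)
  (P : probability Omega R)
  (W : forall d : nat, nat -> Theta -> nat -> Omega -> 'rV[R]_d)
  (W_iid : forall d K : nat, (0 < d)%N -> (0 < K)%N ->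
    iid P (fun theta : Theta =>
      proc K (W d K theta : nat -> Omega -> borel 'rV[R]_d)))
  (W_indep : forall d K : nat, (0 < d)%N -> (0 < K)%N ->
    forall theta : Theta,
      mutually_independent P
        (fun k : 'I_K => W d K theta k : Omega -> borel 'rV[R]_d))
  (Rc : nat -> nat -> Theta -> nat -> Omega -> nat)
  (Rc_iid : forall d K : nat, (0 < d)%N -> (0 < K)%N ->
    iid P (fun theta : Theta => proc K (Rc d K theta)))
  (pf : nat -> nat -> nat -> nat -> R)
  (pf_gt0 : forall d K k l : nat, (0 < d)%N -> (0 < K)%N ->
    (0 < k <= K)%N -> 0 < pf d K k l)
  (Rc_le : forall (d K : nat) (theta : Theta) (k : nat) (w : Omega),
    (0 < d)%N -> (0 < K)%N -> (0 < k <= K)%N -> (Rc d K theta k w <= k - 1)%N)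
  (pf_eq : forall d K k l : nat,
    (0 < d)%N -> (0 < K)%N -> (0 < k <= K)%N -> (l < k)%N ->
    pf d K k l * fine (P [set w | Rc d K (theta_int 0) k w = l]) =
    `|fine (P [set w | Rc d K (theta_int 0) k w = l])| ^+ 2)
  (L_le : forall d K k l : nat,
    (0 < d)%N -> (0 < K)%N -> (0 < k <= K)%N -> (l < k)%N ->
    L d K l <= c * fine (P [set w | Rc d K (theta_int 0) k w = l]))
  (Rc_W_indep : forall d K : nat, (0 < d)%N -> (0 < K)%N ->
    independent_families P
      (fun theta : Theta => proc K (Rc d K theta))
      (fun theta : Theta =>
        proc K (W d K theta : nat -> Omega -> borel 'rV[R]_d)))
  (X : forall d : nat, nat -> Theta -> nat -> 'rV[R]_d -> nat ->
    Omega -> 'rV[R]_d)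
  (X_eq : forall (d K k : nat) (theta : Theta) (l : nat) (x : 'rV[R]_d)
      (w : Omega),
    (0 < d)%N -> (0 < K)%N -> (k <= K)%N -> (l <= k)%N ->
    X d K theta k x l w =
      if l == k then x
      else phi d K l (X d K theta k x l.+1 w, W d K theta l w))
  (v : forall d : nat, nat -> nat -> 'rV[R]_d -> R)
  (v_meas : forall d K k : nat, (0 < d)%N -> (0 < K)%N -> (k <= K)%N ->
    measurable_fun [set: borel 'rV[R]_d] (v d K k : borel 'rV[R]_d -> R))
  (moment_fin : forall (d K k : nat) (x : 'rV[R]_d),
    (0 < d)%N -> (0 < K)%N -> (0 < k <= K)%N ->
    ('E_P[fun w : Omega => (`|v d K 0%N (X d K (theta_int 0) k x 0%N w)| ^+ 2
        + \sum_(0 <= l < k) `|f d K l (X d K (theta_int 0) k x l w, 0)| ^+ 2)%R]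
     < +oo)%E)
  (moment_le : forall d K : nat, (0 < d)%N -> (0 < K)%N ->
    ('E_P[fun w : Omega =>
          (`|v d K 0%N (X d K (theta_int 0) K (xi d) 0%N w)| ^+ 2)%R]
        `^ (2^-1)%R
      + \sum_(0 <= l < K)
          'E_P[fun w : Omega =>
            (`|f d K l (X d K (theta_int 0) K (xi d) l w, 0)| ^+ 2)%R]
          `^ (2^-1)%R
     <= kappa%:E)%E)
  (v_eq : forall (d K k : nat) (x : 'rV[R]_d),
    (0 < d)%N -> (0 < K)%N -> (0 < k <= K)%N ->
    ((v d K k x)%:E = 'E_P[fun w : Omega =>
      f d K k.-1 (X d K (theta_int 0) k x k.-1 w,
                  v d K k.-1 (X d K (theta_int 0) k x k.-1 w))])%E)
  (V : forall d : nat, nat -> Theta -> nat -> nat -> nat ->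
    'rV[R]_d -> Omega -> R)
  (V_eq : forall (d K M n : nat) (theta : Theta) (k : nat) (x : 'rV[R]_d)
      (w : Omega),
    (0 < d)%N -> (0 < K)%N -> (0 < M)%N -> (k <= K)%N ->
    V d K theta k n M x w =
      (0 < n)%N%:R / M%:R ^+ n *
        \sum_(1 <= m < (M ^ n).+1)
          (v d K 0%N (X d K (theta_app theta 0 (- m%:Z)) k x 0%N w)
           + \sum_(0 <= l < k)
               f d K l (X d K (theta_app theta 0 m%:Z) k x l w, 0))
      + \sum_(1 <= j < n)
          (M%:R ^+ (n - j))^-1 *
          \sum_(1 <= m < (M ^ (n - j)).+1)
            let theta1 := theta_app theta j%:Z m%:Z in
            let theta2 := theta_app theta j%:Z (- m%:Z) in
            let r := Rc d K theta1 k w in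
            let Y := X d K theta1 k x r w in
            (0 < k)%N%:R / pf d K k r *
              (f d K r (Y, V d K theta1 r j M Y w)
               - V d K theta1 r j M Y w
               - f d K r (Y, V d K theta2 r j.-1 M Y w)
               + V d K theta2 r j.-1 M Y w))
  (C : nat -> nat -> nat -> nat -> R)
  (C_le : forall d K M n : nat, (0 < d)%N -> (0 < K)%N -> (0 < M)%N ->
    C d K M n <=
      gamma * K%:R `^ alpha * d%:R `^ p * M%:R ^+ n
      + \sum_(1 <= j < n) M%:R ^+ (n - j) *
          (1 + gamma * K%:R `^ alpha * d%:R `^ p
             + C d K M j + C d K M j.-1)) :
  (forall d K M N : nat, (0 < d)%N -> (0 < K)%N -> (0 < M)%N ->
    ('E_P[fun w : Omega =>
        (`|V d K (theta_int 0) K N M (xi d) w - v d K K (xi d)| ^+ 2)%R]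
       `^ (2^-1)%R
     <= (kappa * (1 + 2 * c) ^+ N * M%:R `^ (- (N%:R / 2))
           * expR (M%:R / 2 + c))%:E)%E)
  /\
  (exists (NN : R -> nat) (cc : R -> R),
    [/\ forall eps : R, 0 < eps <= 1 -> (0 < NN eps)%N,
        forall delta : R, 0 < delta <= 1 -> 0 <= cc delta
      & forall (d K : nat) (delta eps : R), (0 < d)%N -> (0 < K)%N ->
          0 < delta <= 1 -> 0 < eps <= 1 ->
          C d K (NN eps) (NN eps) <=
            cc delta * K%:R `^ alpha * d%:R `^ p * eps `^ (- (2 + delta))
          /\
          ('E_P[fun w : Omega =>
              (`|V d K (theta_int 0) K (NN eps) (NN eps) (xi d) w
                 - v d K K (xi d)| ^+ 2)%R]
             `^ (2^-1)%R
           <= eps%:E)%E]).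
Proof.
have error d K M N : (0 < d)%N -> (0 < K)%N -> (0 < M)%N ->
    ('E_P[fun w : Omega =>
        (`|V d K (theta_int 0) K N M (xi d) w - v d K K (xi d)| ^+ 2)%R]
       `^ (2^-1)%R
     <= (kappa * (1 + 2 * c) ^+ N * M%:R `^ (- (N%:R / 2))
           * expR (M%:R / 2 + c))%:E)%E.
  move=> d0 K0 M0.
  have f_meas k : (k <= K)%N -> measurable_fun [set: borel 'rV[R]_d * R] (f d K k).
    by move=> kK; apply: continuous_borel_rV_measurable; exact: f_cont.
  have phi_meas' k : (k <= K)%N ->
      measurable_fun [set: borel 'rV[R]_d * borel 'rV[R]_d]
        (phi d K k : _ -> borel 'rV[R]_d).
    by move=> kK; apply: borel_rV_pair_measurable; exact: phi_meas.
  have V_eq' n theta k (x : borel 'rV[R]_d) w (kK : (k <= K)%N) :=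
    @V_eq d K M n theta k x w d0 K0 M0 kK.
  exact: (@expectation_error _ _ (borel 'rV[R]_d) Omega R P K (f d K) f_meas (L d K)
    (fun k => @f_lip d K k d0 K0) (phi d K) phi_meas' (W d K) (W_iid d K d0 K0)
    (W_indep d K d0 K0) (X d K) (fun k theta l x w => @X_eq d K k theta l x w d0 K0)
    (v d K) (fun k => @v_meas d K k d0 K0) (fun k x => @moment_fin d K k x d0 K0)
    (fun k x => @v_eq d K k x d0 K0) c c_ge0 (Rc d K) (Rc_iid d K d0 K0) (pf d K)
    (fun theta k w => @Rc_le d K theta k w d0 K0)
    (fun k l => @pf_eq d K k l d0 K0) (fun k l => @L_le d K k l d0 K0)
    (Rc_W_indep d K d0 K0) M M0 (fun theta k n x w => V d K theta k n M x w) V_eq'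
    kappa N (xi d) kappa_ge0 (moment_le d K d0 K0)).
split; first exact: error.
have A0 : 0 <= kappa * expR c by rewrite mulr_ge0 ?expR_ge0.
have a1 : 1 <= (1 + 2 * c) * expR 2^-1.
  by rewrite mulr_ege1 ?lerDl ?mulr_ge0// -expR0 ler_expR invr_ge0.
have [NN [Q [NN0 NNerr Q0 NNcost]]] := complexity A0 a1.
exists NN, (fun delta => (1 + gamma) * Q delta); split => [eps _|delta _|] //.
  by rewrite mulr_ge0// addr_ge0.
move=> d K delta eps d0 K0 /andP[delta0 _] /andP[eps0 eps1]; split; last first.
  by apply: le_trans (error _ _ _ _ d0 K0 (NN0 eps)) _; rewrite lee_fin -err_rateE NNerr.
have big1 (b : R) (n : nat) : 0 <= b -> (0 < n)%N -> 1 <= n%:R `^ b.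
  by move=> b0 n0; rewrite -[leLHS](powRr0 n%:R) ler_powR// ler1n.
(* As this product is at least [1], the [1] in [1 + gamma * K ^ alpha * d ^ p] is absorbed into the
   factor [1 + gamma]. *)
have Kd1 : 1 <= K%:R `^ alpha * d%:R `^ p by rewrite mulr_ege1// big1.
have Kd0 := le_trans ler01 Kd1.
have g0 : 0 <= gamma * K%:R `^ alpha * d%:R `^ p by rewrite -mulrA mulr_ge0.
have M1 : 1 <= (NN eps)%:R :> R by rewrite ler1n.
apply: le_trans (cost_recursion g0 M1 (fun n => C_le d K _ n d0 K0 (NN0 eps)) _) _.
apply: le_trans (_ : _ <= (1 + gamma) * (K%:R `^ alpha * d%:R `^ p) *
    (Q delta * eps `^ (- (2 + delta)))) _; last first.
  by rewrite le_eqVlt; apply/predU1P; left; ring.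
apply: ler_pM; rewrite ?addr_ge0 ?exprn_ge0 ?mulr_ge0//.
  by rewrite mulrDl mul1r -mulrA lerD2r.
by apply: NNcost; rewrite ?eps0.
Qed.
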